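(* Let $1\le k<m$ be integers. Let $E\subset A(m,k)$ be a non-empty collection of non-vertical affine subspaces such that $\dim E\le1$ and $B=\bigcup_{P\in E}P\subset\mathbb{R}^m$ is Borel. Then $B$ has the Fubini property; that is, $\dim B=\beta+k$, where $\beta=\mathrm{ess}^{k}\text{-}\sup(\dim B_t)$. In particular, if $B$ is a Borel union of a non-empty collection of non-vertical $k$-dimensional affine subspaces of $\mathbb{R}^m$ with $\dim B<k+1$, then it has the Fubini property.
   Context: $\dim$ denotes Hausdorff dimension. $A(m,k)$ is the space of all $k$-dimensional affine subspaces of $\mathbb{R}^m$. Write $\mathbb{R}^m=\mathbb{R}^k\times\mathbb{R}^{m-k}$; $P\in A(m,k)$ is non-vertical if its orthogonal projection to $\mathbb{R}^k\times\{0\}$ is all of $\mathbb{R}^k\times\{0\}$. For $t\in\mathbb{R}^k$, $B_t=\{x\in\mathbb{R}^{m-k}:(t,x)\in B\}$, and (since $\mathrm{proj}_{\mathbb{R}^k}B=\mathbb{R}^k$ here) $\mathrm{ess}^{k}\text{-}\sup(\dim B_t)=\sup\{q\ge0:\mathcal{H}^k(\{t\in\mathbb{R}^k:\dim B_t>q\})>0\}$, with $\sup\emptyset=0$; $\mathcal{H}^k$ is $k$-dimensional Hausdorff measure. The dimension $\dim E$ is taken with respect to any natural metric on $A(m,k)$, i.e. any metric Lipschitz equivalent (bounded above and below by constant multiples) to $\delta(P_1,P_2)=\|\mathrm{proj}_{V_1}-\mathrm{proj}_{V_2}\|+|a_1-a_2|$, where $P_i=V_i+a_i$ with $V_i$ a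 $k$-dimensional linear subspace and $a_i\in V_i^\perp$, $\mathrm{proj}_{V}$ is orthogonal projection onto $V$, and $\|\cdot\|$ is the operator norm. *)

(* Defs.v *)
From HB Require Import structures.
From mathcomp Require Import all_boot all_order all_algebra.
From mathcomp Require Import all_classical all_reals all_analysis.

Set Implicit Arguments.
Unset Strict Implicit.
Unset Printing Implicit Defensive.

Import Order.TTheory GRing.Theory Num.Theory.
Import numFieldNormedType.Exports.

Local Open Scope classical_set_scope.
Local Open Scope ring_scope.

(* A metric is carried by an explicit distance function: the canonical norm of
   the library on row vectors is the maximum norm, not the Euclidean one, and
   the metric on the space of affine subspaces is not fixed. *)
Definition is_metric (R : realType) (T : Type) (d : T -> T -> R) : Prop :=
  [/\ forall x y, 0 <= d x y,
      forall x y, d x y = 0 <-> x = y,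
      forall x y, d x y = d y x &
      forall x y z, d x z <= d x y + d y z].

Definition lipschitz_equivalent (R : realType) (T : Type) (d d' : T -> T -> R)
    : Prop :=
  exists c C : R, [/\ 0 < c, 0 < C &
    forall x y, c * d' x y <= d x y /\ d x y <= C * d' x y].

Section Hausdorff.
Variables (R : realType) (T : Type) (d : T -> T -> R).
Local Open Scope ereal_scope.

Definition diameter (U : set T) : \bar R :=
  ereal_sup [set z | exists x y, [/\ U x, U y & z = (d x y)%:E]].

(* (diam U)^s, where the empty set has weight 0 for every s >= 0, and a
   one-point set has weight 1 for s = 0 (as 0 `^ 0 = 1). *)
Definition diam_pow (s : R) (U : set T) : \bar R :=
  if U == set0 then 0 else diameter U `^ s.

Definition hausdorff_premeasure (s delta : R) (A : set T) : \bar R :=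
  ereal_inf [set z | exists U : nat -> set T,
    [/\ A `<=` \bigcup_i U i,
        forall i, diameter (U i) <= delta%:E &
        z = \sum_(0 <= i <oo) diam_pow s (U i)]].

(* The unnormalized s-dimensional Hausdorff (outer) measure; the normalizing
   constant is irrelevant to whether a set is null. *)
Definition hausdorff_measure (s : R) (A : set T) : \bar R :=
  ereal_sup [set hausdorff_premeasure s delta A | delta in [set r : R | (0 < r)%R]].

Definition hausdorff_dim (A : set T) : \bar R :=
  ereal_inf [set s%:E | s in [set s : R | (0 <= s)%R /\ hausdorff_measure s A = 0]].

End Hausdorff.

Section Euclidean.
Variables (R : realType) (n : nat).
Implicit Types (x y : 'rV[R]_n) (V : {vspace 'rV[R]_n}).

Definition dot_product x y : R := \sum_(i < n) x ord0 i * y ord0 i.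

Definition eucl_norm x : R := Num.sqrt (dot_product x x).

Definition eucl_dist x y : R := eucl_norm (x - y).

Definition borel (B : set 'rV[R]_n) : Prop :=
  <<s [set U : set 'rV[R]_n | open U] >> B.

(* [xget] selects the unique y satisfying the condition. *)
Definition oproj V x : 'rV[R]_n :=
  xget 0 [set y | y \in V /\ forall v, v \in V -> dot_product (x - y) v = 0].

Definition operator_norm (f : 'rV[R]_n -> 'rV[R]_n) : R :=
  sup [set eucl_norm (f x) | x in [set x | eucl_norm x <= 1]].

End Euclidean.

(* A(m,k): each k-dimensional affine subspace of R^m is V + a for exactly one
   k-dimensional linear subspace V and exactly one a orthogonal to V, so that
   the type below is in bijection with the set of these subspaces through
   [points]. *)
Record affine_subspace (R : realType) (m k : nat) := AffineSubspace {
  direction : {vspace 'rV[R]_m};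
  offset : 'rV[R]_m;
  dim_direction : \dim direction = k;
  offset_orthogonal : forall v, v \in direction -> dot_product offset v = 0 }.

Definition points (R : realType) (m k : nat) (P : affine_subspace R m k) :
    set 'rV[R]_m :=
  [set v + offset P | v in [set v | v \in direction P]].

Definition affine_dist (R : realType) (m k : nat)
    (P1 P2 : affine_subspace R m k) : R :=
  operator_norm (fun x => oproj (direction P1) x - oproj (direction P2) x)
  + eucl_norm (offset P1 - offset P2).

(* R^k x R^n is 'rV_(k + n), with the pair (t, x) written [row_mx t x]. *)
Section Product.
Variables (R : realType) (k n : nat).

Definition non_vertical (P : affine_subspace R (k + n) k) : Prop :=
  [set row_mx (lsubmx x) (0 : 'rV[R]_n) | x in points P] =
  [set row_mx t (0 : 'rV[R]_n) | t in [set: 'rV[R]_k]].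

Definition slice (B : set 'rV[R]_(k + n)) (t : 'rV[R]_k) : set 'rV[R]_n :=
  [set x | B (row_mx t x)].

(* 0 is added to the set because [ereal_sup set0] is -oo, whereas the supremum
   of the empty set of dimensions is 0. *)
Definition ess_sup_slice_dim (B : set 'rV[R]_(k + n)) : \bar R :=
  ereal_sup ([set 0%E] `|` [set q%:E | q in [set q : R | 0 <= q /\
    (0 < hausdorff_measure (@eucl_dist R k) k%:R
       [set t | (q%:E < hausdorff_dim (@eucl_dist R n) (slice B t))%E])%E]]).

Definition fubini_property (B : set 'rV[R]_(k + n)) : Prop :=
  (hausdorff_dim (@eucl_dist R (k + n)) B = ess_sup_slice_dim B + k%:R%:E)%E.

End Product.

(* Main.v *)
(* Idea.  The nontrivial inequality is [dim B <= k + beta]; the other one is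
   Eilenberg's inequality.  A non-vertical subspace is the graph of an affine map
   [t |-> M t], so [E] becomes a set of matrices, and [dim B <= k + dim E].  It
   remains to see that [beta >= min (dim E, 1)].  No measurability of [E] is
   available, only that of [B].

   Suppose that [E] has positive s'-dimensional net content for an [s' < 1], and
   that [B_t] is H^s-null for almost all [t] in the unit cube, with [s < s'].  For
   a set [X] let [c X] be the net content of the family of the [P] in [E] whose
   part over [X] has measure more than 3/4.  Net contents are continuous along
   increasing sequences of arbitrary sets, so Choquet's argument applies to [c]
   and the Souslin set [B]: there are closed sets [C_j] decreasing to a subset of
   [B] with [c C_j] bounded below.  By compactness, for some [j] and for most
   dyadic cubes [Q] of level [j] the part of [C_j] over [Q] is covered by
   finitely many balls of radius at least [2^-j] and small total cost.  Take a
   Frostman measure at scale [2^-j] on finitely many elements of the family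
   defining [c C_j].  By transversality the proportion of the cubes over which
   the graphs of [M] and [M'] are [delta]-close is at most a constant times
   [delta / |M - M'|], which bounds the average energy of the slices of this
   measure and contradicts the cheap covers. *)
Require Import Defs.
From mathcomp Require Import all_boot all_order all_algebra.
From mathcomp Require Import all_classical all_reals all_analysis.
From mathcomp Require Import zify ring lra.

Set Implicit Arguments.
Unset Strict Implicit.
Unset Printing Implicit Defensive.

Import Order.TTheory GRing.Theory Num.Theory.
Import numFieldNormedType.Exports.

Local Open Scope classical_set_scope.
Local Open Scope ring_scope.

(** * Contents defined by countable covers *)

(** The threshold 1 comes from transversality. Two distinct affine graphs may meet over a hyperplane
    of R^k, so the proportion of cubes over which they are delta-close is linear in
    [delta / |M - M'|] and no better. Summed over dyadic shells against a measure whose balls of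
    radius [r] have mass at most [r^s'], this gives a geometric series of ratio [2 * 2^-s'],
    dominated by its smallest scale because [s' < 1].

    As [E] may be non-measurable, integration over parameters or times is avoided: measures are
    finitely supported and averages over times are counts of words of a fixed length. The contents
    live on trees of binary expansions, one tree for the matrices and one for the times. Their
    cylinders are nested, so a cheap cover splits exactly among the children of a node; hence the
    continuity along increasing sequences holds with no loss of constant. On the tree of times, with
    ratio [2^-k], the same content plays the part of Lebesgue outer measure, so that one continuity
    lemma serves both variables. *)

Lemma ler_sum_subset (R : realDomainType) (K : eqType) (s t : seq K)
    (g : K -> R) :
  uniq s -> uniq t -> {subset s <= t} -> (forall x, 0 <= g x) ->
  \sum_(x <- s) g x <= \sum_(x <- t) g x.
Proof.
move=> us ut st g0.
rewrite [leRHS](bigID (mem s)) /=.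
have -> : \sum_(x <- t | x \in s) g x = \sum_(x <- s) g x.
  rewrite -big_filter; apply: perm_big; apply: uniq_perm; rewrite ?filter_uniq //.
  by move=> x; rewrite mem_filter; case: (boolP (x \in s)) => [/st ->|].
by rewrite lerDl sumr_ge0.
Qed.

Lemma sum_geo_half (R : realType) (d : R) (n : nat) : 0 <= d ->
  \sum_(i < n) d * 2^-1 ^+ i.+1 <= d.
Proof.
move=> d0; rewrite -mulr_sumr ler_piMr //.
have -> : \sum_(i < n) 2^-1 ^+ i.+1 = 1 - 2^-1 ^+ n :> R.
  elim: n => [|n IH]; first by rewrite big_ord0 expr0 subrr.
  rewrite big_ord_recr /= IH exprS.
  by lra.
by rewrite gerBl exprn_ge0.
Qed.

(** As the sequences are monotone, one late index brings all of the finitely many terms close to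
    their suprema. *)
Lemma ler_sum_sup (R : realType) (K : Type) (s : seq K) (x : K -> nat -> R)
    (b : R) :
  (forall c, {homo x c : m n / (m <= n)%N >-> m <= n}) ->
  (forall c, has_ubound (range (x c))) ->
  (forall n, \sum_(c <- s) x c n <= b) ->
  \sum_(c <- s) sup (range (x c)) <= b.
Proof.
move=> hx hb hs; apply/ler_addgt0Pr => e e0.
have [M HM] : exists M, forall n, (M <= n)%N ->
    \sum_(c <- s) sup (range (x c)) <= \sum_(c <- s) x c n + e.
  elim: s {hs} e e0 => [|c s IH] e e0.
    by exists 0%N => n _; rewrite !big_nil add0r ltW.
  have e2 : 0 < e / 2 by rewrite divr_gt0.
  have [M1 H1] := IH _ e2.
  have hs : has_sup (range (x c)) by split => //; exists (x c 0%N), 0%N.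
  have [_ [M2 _ <-] H2] := sup_adherent e2 hs.
  exists (maxn M1 M2) => n; rewrite geq_max => /andP[n1 n2].
  rewrite !big_cons; have := H1 n n1; have := hx c _ _ n2; lra.
by apply: le_trans (HM M (leqnn _)) _; rewrite lerD2r.
Qed.

Section Content.
Variables (R : realType) (I T : Type) (S : I -> set T) (W : I -> R).

(* Costs are real and sums are bounded through their partial sums; a finite
   cover is padded with sets of arbitrarily small cost. *)
Definition covered (e : R) (A : set T) :=
  exists u : nat -> I, A `<=` \bigcup_i S (u i) /\
    forall n, \sum_(i < n) W (u i) <= e.

(** An upper bound on the infimum of the costs of covers, stated with a slack so that no infimum is
    formed and the cost of padding vanishes. *)
Definition content_le (e : R) (A : set T) := forall d, 0 < d -> covered (e + d) A.

Lemma covered_le e e' A A' : e <= e' -> A' `<=` A -> covered e A -> covered e' A'.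
Proof.
move=> ee AA [u [uA ue]]; exists u; split; first exact: subset_trans uA.
by move=> n; apply: le_trans (ue n) _.
Qed.

Lemma content_le_le e e' A A' :
  e <= e' -> A' `<=` A -> content_le e A -> content_le e' A'.
Proof.
by move=> ee AA h d d0; apply: covered_le (h d d0) => //; rewrite lerD2r.
Qed.

Lemma content_le_inf e A : (forall d, 0 < d -> content_le (e + d) A) -> content_le e A.
Proof.
move=> h d d0; have d2 : 0 < d / 2 by rewrite divr_gt0.
by have := h _ d2 _ d2; rewrite -addrA -splitr.
Qed.

Hypothesis W0 : forall i, 0 <= W i.
Hypothesis Wsmall : forall e, 0 < e -> exists i, W i <= e.

Lemma content_le_ge0 e A : content_le e A -> 0 <= e.
Proof.
by move=> h; apply/ler_addgt0Pr => d /h [u [_ /(_ 0%N)]]; rewrite big_ord0.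
Qed.

Lemma content_le_single i : content_le (W i) (S i).
Proof.
move=> d d0.
have /choice[f Hf] : forall j : nat, exists k, W k <= d * 2^-1 ^+ j.+1.
  by move=> j; apply: Wsmall; rewrite mulr_gt0// exprn_gt0.
exists (fun j => if j is j.+1 then f j else i); split.
  by move=> x Sx; exists 0%N.
case=> [|n]; first by rewrite big_ord0 addr_ge0 // ltW.
rewrite big_ord_recl /= lerD2l.
apply: le_trans (sum_geo_half n (ltW d0)); exact: ler_sum.
Qed.

Lemma content_le_set0 e : 0 <= e -> content_le e set0.
Proof.
move=> e0; apply: content_le_inf => d d0; have [i Wi] := Wsmall d0.
apply: content_le_le (content_le_single i) => //.
by rewrite (le_trans Wi)// lerDr.
Qed.

Lemma covered_bigcup (e : nat -> R) b (A : nat -> set T) :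
  (forall i, covered (e i) (A i)) -> (forall n, \sum_(i < n) e i <= b) ->
  covered b (\bigcup_i A i).
Proof.
move=> /choice[u Hu] eb.
have /card_set_bijP[f [_ finj fsurj]] : ([set: nat] #= [set: nat * nat])%card.
  by rewrite card_eq_sym; exact: card_nat2.
exists (fun i => u (f i).1 (f i).2); split.
  move=> x [i _ Ax]; have [j _ Sx] := (Hu i).1 x Ax.
  by have [m _ fm] := fsurj (i, j) Logic.I; exists m => //=; rewrite fm.
move=> n.
(* The first [n] pairs lie in an [N] by [N] square, over which the cost can be summed row by row. *)
pose N := (\max_(i < n) maxn (f i).1 (f i).2).+1.
pose t := [seq (a, b) | a <- iota 0 N, b <- iota 0 N].
have -> : \sum_(i < n) W (u (f i).1 (f i).2) =
    \sum_(p <- [seq f i | i <- iota 0 n]) W (u p.1 p.2).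
  by rewrite big_map -(big_mkord xpredT (fun i => W (u (f i).1 (f i).2))) /index_iota subn0.
apply: (@le_trans _ _ (\sum_(p <- t) W (u p.1 p.2))).
  apply: ler_sum_subset => //.
  - rewrite map_inj_in_uniq ?iota_uniq // => i j _ _; apply: finj; exact: mem_set.
  - by rewrite allpairs_uniq ?iota_uniq // => -[? ?] [? ?].
  - move=> p /mapP[i]; rewrite mem_iota add0n => /= lin ->.
    apply/allpairsP; exists (f i); split; last by case: (f i).
      rewrite mem_iota /= add0n ltnS.
      apply: leq_trans (leq_bigmax (Ordinal lin)) => /=; exact: leq_maxl.
    rewrite mem_iota /= add0n ltnS.
    apply: leq_trans (leq_bigmax (Ordinal lin)) => /=; exact: leq_maxr.
rewrite big_allpairs_dep /=.
apply: le_trans (eb N); rewrite -(big_mkord xpredT e) /index_iota subn0.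
apply: ler_sum => i _.
apply: le_trans ((Hu i).2 N).
by rewrite -(big_mkord xpredT (fun j => W (u i j))) /index_iota subn0.
Qed.

Lemma content_le_bigcup (e : nat -> R) b (A : nat -> set T) :
  (forall i, content_le (e i) (A i)) -> (forall n, \sum_(i < n) e i <= b) ->
  content_le b (\bigcup_i A i).
Proof.
move=> H eb d d0; apply: (@covered_bigcup (fun i => e i + d * 2^-1 ^+ i.+1)).
  by move=> i; apply: H; rewrite mulr_gt0 // exprn_gt0.
by move=> n; rewrite big_split /=; apply: lerD; [exact: eb | apply: sum_geo_half; exact: ltW].
Qed.

Lemma content_le_setU e e' A A' :
  content_le e A -> content_le e' A' -> content_le (e + e') (A `|` A').
Proof.
move=> h h'.
apply: (@content_le_le _ _ (\bigcup_i (if i is i'.+1 then if i' is 0%N then A' else set0 else A))) => [||].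
- exact: lexx.
- by move=> x [Ax|Ax]; [exists 0%N | exists 1%N].
apply: (@content_le_bigcup (fun i => if i is i'.+1 then if i' is 0%N then e' else 0 else e)).
  by case=> [|[|i]] //; apply: content_le_set0.
have e0 := content_le_ge0 h; have e'0 := content_le_ge0 h'.
case=> [|[|n]]; rewrite ?big_ord0 ?addr_ge0 //.
  by rewrite big_ord_recl big_ord0 addr0 lerDl.
by rewrite !big_ord_recl /= big1 ?addr0.
Qed.

Lemma content_le_bigsum (K : eqType) (s : seq K) (e : K -> R) (A : K -> set T) (B : set T) :
  (forall c, c \in s -> content_le (e c) (A c)) ->
  (forall x, B x -> exists2 c, c \in s & A c x) ->
  content_le (\sum_(c <- s) e c) B.
Proof.
elim: s B => [|c s IH] B H HB.
  rewrite big_nil; apply: content_le_le (content_le_set0 (lexx 0)) => //.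
  by move=> x /HB[].
rewrite big_cons.
apply: (@content_le_le _ _ (A c `|` (B `\` A c))); [exact: lexx| |].
  by move=> x Bx; have [|] := pselect (A c x); [left|right].
apply: content_le_setU; first by apply: H; rewrite mem_head.
apply: IH => [c' c's|x [Bx nAx]]; first by apply: H; rewrite inE c's orbT.
have [c'] := HB _ Bx; rewrite inE => /orP[/eqP ->//|]; by exists c'.
Qed.

End Content.

(** * Net content on a tree *)

Section Tree.
Variables (R : realType) (F : finType) (c0 : F) (rho : R).
Hypotheses (rho0 : 0 < rho) (rho1 : rho < 1).
Implicit Types (v w : seq F) (x : nat -> F) (A : set (nat -> F)).

Definition cyl v : set (nat -> F) := [set x | mkseq x (size v) = v].

Definition cylw v : R := rho ^+ size v.

Definition tree_content A : R := inf [set e | content_le cyl cylw e A].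

Local Notation h := tree_content.

Lemma cyl_mkseq x n : cyl (mkseq x n) x.
Proof. by rewrite /cyl /= size_mkseq. Qed.

Lemma cyl_rcons v c x : cyl (rcons v c) x <-> cyl v x /\ x (size v) = c.
Proof.
rewrite /cyl /= size_rcons mkseqS; split=> [/rcons_inj[-> ->] //|[-> ->] //].
Qed.

Lemma take_mkseq x m n : (m <= n)%N -> take m (mkseq x n) = mkseq x m.
Proof. by move=> mn; rewrite /mkseq -map_take take_iota (minn_idPl mn). Qed.

Lemma cyl_prefix v w x : (size v <= size w)%N -> cyl w x -> cyl v x <-> prefix v w.
Proof.
move=> vw xw; rewrite prefixE -xw take_mkseq // /cyl /=.
by split=> [->|/eqP].
Qed.

Lemma cylw_ge0 v : 0 <= cylw v.
Proof. by rewrite /cylw exprn_ge0 // ltW. Qed.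

Lemma exists_expr_le (e : R) : 0 < e -> exists n, rho ^+ n <= e.
Proof.
move=> e0.
have : rho ^+ n @[n --> \oo] --> (0 : R) by apply: cvg_expr; rewrite gtr0_norm.
move=> /cvgrPdist_le /(_ _ e0) [n _ /(_ n (leqnn n))] /=.
by rewrite sub0r normrN ger0_norm ?exprn_ge0 ?(ltW rho0) //; exists n.
Qed.

Lemma cylw_small (e : R) : 0 < e -> exists v, cylw v <= e.
Proof.
by move=> /exists_expr_le [n ne]; exists (nseq n c0); rewrite /cylw size_nseq.
Qed.

Let csingle := content_le_single cyl cylw_ge0 cylw_small.

Let cset0 := content_le_set0 cyl cylw_ge0 cylw_small.

Let cbig := @content_le_bigcup R (seq F) (nat -> F) cyl _ cylw_ge0.

Lemma content_le1 A : content_le cyl cylw 1 A.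
Proof.
apply: content_le_le (csingle [::]) => //.
Qed.

Lemma tree_content_le e A : content_le cyl cylw e A -> h A <= e.
Proof.
move=> eA; apply: ge_inf => //; exists 0 => y /=; exact: content_le_ge0.
Qed.

Lemma tree_contentP A : content_le cyl cylw (h A) A.
Proof.
apply: content_le_inf => d d0.
have : has_inf [set e | content_le cyl cylw e A].
  split; first by exists 1; exact: content_le1.
  by exists 0 => y /=; exact: content_le_ge0.
move=> /(inf_adherent d0) [e /= eA ed].
by apply: content_le_le eA => //; exact: ltW.
Qed.

Lemma tree_content_leP e A : h A <= e <-> content_le cyl cylw e A.
Proof.
split; last exact: tree_content_le.
by move=> he; apply: content_le_le (tree_contentP A).
Qed.

Lemma tree_content_ge0 A : 0 <= h A.
Proof. exact: content_le_ge0 (tree_contentP A). Qed.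

Lemma tree_content_mono A A' : A `<=` A' -> h A <= h A'.
Proof.
by move=> AA; apply: tree_content_le; apply: content_le_le (tree_contentP A').
Qed.

Lemma tree_content_cyl v A : A `<=` cyl v -> h A <= rho ^+ size v.
Proof.
move=> Av; apply: tree_content_le.
by apply: content_le_le (csingle v).
Qed.

Lemma tree_content_le1 A : h A <= 1.
Proof. exact: tree_content_le (content_le1 A). Qed.

Lemma tree_content0 A : A `<=` set0 -> h A = 0.
Proof.
move=> A0; apply/eqP; rewrite eq_le tree_content_ge0 andbT.
apply: tree_content_le.
by apply: content_le_le (cset0 (lexx 0)).
Qed.

Lemma tree_content_setU A A' : h (A `|` A') <= h A + h A'.
Proof.
apply: tree_content_le; apply: content_le_setU => //;
  [exact: cylw_ge0 | exact: cylw_small | exact: tree_contentP..].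
Qed.

Lemma tree_content_split A v :
  h (A `&` cyl v) <= \sum_c h (A `&` cyl (rcons v c)).
Proof.
apply: tree_content_le; apply: content_le_bigsum;
  [exact: cylw_ge0 | exact: cylw_small | move=> c _; exact: tree_contentP |].
move=> x [Ax xv]; exists (x (size v)); first by rewrite mem_index_enum.
by split=> //; apply/cyl_rcons.
Qed.

(** A cover cheaper than the cost of [v] has no member of length at most [size v], since one such
    cylinder already costs too much. So every member meeting [cyl v] lies below a single child, and
    the cover splits into covers of the children. *)
Lemma tree_content_children A v : h (A `&` cyl v) < rho ^+ size v ->
  \sum_c h (A `&` cyl (rcons v c)) <= h (A `&` cyl v).
Proof.
move=> hlt; set a := h (A `&` cyl v) in hlt *.
apply/ler_addgt0Pr => d' d'0.
pose d := Num.min d' ((rho ^+ size v - a) / 2).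
have d0 : 0 < d by rewrite lt_min d'0 divr_gt0 // subr_gt0.
have dd' : d <= d' by rewrite ge_min lexx.
have ad : a + d < rho ^+ size v.
  have : d <= (rho ^+ size v - a) / 2 by rewrite ge_min lexx orbT.
  lra.
apply: (@le_trans _ _ (a + d)); last by rewrite lerD2l.
have [u [Au ue]] := tree_contentP (A `&` cyl v) d0.
have su i : (size v < size (u i))%N.
  rewrite ltnNge; apply/negP => uv.
  have := ue i.+1; rewrite big_ord_recr /= => h1.
  have : cylw (u i) < rho ^+ size v.
    apply: le_lt_trans ad; apply: le_trans h1.
    by rewrite lerDr sumr_ge0 // => ? _; exact: cylw_ge0.
  rewrite ltNge => /negP; apply.
  by rewrite /cylw ler_wiXn2l // ltW.
pose t c i := if prefix (rcons v c) (u i) then cylw (u i) else 0.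
have t0 c i : 0 <= t c i by rewrite /t; case: ifP => // _; exact: cylw_ge0.
have sumt n : \sum_c \sum_(i < n) t c i <= a + d.
  rewrite exchange_big /=; apply: le_trans (ue n); apply: ler_sum => i _.
  apply: (@le_trans _ _ (\sum_(c | c == nth c0 (u i) (size v)) cylw (u i))).
    rewrite [leRHS]big_mkcond; apply: ler_sum => c _; rewrite /t.
    case: ifP => [/prefixP[s ->]|_]; last by case: ifP => // _; exact: cylw_ge0.
    by rewrite cat_rcons nth_cat ltnn subnn /= eqxx.
  by rewrite big_pred1_eq.
have hom c : {homo (fun n : nat => \sum_(i < n) t c i) : m n / (m <= n)%N >-> m <= n}.
  move=> m n mn; rewrite -(big_mkord xpredT (t c)) -(big_mkord xpredT (t c)).
  by rewrite [leRHS](big_cat_nat (n := m)) //= lerDl sumr_ge0.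
have bnd c : has_ubound (range (fun n : nat => \sum_(i < n) t c i)).
  exists (a + d) => _ [n _ <-]; apply: le_trans (sumt n).
  by rewrite (bigD1 c) //= lerDl; apply: sumr_ge0 => ? _; apply: sumr_ge0.
apply: le_trans (@ler_sum_sup _ _ _ (fun c n => \sum_(i < n) t c i) _ hom bnd sumt).
apply: ler_sum => c _; apply: tree_content_le.
pose S i := if prefix (rcons v c) (u i) then cyl (u i) else set0.
apply: (@content_le_le _ _ _ _ _ _ _ (\bigcup_i S i)); [exact: lexx| |].
  move=> x [Ax xc]; have [i _ ui] := Au x (conj Ax (proj1 ((cyl_rcons v c x).1 xc))).
  exists i => //; rewrite /S.
  have -> // : prefix (rcons v c) (u i).
  by apply/(cyl_prefix _ ui) => //; rewrite size_rcons.
apply: (cbig (e := t c)) => [i|n].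
  rewrite /t /S; case: ifP => _; last exact: cset0.
  exact: csingle.
by apply: sup_upper_bound; [split => //; exists 0, 0%N; rewrite ?big_ord0 | exists n].
Qed.

(* Net content is continuous along increasing sequences of arbitrary sets.  With
   [a v] the limit of the contents inside the cylinder of [v], call [v] saturated
   if [a v] is at least [1 / lam] times the cost of [v].  The minimal saturated
   cylinders have total cost at most [lam * a [::]], and the points that lie in no
   saturated cylinder form a null set. *)
Section Increasing.
Variables (Aj : nat -> set (nat -> F)).
Hypothesis Ainc : forall j, Aj j `<=` Aj j.+1.
Variable lam : R.
Hypothesis lam1 : 1 < lam.

Let U := \bigcup_j Aj j.
Let a v := sup (range (fun j => h (Aj j `&` cyl v))).
Let sat v := rho ^+ size v <= lam * a v.

Let lam0 : 0 < lam. Proof. exact: lt_trans lam1. Qed.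

Let Ainc' m n : (m <= n)%N -> Aj m `<=` Aj n.
Proof.
elim: n => [|n IH]; first by rewrite leqn0 => /eqP ->.
rewrite leq_eqVlt ltnS => /orP[/eqP -> //|/IH]; move/subset_trans; apply; exact: Ainc.
Qed.

Let a_hom v : {homo (fun j => h (Aj j `&` cyl v)) : m n / (m <= n)%N >-> m <= n}.
Proof. by move=> m n mn; apply: tree_content_mono; apply: setSI; exact: Ainc'. Qed.

Let a_ub v : has_ubound (range (fun j => h (Aj j `&` cyl v))).
Proof. by exists 1 => _ [j _ <-]; exact: tree_content_le1. Qed.

Let le_a v j : h (Aj j `&` cyl v) <= a v.
Proof. by apply: sup_upper_bound; [split => //; exists (h (Aj 0%N `&` cyl v)), 0%N | exists j]. Qed.

Let a0 v : 0 <= a v.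
Proof. exact: le_trans (tree_content_ge0 _) (le_a v 0). Qed.

(** As [lam > 1], the content inside an unsaturated cylinder is below its cost at every stage, so
    [tree_content_children] applies at each stage and passes to the limit. *)
Let a_children v : ~~ sat v -> \sum_c a (rcons v c) <= a v.
Proof.
rewrite -ltNge => nsat.
apply: ler_sum_sup => // n; apply: le_trans (le_a v n).
apply: tree_content_children; apply: le_lt_trans (le_a v n) _.
by apply: le_lt_trans nsat; rewrite ler_peMl // ltW.
Qed.

(** The total cost of the minimal saturated cylinders lying exactly [n] levels below [v];
    [satset n v] is their union. *)
Fixpoint satcost n v : R := match n with
  | 0 => if sat v then rho ^+ size v else 0
  | n'.+1 => if sat v then 0 else \sum_c satcost n' (rcons v c)
  end.

Let satset n v : set (nat -> F) := [set x | [/\ cyl v x, sat (mkseq x (size v + n)) &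
  forall m, (m < n)%N -> ~~ sat (mkseq x (size v + m))]].

Let satset_content n v : content_le cyl cylw (satcost n v) (satset n v).
Proof.
elim: n v => [|n IH] v /=; case: ifPn => satv.
- apply: content_le_le (csingle v) => //.
  by move=> x [].
- apply: content_le_le (cset0 (lexx 0)) => // x [xv].
  by rewrite addn0 xv (negbTE satv).
- apply: content_le_le (cset0 (lexx 0)) => // x [xv _].
  by move=> /(_ 0%N (ltn0Sn _)); rewrite addn0 xv satv.
apply: content_le_bigsum; [exact: cylw_ge0 | exact: cylw_small | by move=> c _; exact: IH|].
move=> x [xv xs xm]; exists (x (size v)); first by rewrite mem_index_enum.
split; first by apply/cyl_rcons.
  by rewrite size_rcons addSnnS.
by move=> m mn; rewrite size_rcons addSnnS; exact: xm.
Qed.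

(** Induction down the tree: a saturated [v] costs at most [lam * a v] by definition, and below an
    unsaturated one the limits of the children add up to at most [a v]. *)
Let sum_satcost n v : \sum_(m < n) satcost m v <= lam * a v.
Proof.
elim: n v => [|n IH] v; first by rewrite big_ord0 mulr_ge0 // ltW.
rewrite big_ord_recl /=; case: ifPn => satv.
  by rewrite big1 ?addr0.
rewrite add0r exchange_big /=.
apply: (@le_trans _ _ (\sum_c lam * a (rcons v c))); first exact: ler_sum.
by rewrite -mulr_sumr ler_pM2l // a_children.
Qed.

Let rest : set (nat -> F) := [set x | forall n, ~~ sat (mkseq x n)].

(* Each cylinder of a cover of [Aj j `&` rest] is unsaturated, so the cover can be
   improved by the factor [lam]: the content [r] satisfies [lam * r <= r]. *)
Let rest_null j : content_le cyl cylw 0 (Aj j `&` rest).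
Proof.
apply/tree_content_leP; set r := h _.
suff : lam * r <= r.
  have r0 : 0 <= r by exact: tree_content_ge0.
  by rewrite -subr_le0 -{2}(mul1r r) -mulrBl pmulr_rle0 // subr_gt0.
apply/ler_addgt0Pr => d d0.
have [u [Au ue]] := tree_contentP (Aj j `&` rest) d0.
rewrite mulrC -ler_pdivlMr //.
apply/tree_content_leP.
apply: (@content_le_le _ _ _ _ _ _ _ (\bigcup_i (Aj j `&` rest `&` cyl (u i)))); [exact: lexx| |].
  by move=> x Ax; have [i _ ui] := Au x Ax; exists i.
apply: (cbig (e := fun i => cylw (u i) / lam)) => [i|n]; last first.
  by rewrite -mulr_suml ler_pM2r ?invr_gt0 // ue.
apply/tree_content_leP.
have [[x [[Ax rx] xu]]|ne] := pselect (exists x, (Aj j `&` rest `&` cyl (u i)) x).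
  rewrite ler_pdivlMr // mulrC.
  have := rx (size (u i)); rewrite xu -ltNge => /ltW; apply: le_trans.
  rewrite ler_pM2l //; apply: le_trans (le_a _ j).
  by apply: tree_content_mono => y [[]].
rewrite tree_content0 ?divr_ge0 ?cylw_ge0 ?(ltW lam0) //.
by move=> x Ax; apply: ne; exists x.
Qed.

Lemma increasing_content_lam b : (forall j, h (Aj j) <= b) -> h U <= lam * b.
Proof.
move=> hb; apply/tree_content_leP.
apply: (@content_le_le _ _ _ _ _ _ _
    (\bigcup_n satset n [::] `|` \bigcup_j (Aj j `&` rest))); [exact: lexx| |].
  move=> x [j _ Ax].
  have [xr|/existsNP[n /negP]] := pselect (rest x); first by right; exists j.
  rewrite negbK => xn; left.
  have ex : exists n, sat (mkseq x n) by exists n.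
  exists (ex_minn ex) => //; case: ex_minnP => m sm mm; split=> // k km.
  by rewrite add0n; apply/negP => /mm; rewrite leqNgt km.
rewrite -[lam * b]addr0; apply: content_le_setU; [exact: cylw_ge0 | exact: cylw_small | |].
  apply: (cbig (e := fun n => satcost n [::])); first by move=> n; exact: satset_content.
  move=> n; apply: le_trans (sum_satcost n [::]) _; rewrite ler_pM2l //.
  apply: ge_sup; first by exists (h (Aj 0%N `&` cyl [::])), 0%N.
  by move=> _ [j _ <-]; apply: le_trans (hb j); apply: tree_content_mono => x [].
apply: (cbig (e := fun=> 0)) => [j|n]; first exact: rest_null.
by rewrite big1.
Qed.

End Increasing.

Lemma increasing_content (Aj : nat -> set (nat -> F)) b :
  (forall j, Aj j `<=` Aj j.+1) -> (forall j, h (Aj j) <= b) ->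
  h (\bigcup_j Aj j) <= b.
Proof.
move=> Ainc hb.
have b0 : 0 <= b by exact: le_trans (tree_content_ge0 _) (hb 0%N).
apply/ler_addgt0Pr => d d0.
have b1 : 0 < b + 1 by rewrite ltr_wpDl.
(* With this factor [lam * b <= b + d]; the denominator [b + 1] is positive even if [b] is 0. *)
have l1 : 1 < 1 + d / (b + 1) by rewrite ltrDl divr_gt0.
apply: le_trans (increasing_content_lam Ainc l1 hb) _.
rewrite mulrDl mul1r lerD2l mulrAC ler_pdivrMr // ler_pM2l //.
by rewrite lerDl.
Qed.

(** A list of weighted points stands for a finitely supported measure, and [mass] is its value on a
    cylinder. *)
Definition mass (mu : seq ((nat -> F) * R)) w : R :=
  \sum_(q <- mu | mkseq q.1 (size w) == w) q.2.

Definition total (mu : seq ((nat -> F) * R)) : R := \sum_(q <- mu) q.2.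

Lemma mass_le_total mu w : (forall q, q \in mu -> 0 <= q.2) -> mass mu w <= total mu.
Proof.
move=> mu0; rewrite /total /mass big_mkcond [leLHS]big_seq [leRHS]big_seq.
by apply: ler_sum => q /mu0 q0; case: ifP.
Qed.

(* Going up the tree, the masses of the children are rescaled whenever their
   total exceeds the cost of the parent. *)
Lemma finite_frostman A n v : exists mu : seq ((nat -> F) * R),
  [/\ forall q, q \in mu -> [/\ A q.1, cyl v q.1 & 0 <= q.2],
      forall w, prefix v w -> (size w <= size v + n)%N -> mass mu w <= rho ^+ size w &
      h (A `&` cyl v) <= total mu].
Proof.
elim: n v => [|n IH] v.
  have [[x [Ax xv]]|ne] := pselect (exists x, (A `&` cyl v) x); last first.
    exists [::]; split=> //; first by move=> w _ _; rewrite /mass big_nil exprn_ge0 // ltW.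
    by rewrite /total big_nil tree_content0 // => x Ax; apply: ne; exists x.
  exists [:: (x, h (A `&` cyl v))].
  have mu0 q : q \in [:: (x, h (A `&` cyl v))] -> [/\ A q.1, cyl v q.1 & 0 <= q.2].
    by rewrite inE => /eqP -> /=; split=> //; exact: tree_content_ge0.
  split=> //; last by rewrite /total big_seq1.
  move=> w vw; rewrite addn0 => wv.
  have -> : w = v.
    by move: vw; rewrite prefixE take_oversize // => /eqP.
  apply: le_trans (mass_le_total _ _) _; first by move=> q /mu0[].
  by rewrite /total big_seq1 /= tree_content_cyl.
have /choice[mu Hmu] := fun c => IH (rcons v c).
have Hmem c q : q \in mu c -> [/\ A q.1, cyl (rcons v c) q.1 & 0 <= q.2].
  by case: (Hmu c) => H _ _; exact: H.
pose nu := flatten [seq mu c | c <- enum F].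
have nu_mem q : q \in nu -> [/\ A q.1, cyl v q.1 & 0 <= q.2].
  move=> /flatten_mapP[c _ /Hmem[Aq /cyl_rcons[vq _] q0]] //.
have massnu w : mass nu w = \sum_c mass (mu c) w.
  rewrite /mass /nu big_flatten big_map.
  by rewrite big_enum.
have totnu : total nu = \sum_c total (mu c).
  by rewrite /total /nu big_flatten big_map big_enum.
(* Either nothing is rescaled and the lower bound is the sum of those of the children, or the total
   becomes exactly the cost of [v], which bounds the content. *)
have [k [k0 k1 kv kh]] : exists k : R, [/\ 0 <= k, k <= 1, k * total nu <= rho ^+ size v &
    h (A `&` cyl v) <= k * total nu].
  have [le|lt] := leP (total nu) (rho ^+ size v).
    exists 1; rewrite mul1r; split=> //; apply: le_trans (tree_content_split _ _) _.
    by rewrite totnu; apply: ler_sum => c _; case: (Hmu c).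
  have r0 : 0 < rho ^+ size v by rewrite exprn_gt0.
  have t0 : 0 < total nu by exact: lt_trans lt.
  exists (rho ^+ size v / total nu); rewrite divfK ?gt_eqF //; split=> //.
  - by rewrite divr_ge0 // ltW.
  - by rewrite ler_pdivrMr // mul1r ltW.
  - exact: tree_content_cyl.
pose nuk := [seq (q.1, k * q.2) | q <- nu].
have massk w : mass nuk w = k * mass nu w by rewrite /mass /nuk big_map mulr_sumr.
have totk : total nuk = k * total nu by rewrite /total /nuk big_map mulr_sumr.
have nuk_mem q : q \in nuk -> [/\ A q.1, cyl v q.1 & 0 <= q.2].
  by move=> /mapP[q' /nu_mem[Aq vq q0] ->] /=; split=> //; exact: mulr_ge0.
exists nuk; split=> //; last by rewrite totk.
move=> w vw wn.
have [wv|wv] := eqVneq w v.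
  rewrite wv; apply: le_trans (mass_le_total _ _) _; first by move=> q /nuk_mem[].
  by rewrite totk.
have m0 c w' : 0 <= mass (mu c) w'.
  by rewrite /mass big_seq_cond sumr_ge0 // => q /andP[/Hmem[]].
have [s ws] := prefixP vw; case: s ws => [|c s] ws; first by rewrite ws cats0 eqxx in wv.
rewrite massk massnu (bigD1 c) //= [X in _ + X]big1 ?addr0; last first.
  move=> c' cc'; rewrite /mass big_seq_cond big1 // => q /andP[/Hmem[_ /cyl_rcons[_ qc] _]].
  move=> /eqP qw; move/negP: cc'; case; rewrite -qc.
  have := congr1 (fun z => nth c0 z (size v)) qw.
  rewrite nth_mkseq ?ws ?size_cat /= -?addSnnS ?leq_addr //.
  by rewrite nth_cat ltnn subnn /= => ->.
apply: (@le_trans _ _ (mass (mu c) w)); first by rewrite ler_piMl.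
case: (Hmu c) => _ H _; apply: H; first by rewrite ws -cat_rcons prefix_prefix.
by rewrite size_rcons addSnnS.
Qed.

End Tree.

(** * Uniform measure and binary expansions *)

(** Dependent choice along a tree, the source of the compactness and Koenig arguments below. *)
Lemma exists_branch (T : Type) (P : seq T -> Prop) :
  P [::] -> (forall s, P s -> exists c, P (rcons s c)) ->
  exists x : nat -> T, forall l, P (mkseq x l).
Proof.
move=> P0 PS.
have [c1 _] := PS _ P0.
have /choice[f Hf] : forall s, exists c, P s -> P (rcons s c).
  move=> s; have [/PS[c Pc]|nP] := pselect (P s); first by exists c.
  by exists c1.
pose s n := iter n (fun s => rcons s (f s)) [::].
have Ps n : P (s n) by elim: n => [|n IH] //=; exact: Hf.
exists (fun n => f (s n)) => l.
suff -> : mkseq (fun n => f (s n)) l = s l by [].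
by elim: l => [//|l IH]; rewrite mkseqS IH.
Qed.

Section Uniform.
Variables (R : realType) (F : finType) (c0 : F) (rho : R).
Hypotheses (rho1 : rho < 1) (rhoF : rho * #|F|%:R = 1).

Local Notation h := (tree_content (F := F) rho).

Lemma uniform_gt0 : 0 < rho.
Proof.
rewrite lt_neqAle eq_sym; apply/andP; split.
  by apply: contra_eq_neq rhoF => ->; rewrite mul0r eq_sym oner_neq0.
rewrite leNgt; apply/negP => r0; have : rho * #|F|%:R <= 0 by rewrite nmulr_rle0.
by rewrite rhoF ler10.
Qed.

Let rho0 := uniform_gt0.

Lemma card_prefix N (u : seq F) :
  #|[pred w : N.-tuple F | prefix u w]|%:R * rho ^+ N <= rho ^+ size u.
Proof.
have [uN|uN] := leqP (size u) N; last first.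
  rewrite (eq_card0 (A := [pred w : N.-tuple F | prefix u w])).
    by rewrite mul0r exprn_ge0 // ltW.
  move=> w; rewrite !inE; apply/negP => /size_prefix; rewrite size_tuple leqNgt uN //.
have -> : rho ^+ N = rho ^+ size u * rho ^+ (N - size u) by rewrite -exprD subnKC.
rewrite mulrCA ler_piMr ?exprn_ge0 ?(ltW rho0) //.
have le : (#|[pred w : N.-tuple F | prefix u w]| <= #|F| ^ (N - size u))%N.
  rewrite -card_tuple.
  rewrite -(card_in_imset (f := fun w : N.-tuple F => [tuple of drop (size u) w])) ?max_card //.
  move=> w w'; rewrite !inE !prefixE => /eqP h1 /eqP h2 /(congr1 val) /= e.
  by apply: val_inj; rewrite /= -(cat_take_drop (size u) w) -(cat_take_drop (size u) w') h1 h2 e.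
apply: (@le_trans _ _ ((#|F| ^ (N - size u))%:R * rho ^+ (N - size u))).
  by rewrite ler_wpM2r ?exprn_ge0 ?(ltW rho0) // ler_nat.
by rewrite natrX -exprMn (mulrC _ rho) rhoF expr1n.
Qed.

(** From measure to counting: [A] is covered by the cylinders of level [N] that it meets. This later
    turns large sets of times into large sets of cubes. *)
Lemma content_le_count (A : set (nat -> F)) N :
  h A <= #|[pred w : N.-tuple F | `[< exists2 x, A x & mkseq x N = w >]]|%:R * rho ^+ N.
Proof.
apply: tree_content_le => //.
set P := [pred w | _].
have -> : #|P|%:R * rho ^+ N = \sum_(w <- enum P) cylw rho (tval w).
  rewrite big_enum /= (eq_bigr (fun=> rho ^+ N)) ?sumr_const ?mulr_natl // => w _.
  by rewrite /cylw size_tuple.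
apply: (content_le_bigsum (cylw_ge0 rho0) (cylw_small c0 rho0 rho1) (A := fun w => cyl (tval w))).
  move=> w _; exact (content_le_single (@cyl F) (@cylw_ge0 R F rho rho0) (cylw_small c0 rho0 rho1) (tval w)).
move=> x Ax; exists [tuple of mkseq x N]; last by rewrite /cyl /= size_mkseq.
by rewrite mem_enum unfold_in /=; apply: asboolT; exists x.
Qed.

(** Compactness. If finitely many cylinders of a cover already suffice, counting words at a common
    depth shows that they cost at least 1. Otherwise some branch has no prefix whose cylinder is
    finitely covered, yet it lies in a member of the cover, and that member is one of its
    prefixes. *)
Lemma tree_content_setT : h setT = 1.
Proof.
apply/eqP; rewrite eq_le tree_content_le1 //= leNgt; apply/negP => lt1.
pose d := (1 - h setT) / 2.
have d0 : 0 < d by rewrite divr_gt0 // subr_gt0.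
have [u [Au ue]] := tree_contentP c0 rho0 rho1 setT d0.
have e1 : h setT + d < 1 by rewrite /d; lra.
have [[n Hn]|nfin] := pselect (exists n, forall x : nat -> F, exists2 i, (i < n)%N & cyl (u i) x).
  pose N := \max_(i < n) size (u i).
  have : 1 <= \sum_(i < n) cylw rho (u i).
    apply: (@le_trans _ _ (\sum_(i < n) #|[pred w : N.-tuple F | prefix (u i) w]|%:R * rho ^+ N)).
      rewrite -mulr_suml.
      have -> : \sum_(i < n) #|[pred w : N.-tuple F | prefix (u i) w]|%:R =
          (\sum_(i < n) #|[pred w : N.-tuple F | prefix (u i) w]|)%N%:R :> R by rewrite natr_sum.
      have {1}<- : (#|{: N.-tuple F}|)%:R * rho ^+ N = 1.
        by rewrite card_tuple natrX -exprMn (mulrC _ rho) rhoF expr1n.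
      rewrite ler_wpM2r ?exprn_ge0 ?(ltW rho0) // ler_nat.
      rewrite -sum1_card; under [leqRHS]eq_bigr do rewrite -sum1_card big_mkcond.
      rewrite [leqRHS]exchange_big /=; apply: leq_sum => w _.
      have [i lin iu] := Hn (nth c0 w).
      rewrite (bigD1 (Ordinal lin)) //= inE.
      have -> // : prefix (u i) w.
      have wN : cyl w (nth c0 w) by rewrite /cyl /= mkseq_nth.
      apply/(cyl_prefix _ wN) => //; rewrite size_tuple.
      exact: (leq_bigmax (Ordinal lin)).
    by apply: ler_sum => i _; exact: card_prefix.
  move=> h1; have := le_lt_trans (le_trans h1 (ue n)) e1; by rewrite ltxx.
have [x Hx] : exists x : nat -> F, forall l,
    ~ exists n, forall y, cyl (mkseq x l) y -> exists2 i, (i < n)%N & cyl (u i) y.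
  apply: (exists_branch (P := fun s => ~ exists n, forall y, cyl s y -> exists2 i, (i < n)%N & cyl (u i) y)).
    by move=> [n Hn]; apply: nfin; exists n => y; exact: Hn.
  move=> s Hs; apply: contrapT => /forallNP H; apply: Hs.
  have /choice[g Hg] : forall c, exists n, forall y, cyl (rcons s c) y -> exists2 i, (i < n)%N & cyl (u i) y.
    by move=> c; exact: contrapT (H c).
  exists (\max_c g c) => y ys.
  have [|i ig ui] := Hg (y (size s)) y; first by apply/cyl_rcons.
  by exists i => //; apply: leq_trans ig (leq_bigmax _).
have [i _ ui] := Au x Logic.I.
apply: (Hx (size (u i))); exists i.+1 => y; rewrite ui => yu; by exists i.
Qed.

(** Markov's inequality for a finite sum of weighted indicators of cylinders: at the depth of the
    longest word the sum depends on the prefix only, and integration becomes counting. *)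
Lemma tree_markov (s : seq (seq F * R)) (t : R) (A : set (nat -> F)) :
  (forall q, q \in s -> 0 <= q.2) -> 0 <= t ->
  (forall x, A x -> t <= \sum_(q <- s | mkseq x (size q.1) == q.1) q.2) ->
  t * h A <= \sum_(q <- s) q.2 * rho ^+ size q.1.
Proof.
move=> s0 t0 HA.
pose N := \max_(q <- s) size q.1.
apply: le_trans (ler_wpM2l t0 (content_le_count A N)) _.
set P := [pred w | _].
have -> : t * (#|P|%:R * rho ^+ N) = \sum_(w in P) t * rho ^+ N.
  by rewrite sumr_const mulrCA mulr_natl.
apply: (@le_trans _ _ (\sum_(w in P) \sum_(q <- s | prefix q.1 w) q.2 * rho ^+ N)).
  apply: ler_sum => w; rewrite unfold_in /= => /asboolP[x Ax xw].
  rewrite -mulr_suml ler_wpM2r ?exprn_ge0 ?(ltW rho0) //.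
  apply: le_trans (HA x Ax) _.
  rewrite big_seq_cond [leRHS]big_seq_cond le_eqVlt; apply/orP; left; apply/eqP.
  apply: eq_bigl => q; case: (boolP (q \in s)) => //= qs.
  have sq : (size q.1 <= size w)%N.
    by rewrite size_tuple; apply: (leq_bigmax_seq q).
  have xw' : cyl w x by rewrite /cyl /= size_tuple.
  by apply/eqP/idP => /(cyl_prefix sq xw').
apply: (@le_trans _ _ (\sum_(w : N.-tuple F) \sum_(q <- s | prefix q.1 w) q.2 * rho ^+ N)).
  rewrite [leLHS]big_mkcond; apply: ler_sum => w _; case: ifP => // _.
  rewrite big_seq_cond; apply: sumr_ge0 => q /andP[/s0 q0 _].
  by rewrite mulr_ge0 // exprn_ge0 // ltW.
under eq_bigr do rewrite big_mkcond.
rewrite exchange_big /= big_seq [leRHS]big_seq; apply: ler_sum => q /s0 q0.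
rewrite -big_mkcond sumr_const /= -[leLHS]mulr_natl mulrCA.
by apply: ler_wpM2l => //; exact: card_prefix.
Qed.

End Uniform.

Lemma absz_shift_inj (m n : nat) (z : int) :
  -1 <= m%:Z - z -> m%:Z - z <= 1 -> -1 <= n%:Z - z -> n%:Z - z <= 1 ->
  absz (m%:Z - z + 1) = absz (n%:Z - z + 1) -> m = n.
Proof. lia. Qed.

Lemma absz_shift_lt (n : nat) (z : int) :
  -1 <= n%:Z - z -> n%:Z - z <= 1 -> (absz (n%:Z - z + 1)%R < 3)%N.
Proof. lia. Qed.

Definition mx_close (R : realType) (a b : nat) (e : R) (x y : 'M[R]_(a, b)) :=
  forall i j, `|x i j - y i j| < e.

Section DyadicValue.
Variables (R : realType) (a b : nat).

(** One bit for each entry at once, so that a word of length [l] names a dyadic cube of side [2^-l]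
    in the unit cube of matrices. *)
Definition digit := {ffun 'I_a * 'I_b -> bool}.

Lemma card_digit : #|{: digit}| = (2 ^ (a * b))%N.
Proof. by rewrite card_ffun card_bool card_prod !card_ord. Qed.

Definition num (w : seq digit) (p : 'I_a * 'I_b) : nat :=
  foldl (fun n c => (n.*2 + (c : digit) p)%N) 0%N w.

Lemma num_rcons w c p : num (rcons w c) p = ((num w p).*2 + c p)%N.
Proof. by rewrite /num foldl_rcons. Qed.

Lemma num_lt w p : (num w p < 2 ^ size w)%N.
Proof.
elim/last_ind: w => [//|w c IH]; rewrite num_rcons size_rcons expnS.
case: (c p); lia.
Qed.

Lemma num_inj w w' : size w = size w' -> num w =1 num w' -> w = w'.
Proof.
elim/last_ind: w w' => [|w c IH] w'; first by case: w'.
case/lastP: w' => [|w' c']; rewrite !size_rcons // => -[sw] H.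
have Hp p : num w p = num w' p /\ c p = c' p.
  have := H p; rewrite !num_rcons; case: (c p); case: (c' p) => /= h; split=> //; lia.
rewrite (IH w') //; last by move=> p; case: (Hp p).
congr rcons; apply/ffunP => p; by case: (Hp p).
Qed.

Implicit Types x : nat -> digit.

Definition bin_val x : 'M[R]_(a, b) :=
  \matrix_(i, j) sup (range (fun l => (num (mkseq x l) (i, j))%:R * 2^-1 ^+ l : R)).

Lemma num_mkseq x l m p :
  (num (mkseq x l) p * 2 ^ m <= num (mkseq x (l + m)) p < (num (mkseq x l) p).+1 * 2 ^ m)%N.
Proof.
elim: m => [|m IH]; first by rewrite addn0 expn0 !muln1 leqnn ltnSn.
rewrite addnS mkseqS num_rcons expnS; case: (x (l + m)%N p); lia.
Qed.

Lemma natr_half_exp m l : 2^-1 ^+ l = (2 ^ m)%:R * 2^-1 ^+ (l + m) :> R.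
Proof.
by rewrite exprD natrX mulrCA -exprMn divff ?expr1n ?mulr1 // pnatr_eq0.
Qed.

Lemma num_mkseq_le x l l' p :
  (num (mkseq x l) p)%:R * 2^-1 ^+ l <= (num (mkseq x l') p).+1%:R * 2^-1 ^+ l' :> R.
Proof.
have e0 n : 0 <= 2^-1 ^+ n :> R by rewrite exprn_ge0.
have [|] := leqP l l' => ll.
  have /andP[h _] := num_mkseq x l (l' - l) p.
  rewrite (natr_half_exp (l' - l)) mulrA -natrM subnKC // in h *.
  by rewrite ler_wpM2r // ler_nat; apply: leq_trans h _.
have /andP[_ h] := num_mkseq x l' (l - l') p.
rewrite (natr_half_exp (l - l') l') mulrA -natrM subnKC ?(ltnW ll) // in h *.
by rewrite ler_wpM2r // ler_nat ltnW.
Qed.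

Lemma bin_val_bounds x l i j :
  (num (mkseq x l) (i, j))%:R * 2^-1 ^+ l <= bin_val x i j <=
  ((num (mkseq x l) (i, j))%:R + 1) * 2^-1 ^+ l.
Proof.
rewrite natr1 mxE; apply/andP; split.
  apply: ub_le_sup; last by exists l.
  by exists ((num (mkseq x 0) (i, j)).+1%:R * 2^-1 ^+ 0) => _ [m _ <-]; exact: num_mkseq_le.
apply: ge_sup; first by exists ((num (mkseq x 0) (i, j))%:R * 2^-1 ^+ 0), 0%N.
by move=> _ [m _ <-]; exact: num_mkseq_le.
Qed.

Lemma bin_val01 x i j : 0 <= bin_val x i j <= 1.
Proof. by have := bin_val_bounds x 0 i j; rewrite /= !expr0 mulr0n !mulr1 add0r. Qed.

Lemma bin_val_close x y l i j : mkseq x l = mkseq y l ->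
  `|bin_val x i j - bin_val y i j| <= 2^-1 ^+ l.
Proof.
move=> e; have := bin_val_bounds x l i j; have := bin_val_bounds y l i j; rewrite e.
rewrite mulrDl mul1r ler_norml => /andP[? ?] /andP[? ?]; lra.
Qed.

Lemma bin_val_surj (t : 'M[R]_(a, b)) : (forall i j, 0 <= t i j < 1) -> exists x, bin_val x = t.
Proof.
move=> t01.
(* With these parities, the prefix of length [l] encodes the integer part of [2^l t]. *)
pose x l : digit := [ffun p => odd (Num.truncn (t p.1 p.2 * 2 ^+ l.+1))].
have t0 i j l : 0 <= t i j * 2 ^+ l.
  by case/andP: (t01 i j) => ? _; rewrite mulr_ge0 // exprn_ge0.
have numx l p : num (mkseq x l) p = Num.truncn (t p.1 p.2 * 2 ^+ l).
  elim: l => [|l IH].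
    rewrite expr0 mulr1; apply/esym/eqP; rewrite truncn_eq /= ?addn0; last by case/andP: (t01 p.1 p.2).
    exact: t01.
  rewrite mkseqS num_rcons IH ffunE.
  set m := Num.truncn (t p.1 p.2 * 2 ^+ l.+1).
  suff -> : Num.truncn (t p.1 p.2 * 2 ^+ l) = m./2 by rewrite addnC odd_double_half.
  have /andP[m1 m2] := truncn_itv (t0 p.1 p.2 l.+1).
  rewrite -/m exprS in m1 m2.
  apply/eqP; rewrite truncn_eq //.
  have e : m%:R = (odd m)%:R + 2 * (m./2)%:R :> R.
    by rewrite -{1}(odd_double_half m) natrD -muln2 natrM mulrC.
  rewrite -(natr1 m) in m2; rewrite -(natr1 m./2); rewrite e in m1 m2.
  rewrite mulrCA in m1 m2; set y := _ * 2 ^+ l in m1 m2 *.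
  by case: (odd m) m1 m2 => /= m1 m2; apply/andP; split; lra.
exists x; apply/matrixP => i j; apply/eqP; rewrite -subr_eq0 -normr_le0.
apply/ler_addgt0Pr => e e0; rewrite add0r.
have h0 : 0 < 2^-1 :> R by rewrite invr_gt0.
have h1 : 2^-1 < 1 :> R by rewrite invf_lt1 // ltr1n.
have [l le] := exists_expr_le h0 h1 e0.
apply: le_trans le.
have /andP[b1 b2] := bin_val_bounds x l i j.
have /andP[m1 m2] := truncn_itv (t0 i j l).
rewrite numx /= in b1 b2.
have p0 : 0 < 2 ^+ l :> R by rewrite exprn_gt0.
move: b1 b2; rewrite exprVn ler_pdivrMr // ler_pdivlMr // => b1 b2.
rewrite -(ler_pM2r p0) mulVf ?gt_eqF // -{1}(gtr0_norm p0) -normrM mulrBl.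
rewrite -(natr1 (Num.truncn _)) in m2; rewrite ler_norml; lra.
Qed.

(** The ball of radius [2^-l] about [y] meets only cubes whose index differs from that of [y] by at
    most 1 in each entry, hence at most [3^(a * b)] cubes. The index of [y] is an integer because
    [y] may lie outside the unit cube. *)
Definition close_word (y : 'M[R]_(a, b)) l : pred (seq digit) := fun w =>
  [forall p, (`|(num w p)%:Z - Num.floor (y p.1 p.2 * 2 ^+ l)| <= 1)%R].

Lemma close_wordP y l x : mx_close (2^-1 ^+ l) y (bin_val x) -> close_word y l (mkseq x l).
Proof.
move=> yx; apply/forallP => -[i j] /=.
have p0 : 0 < 2 ^+ l :> R by rewrite exprn_gt0.
have := bin_val_bounds x l i j; have := yx i j.
rewrite -(ltr_pM2r p0) exprVn mulVf ?gt_eqF // -{1}(gtr0_norm p0) -normrM mulrBl.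
rewrite ler_pdivrMr // ler_pdivlMr // ltr_norml.
set f := Num.floor _; have := floor_itv (y i j * 2 ^+ l); rewrite -/f.
set n := num _ _ => /andP[f1 f2] /andP[h1 h2] /andP[n1 n2].
have g1 : n%:~R < (f + 2)%:~R :> R by rewrite !rmorphD /= in f2 *; lra.
have g2 : (f - 2)%:~R < n%:~R :> R by rewrite rmorphB /=; lra.
rewrite !ltr_int in g1 g2; rewrite ler_norml; lia.
Qed.

Definition close_words y l : seq (seq digit) :=
  [seq tval w | w <- enum [pred w : l.-tuple digit | close_word y l w]].

Lemma close_words_size y l w : w \in close_words y l -> size w = l.
Proof. by move=> /mapP[w' _ ->]; exact: size_tuple. Qed.

Lemma mem_close_words y l x : mx_close (2^-1 ^+ l) y (bin_val x) -> mkseq x l \in close_words y l.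
Proof.
move=> /close_wordP h; apply/mapP; exists [tuple of mkseq x l] => //.
by rewrite mem_enum inE.
Qed.

Lemma size_close_words y l : (size (close_words y l) <= 3 ^ (a * b))%N.
Proof.
rewrite size_map -cardE.
have -> : (3 ^ (a * b) = #|{: {ffun 'I_a * 'I_b -> 'I_3}}|)%N.
  by rewrite card_ffun card_prod !card_ord.
pose f p := Num.floor (y p.1 p.2 * 2 ^+ l).
(* The offsets -1, 0, 1 from the index of [y] are coded as 0, 1, 2. *)
pose g (w : l.-tuple digit) : {ffun 'I_a * 'I_b -> 'I_3} :=
  [ffun p => inord (absz ((num w p)%:Z - f p + 1))].
rewrite -(card_in_imset (f := g)) ?max_card // => w w'.
rewrite !inE => /forallP h /forallP h' e.
apply: val_inj; apply: num_inj; first by rewrite !size_tuple.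
move=> p; have := congr1 (fun z : {ffun _ -> _} => val (z p)) e.
have := h p; have := h' p; rewrite /= -/(f p) !ffunE !ler_norml => /andP[h1 h2] /andP[h3 h4].
rewrite !inordK; [exact: absz_shift_inj | exact: absz_shift_lt | exact: absz_shift_lt].
Qed.

End DyadicValue.

(** * Souslin sets and capacitability *)

Section Souslin.
Variable T : topologicalType.
Implicit Types (A B : set T) (F : seq nat -> set T) (x : T).

Definition souslin A := exists F, (forall s, closed (F s)) /\
  A = [set x | exists sigma : nat -> nat, forall n, F (mkseq sigma n) x].

Lemma closed_souslin A : closed A -> souslin A.
Proof.
move=> cA; exists (fun=> A); split=> //.
by apply/seteqP; split=> x /=; [move=> Ax; exists (fun=> 0%N) | case=> ? /(_ 0%N)].
Qed.

Lemma mkseq_cons (sigma : nat -> nat) n :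
  mkseq sigma n.+1 = sigma 0%N :: mkseq (fun i => sigma i.+1) n.
Proof. by rewrite /mkseq /= -[1%N]addn0 iotaDl -map_comp. Qed.

Lemma bigcup_souslin (A : nat -> set T) :
  (forall i, souslin (A i)) -> souslin (\bigcup_i A i).
Proof.
move=> /choice[F HF].
exists (fun s => if s is i :: s' then F i s' else setT); split.
  by case=> [|i s]; [exact: closedT | case: (HF i)].
apply/seteqP; split=> x.
  move=> [i _]; rewrite (HF i).2 => -[sigma Hs].
  exists (fun n => if n is n'.+1 then sigma n' else i) => -[|n] //.
  by rewrite mkseq_cons; exact: Hs.
move=> [sigma Hs]; exists (sigma 0%N) => //; rewrite (HF _).2.
exists (fun i => sigma i.+1) => n.
by move: (Hs n.+1); rewrite (mkseq_cons sigma n).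
Qed.

(** One branch [tau] codes a sequence of branches, the [i]-th being [tau (g (i, m))] in the variable
    [m]; the scheme at [s] imposes every condition whose codes fall within [s]. *)
Lemma bigcap_souslin (A : nat -> set T) :
  (forall i, souslin (A i)) -> souslin (\bigcap_i A i).
Proof.
move=> /choice[F HF].
have /card_set_bijP[f [_ finj fsurj]] : ([set: nat] #= [set: nat * nat])%card.
  by rewrite card_eq_sym; exact: card_nat2.
have /choice[g gK] : forall p : nat * nat, exists m, f m = p.
  by move=> p; have [m _ <-] := fsurj p Logic.I; exists m.
exists (fun s => [set x | forall i n, (forall m, (m < n)%N -> (g (i, m) < size s)%N) ->
  F i (mkseq (fun m => nth 0%N s (g (i, m))) n) x]); split.
  move=> s.
  have -> : [set x | forall i n, (forall m, (m < n)%N -> (g (i, m) < size s)%N) ->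
      F i (mkseq (fun m => nth 0%N s (g (i, m))) n) x] =
    \bigcap_(p in [set p : nat * nat | forall m, (m < p.2)%N -> (g (p.1, m) < size s)%N])
      F p.1 (mkseq (fun m => nth 0%N s (g (p.1, m))) p.2).
    apply/seteqP; split=> x /= H; first by move=> [i n] /= /H.
    by move=> i n /(H (i, n)).
  by apply: closed_bigI => -[i n] _; case: (HF i).
apply/seteqP; split=> x.
  move=> Ax.
  have /choice[sigma Hs] : forall i, exists sigma : nat -> nat, forall n, F i (mkseq sigma n) x.
    by move=> i; have := Ax i Logic.I; rewrite (HF i).2.
  exists (fun m => sigma (f m).1 (f m).2) => N i n gN.
  suff -> : mkseq (fun m => nth 0%N (mkseq (fun m => sigma (f m).1 (f m).2) N) (g (i, m))) n
    = mkseq (sigma i) n by exact: Hs.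
  apply/eq_in_map => m; rewrite mem_iota /= add0n => mn.
  by have := gN m mn; rewrite size_mkseq => gm; rewrite nth_mkseq // gK.
move=> [tau Ht] i _; rewrite (HF i).2; exists (fun m => tau (g (i, m))) => n.
pose N := (\max_(m < n) g (i, val m)).+1.
have gN m : (m < n)%N -> (g (i, m) < N)%N.
  by move=> mn; rewrite ltnS; exact: (leq_bigmax (Ordinal mn)).
have := Ht N i n; rewrite size_mkseq => /(_ gN).
suff -> : mkseq (fun m => nth 0%N (mkseq tau N) (g (i, m))) n =
  mkseq (fun m => tau (g (i, m))) n by [].
by apply/eq_in_map => m; rewrite mem_iota /= add0n => mn; rewrite nth_mkseq // gN.
Qed.

Variables (big : set T -> Prop).
Hypothesis big_mono : forall A B, A `<=` B -> big A -> big B.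
Hypothesis big_cup : forall A : nat -> set T, (forall n, A n `<=` A n.+1) ->
  big (\bigcup_n A n) -> exists n, big (A n).

Section Scheme.
Variable F : seq nat -> set T.
Hypothesis cF : forall s, closed (F s).

Let bounded_part (b : seq nat) : set T := [set x | exists sigma : nat -> nat,
  (forall i, (i < size b)%N -> (sigma i <= nth 0%N b i)%N) /\
  forall n, F (mkseq sigma n) x].

Fixpoint closed_hull (b s : seq nat) : set T :=
  F s `&` if b is c :: b' then \bigcup_(i in `I_c.+1) closed_hull b' (rcons s i)
          else setT.

Let bounded_part_hull (b s : seq nat) (sigma : nat -> nat) x :
  (forall i, (i < size b)%N -> (sigma (size s + i) <= nth 0%N b i)%N) ->
  s = mkseq sigma (size s) -> (forall n, F (mkseq sigma n) x) -> closed_hull b s x.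
Proof.
elim: b s => [|c b IH] s Hb es Hs /=; split=> //; rewrite ?[s in F s]es //.
exists (sigma (size s)); first by rewrite /= ltnS; have := Hb 0%N (ltn0Sn _); rewrite addn0.
apply: IH => //.
  by move=> i ib; have := Hb i.+1 ib; rewrite size_rcons addSnnS.
by rewrite size_rcons mkseqS -es.
Qed.

Let closed_closed_hull b s : closed (closed_hull b s).
Proof.
elim: b s => [|c b IH] s /=; first by rewrite setIT.
apply: closedI => //.
by apply: closed_bigcup => [|i _]; [exact: finite_II | exact: IH].
Qed.

Let closed_hull_cat b b' s : closed_hull (b ++ b') s `<=` closed_hull b s.
Proof.
elim: b s => [|c b IH] s x /=; first by case: b' => [|? ?] /= [].
by move=> [Fx [i ic Hx]]; split=> //; exists i => //; exact: IH.
Qed.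

(* [closed_hull b [::]] only looks at the finitely many branches bounded by [b];
   the bounds are chosen so that the branches bounded by them stay big, and by
   Koenig's lemma a point of all the hulls lies in the Souslin set. *)
Lemma choquet_scheme :
  big [set x | exists sigma : nat -> nat, forall n, F (mkseq sigma n) x] ->
  exists C : nat -> set T, [/\ forall j, closed (C j), forall j, C j.+1 `<=` C j,
    \bigcap_j C j `<=` [set x | exists sigma : nat -> nat, forall n, F (mkseq sigma n) x] &
    forall j, big (C j)].
Proof.
move=> bigB.
have [b Hb] : exists b : nat -> nat, forall l, big (bounded_part (mkseq b l)).
  apply: (exists_branch (P := fun s => big (bounded_part s))).
    by apply: big_mono bigB => x [sigma Hs]; exists sigma.
  move=> s; have -> : bounded_part s = \bigcup_n bounded_part (rcons s n).
    apply/seteqP; split=> x.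
      move=> [sigma [H1 H2]]; exists (sigma (size s)) => //; exists sigma; split=> // i.
      rewrite size_rcons ltnS leq_eqVlt nth_rcons => /orP[/eqP ->|ib]; rewrite ?ltnn ?eqxx //.
      by rewrite ib H1.
    move=> [n _ [sigma [H1 H2]]]; exists sigma; split=> // i ib.
    by have := H1 i; rewrite size_rcons nth_rcons ib; apply; rewrite ltnW.
  apply: big_cup => n x [sigma [H1 H2]]; exists sigma; split=> // i.
  move=> ib; have := H1 i; rewrite !size_rcons !nth_rcons in ib * => /(_ ib).
  case: ifP => // _; case: ifP => // _; exact: leqW.
exists (fun j => closed_hull (mkseq b j) [::]); split=> //.
- by move=> j; rewrite mkseqS -cats1; exact: closed_hull_cat.
- move=> x Hx.
  pose good s := forall j, closed_hull [seq b i | i <- iota (size s) j] s x.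
  have [sigma Hs] : exists sigma : nat -> nat, forall l, good (mkseq sigma l).
    apply: exists_branch; first by move=> j; exact: Hx.
    move=> s gs; apply: contrapT => /forallNP H.
    have /choice[J HJ] : forall c, exists j,
        ~ closed_hull [seq b i | i <- iota (size s).+1 j] (rcons s c) x.
      by move=> c; have /existsNP := H c; rewrite size_rcons.
    (* Were each child [c] up to the bound to fail at its own depth [J c], all would fail at the
       largest of these depths, although [x] lies in the hull of [s] one level deeper. *)
    pose M := \max_(c < (b (size s)).+1) J c.
    have [_ /= [c cb]] := gs M.+1.
    have le : (J c <= M)%N by exact: (leq_bigmax (Ordinal cb)).
    change (closed_hull [seq b i | i <- iota (size s).+1 M] (rcons s c) x -> False).
    by rewrite -(subnKC le) iotaD map_cat => /closed_hull_cat; exact: HJ.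
  by exists sigma => n; have := Hs n 0%N => -[].
- move=> j; apply: big_mono (Hb j) => x [sigma [H1 H2]].
  exact: (bounded_part_hull (sigma := sigma)).
Qed.

End Scheme.

(** Only monotonicity and upward continuity are asked of [big], so bigness is asserted of each [C j]
    and not of their intersection. *)
Lemma choquet B : souslin B -> big B ->
  exists C : nat -> set T, [/\ forall j, closed (C j), forall j, C j.+1 `<=` C j,
    \bigcap_j C j `<=` B & forall j, big (C j)].
Proof. by move=> [F [cF ->]]; exact: choquet_scheme. Qed.

End Souslin.

Lemma open_souslin (R : realType) (T : pseudoMetricType R) (U : set T) :
  open U -> souslin U.
Proof.
move=> oU.
pose K n := closure [set x | ball x (n.+1%:R^-1 : R) `<=` U].
have -> : U = \bigcup_n K n.
  apply/seteqP; split=> x.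
    move=> Ux; have /nbhs_ballP[e /= e0 eU] : nbhs x U by apply: open_nbhs_nbhs.
    have [n ne] : exists n, n.+1%:R^-1 < e.
      have [n _ /(_ n (leqnn n))] := near_infty_natSinv_lt (PosNum e0); by exists n.
    exists n => //; apply: subset_closure => y /= yx; apply: eU.
    exact: le_ball (ltW ne) _ yx.
  move=> [n _] /(_ (ball x (n.+1%:R^-1))); case=> [|y [/= yU xy]].
    by apply: nbhsx_ballx.
  by apply: yU; exact: ball_sym.
by apply: bigcup_souslin => n; apply: closed_souslin; exact: closed_closure.
Qed.

(** The Souslin sets with Souslin complement form a sigma-algebra, which makes the induction stable
    under complements. *)
Lemma borel_souslin (R : realType) n (B : set 'rV[R]_n) : borel B -> souslin B.
Proof.
move=> bB.
suff : (souslin B /\ souslin (~` B)) by case.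
have := bB; rewrite /borel.
apply: (smallest_sub (X := [set A : set 'rV[R]_n | souslin A /\ souslin (~` A)])).
  split=> /=.
  - by split; apply: closed_souslin; rewrite ?setC0; [exact: closed0 | exact: closedT].
  - by move=> A [h1 h2]; rewrite setTD setCK.
  - move=> A HA; split; first by apply: bigcup_souslin => i; case: (HA i).
    by rewrite setC_bigcup; apply: bigcap_souslin => i; case: (HA i).
move=> U oU; split; first exact: open_souslin.
by apply: closed_souslin; exact: open_closedC.
Qed.

(** * Transversality *)

Lemma size_window (R : realType) (s : seq nat) (d : R) : uniq s -> 0 <= d ->
  (forall x y, x \in s -> y \in s -> `|x%:R - y%:R| <= d) -> (size s)%:R <= d + 1.
Proof.
move=> us d0 H; have [[x xs]|ne] := pselect (exists x, x \in s); last first.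
  case: s us H ne => [|x s] _ _ ne; first by rewrite addr_ge0.
  by case: ne; exists x; rewrite mem_head.
have ex : exists x, x \in s by exists x.
pose m := ex_minn ex; have [ms mmin] : m \in s /\ forall y, y \in s -> (m <= y)%N.
  by rewrite /m; case: ex_minnP.
have sub : {subset s <= iota m (Num.truncn d).+1}.
  move=> y ys; rewrite mem_iota mmin //= addnS ltnS -leq_subLR.
  rewrite truncn_ge_nat // natrB ?mmin //.
  by apply: le_trans (H _ _ ys ms); exact: ler_norm.
have := uniq_leq_size us sub; rewrite size_iota -(ler_nat R) => /le_trans; apply.
by rewrite -natr1 lerD2r truncn_le.
Qed.

Section Transversality.
Variables (R : realType) (k n : nat).

(** With the constant term as the first row of [M], evaluation is linear in [M], and two graphs are
    compared through the difference of their matrices. *)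
Definition affine_eval (M : 'M[R]_(1 + k, n)) (t : 'rV[R]_k) : 'rV[R]_n :=
  row_mx 1%:M t *m M.

Lemma affine_evalE M t i j :
  affine_eval M t i j = M (lshift k ord0) j + \sum_c t ord0 c * M (rshift 1 c) j.
Proof.
rewrite ord1 mxE big_split_ord /= big_ord1 row_mxEl mxE eqxx mul1r; congr (_ + _).
by apply: eq_bigr => c _; rewrite row_mxEr.
Qed.

Lemma affine_evalB M M' t : affine_eval (M - M') t = affine_eval M t - affine_eval M' t.
Proof. exact: mulmxBr. Qed.

Lemma affine_eval_lip (M : 'M[R]_(1 + k, n)) (t t' : 'rV[R]_k) (j : 'I_n) (e c : R) : (forall i j, `|M i j| <= c) ->
  (forall i, `|t ord0 i - t' ord0 i| <= e) ->
  `|affine_eval M t ord0 j - affine_eval M t' ord0 j| <= k%:R * (e * c).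
Proof.
move=> Mc te; rewrite !affine_evalE opprD addrACA subrr add0r -sumrB.
apply: le_trans (ler_norm_sum _ _ _) _.
apply: (@le_trans _ _ (\sum_(i < k) e * c)); last by rewrite sumr_const card_ord -[leLHS]mulr_natl.
by apply: ler_sum => i _; rewrite -mulrBl normrM ler_pM.
Qed.

Lemma affine_eval_le (M : 'M[R]_(1 + k, n)) (t : 'rV[R]_k) (j : 'I_n) (e c : R) : (forall i j, `|M i j| <= c) -> 0 <= c ->
  (forall i, `|t ord0 i| <= e) -> `|affine_eval M t ord0 j| <= (1 + k%:R * e) * c.
Proof.
move=> Mc c0 te; rewrite affine_evalE mulrDl mul1r.
apply: le_trans (ler_normD _ _) _; apply: lerD => //.
apply: le_trans (ler_norm_sum _ _ _) _; rewrite -mulrA.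
apply: (@le_trans _ _ (\sum_(i < k) e * c)); last by rewrite sumr_const card_ord -[leLHS]mulr_natl.
by apply: ler_sum => i _; rewrite normrM ler_pM.
Qed.

Variable N : nat.
Notation word := (N.-tuple (digit 1 k)).

Definition corner (w : seq (digit 1 k)) : 'rV[R]_k :=
  \row_i ((num w (ord0, i))%:R * 2^-1 ^+ size w).

Definition bnum (v : seq bool) : nat := foldl (fun n (b : bool) => (n.*2 + b)%N) 0%N v.

Lemma num_bnum a b (w : seq (digit a b)) p : num w p = bnum [seq (c : digit a b) p | c <- w].
Proof.
by elim/last_ind: w => [//|w c IH]; rewrite num_rcons map_rcons /bnum foldl_rcons IH.
Qed.

Lemma bnum_inj v v' : size v = size v' -> bnum v = bnum v' -> v = v'.
Proof.
elim/last_ind: v v' => [|v c IH] v'; first by case: v'.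
case/lastP: v' => [|v' c']; rewrite !size_rcons // => -[sv].
rewrite /bnum !foldl_rcons -!/(bnum _) => H.
have [hv hc] : bnum v = bnum v' /\ c = c'.
  by case: c H; case: c' => /= h; split=> //; lia.
by rewrite hc (IH v').
Qed.

Let upd (i : 'I_k) (w : word) (v : N.-tuple bool) : word :=
  [tuple [ffun p : 'I_1 * 'I_k => if p.2 == i then tnth v x else tnth w x p] | x < N].

Let coord (i : 'I_k) (w : word) : N.-tuple bool := [tuple tnth w x (ord0, i) | x < N].

Let num_upd i w v c :
  num (upd i w v) (ord0, c) = if c == i then bnum v else num w (ord0, c).
Proof.
rewrite !num_bnum.
have -> : [seq (d : digit 1 k) (ord0, c) | d <- upd i w v] =
    if c == i then tval v else [seq (d : digit 1 k) (ord0, c) | d <- w].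
  apply: (@eq_from_nth _ false); first by rewrite size_map size_tuple; case: ifP; rewrite ?size_map size_tuple.
  move=> x; rewrite size_map size_tuple => xN.
  have e0 : digit 1 k by exact: [ffun=> false].
  rewrite (nth_map e0) ?size_tuple // -(tnth_nth e0 (upd i w v) (Ordinal xN)) tnth_mktuple ffunE /=.
  case: ifP => _; first by rewrite (tnth_nth false).
  by rewrite (nth_map e0) ?size_tuple // (tnth_nth e0).
by case: ifP.
Qed.

(* Exchanging the [i]-th coordinate of a word with a free string of bits is an
   involution, so counting along lines needs no product decomposition. *)
Let swap (i : 'I_k) (q : word * N.-tuple bool) := (upd i q.1 q.2, coord i q.1).

Let swapK i : involutive (swap i).
Proof.
move=> [w v]; rewrite /swap /=; congr pair; apply: eq_from_tnth => x;
  rewrite !tnth_mktuple /= ?ffunE ?eqxx //=.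
by apply/ffunP => -[u c]; rewrite ffunE /= (ord1 u); case: eqP => [->|] //=; rewrite ffunE /=; case: eqP.
Qed.

Let fiber_bound (i : 'I_k) (S : pred word) (K : R) :
  (forall w, (#|[pred v | S (upd i w v)]|)%:R <= K) ->
  (#|S|)%:R * 2 ^+ N <= (2 ^ (k * N))%:R * K.
Proof.
move=> H.
have -> : (#|S|)%:R * 2 ^+ N = \sum_(w : word) (#|[pred v | S (upd i w v)]|)%:R :> R.
  have -> : (2 : R) ^+ N = (#|{: N.-tuple bool}|)%:R by rewrite card_tuple card_bool natrX.
  rewrite -natrM -natr_sum; congr (_%:R).
  transitivity (\sum_(q : word * N.-tuple bool) (S q.1 : nat))%N.
    rewrite -(pair_bigA _ (fun w _ => (S w : nat))) /=.
    under eq_bigr do rewrite sum_nat_const mulnC.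
    rewrite -big_distrl /=; congr (_ * _)%N; rewrite -sum1_card big_mkcond.
    by apply: eq_bigr => w _; rewrite unfold_in; case: (S w).
  rewrite (reindex_inj (inv_inj (swapK i))) /=.
  rewrite -(pair_bigA _ (fun w v => (S (upd i w v) : nat))) /=.
  apply: eq_bigr => w _; rewrite -sum1_card [RHS]big_mkcond.
  by apply: eq_bigr => v _; rewrite inE; case: (S _).
apply: (@le_trans _ _ (\sum_(w : word) K)); first exact: ler_sum.
by rewrite sumr_const card_tuple card_digit mul1n -expnM mulr_natl.
Qed.

(** If some slope in column [j0] is at least [r / (2 * k.+1)], then on each line in that direction
    the indices allowed form a short window. Otherwise the slopes change the value by at most
    [r / 2] on the unit cube and the large entry is the constant term; the set is then empty or the
    claimed bound exceeds the number of all words. *)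
Lemma count_small (D : 'M[R]_(1 + k, n)) (C r : R) (l : nat) (i0 : 'I_(1 + k)) (j0 : 'I_n) :
  0 < r -> r <= 1 -> 0 <= C -> (l <= N)%N -> r <= `|D i0 j0| ->
  (#|[pred w : word | [forall c, `|affine_eval D (corner w) ord0 c| <= C * 2^-1 ^+ l]]|)%:R <=
  (4 * C * k.+1%:R + 1) * 2^-1 ^+ l / r * (2 ^ (k * N))%:R :> R.
Proof.
move=> r0 r1 C0 lN rD; set S := [pred w : word | _].
have h0 : 0 < 2^-1 ^+ l :> R by rewrite exprn_gt0.
have N0 : 0 < 2 ^+ N :> R by rewrite exprn_gt0.
have hN : 0 < 2^-1 ^+ N :> R by rewrite exprn_gt0.
have NN : 2^-1 ^+ N * 2 ^+ N = 1 :> R by rewrite -exprMn mulVf ?expr1n.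
have [[i Hi]|nA] := pselect (exists i : 'I_k, r / (2 * k.+1%:R) <= `|D (rshift 1 i) j0|).
  set a := D (rshift 1 i) j0 in Hi.
  have a0 : 0 < `|a| by apply: lt_le_trans Hi; rewrite divr_gt0 // mulr_gt0.
  have fib w : (#|[pred v | S (upd i w v)]|)%:R <= 2 * C * 2^-1 ^+ l * 2 ^+ N / `|a| + 1 :> R.
    rewrite cardE -(size_map (fun v : N.-tuple bool => bnum v)).
    apply: size_window.
    - rewrite map_inj_uniq ?enum_uniq // => v v' /bnum_inj e.
      by apply: val_inj; apply: e; rewrite !size_tuple.
    - by rewrite divr_ge0 ?normr_ge0 // !mulr_ge0 // ltW.
    move=> x y /mapP[v + ->] /mapP[v' + ->].
    rewrite !mem_enum !inE => /forallP /(_ j0) h1 /forallP /(_ j0) h2.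
    pose X := D (lshift k ord0) j0 +
      \sum_(c | c != i) (num w (ord0, c))%:R * 2^-1 ^+ N * D (rshift 1 c) j0.
    have E u : affine_eval D (corner (upd i w u)) ord0 j0 = X + (bnum u)%:R * 2^-1 ^+ N * a.
      have es : \sum_(c | c != i) corner (upd i w u) ord0 c * D (rshift 1 c) j0 =
          \sum_(c | c != i) (num w (ord0, c))%:R * 2^-1 ^+ N * D (rshift 1 c) j0.
        by apply: eq_bigr => c ci; rewrite mxE num_upd (negbTE ci) size_tuple.
      rewrite affine_evalE (bigD1 i) // es mxE num_upd eqxx size_tuple /X.
      by rewrite -[RHS]addrA [in RHS](addrC (\sum_(_ | _) _)).
    rewrite ler_pdivlMr //.
    have : `|((bnum v)%:R - (bnum v')%:R) * a| * 2^-1 ^+ N <= 2 * C * 2^-1 ^+ l.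
      rewrite -{1}(gtr0_norm hN) -normrM.
      have -> : ((bnum v)%:R - (bnum v')%:R) * a * 2^-1 ^+ N =
        (X + (bnum v)%:R * 2^-1 ^+ N * a) - (X + (bnum v')%:R * 2^-1 ^+ N * a) by ring.
      rewrite -!E; apply: le_trans (ler_normB _ _) _; lra.
    rewrite normrM => h3; rewrite -(ler_pM2r hN) -[leRHS]mulrA [_ * 2^-1 ^+ N in leRHS]mulrC NN mulr1.
    exact: h3.
  have := fiber_bound fib.
  rewrite -(ler_pM2r hN) -[leLHS]mulrA [2 ^+ N * 2^-1 ^+ N]mulrC NN mulr1.
  move=> /le_trans; apply.
  rewrite -[leLHS]mulrA [leLHS]mulrC ler_wpM2r // [leLHS]mulrDl mul1r.
  have aux (c p q b : R) : q * p = 1 -> c * p / b * q = c / b.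
    by move=> e; rewrite -[RHS]mulr1 -e; ring.
  rewrite (aux _ _ _ _ NN).
  have i1 : `|a|^-1 <= (2 * k.+1%:R) / r.
    rewrite -[leRHS]invf_div lef_pV2 // posrE divr_gt0 // mulr_gt0 //.
  (* The extra point of each window has proportion [2^-N], which is within the bound since [l <= N]
     and [r <= 1]. *)
  have i2 : 2^-1 ^+ N <= 2^-1 ^+ l / r.
    rewrite ler_pdivlMr //; apply: (@le_trans _ _ (2^-1 ^+ N)).
      by rewrite ler_piMr // exprn_ge0.
    by rewrite ler_wiXn2l // invf_le1 // ler1n.
  rewrite [X in _ <= X / r]mulrDl [leRHS]mulrDl mul1r; apply: lerD => //.
  have -> : 4 * C * k.+1%:R * 2^-1 ^+ l / r = 2 * C * 2^-1 ^+ l * (2 * k.+1%:R / r).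
    have aux' (c x z b : R) : 4 * c * x * z / b = 2 * c * z * (2 * x / b) by ring.
    exact: aux'.
  by apply: ler_wpM2l => //; rewrite !mulr_ge0 // ltW.
have small c : `|D (rshift 1 c) j0| < r / (2 * k.+1%:R).
  by rewrite ltNge; apply/negP => h; apply: nA; exists c.
have k0 : 0 < 2 * k.+1%:R :> R by rewrite mulr_gt0.
have rk : r / (2 * k.+1%:R) <= r.
  by rewrite ler_pdivrMr // ler_peMr ?(ltW r0) // -natrM ler1n.
have ei : D (lshift k ord0) j0 = D i0 j0.
  case: (split_ordP i0) rD => [u ->|c ->]; first by rewrite (ord1 u).
  by move=> h; have := le_lt_trans h (lt_le_trans (small c) rk); rewrite ltxx.
have [[w wS]|nS] := pselect (exists w, w \in S); last first.
  rewrite eq_card0 ?mulr_ge0 ?invr_ge0 ?(ltW r0) ?(ltW h0) ?addr_ge0 ?mulr_ge0 //.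
  by move=> w; apply/negP => wS; apply: nS; exists w.
have card_le : #|S|%:R <= (2 ^ (k * N))%:R :> R.
  rewrite ler_nat; apply: leq_trans (max_card _) _.
  by rewrite card_tuple card_digit mul1n -expnM.
apply: le_trans card_le _; rewrite ler_peMl //.
have corner01 c : `|corner w ord0 c| <= 1.
  rewrite mxE size_tuple ger0_norm ?mulr_ge0 ?exprn_ge0 //.
  rewrite exprVn ler_pdivrMr // mul1r -natrX ler_nat ltnW //.
  by rewrite -{2}(size_tuple w) num_lt.
have sum_le : `|\sum_c corner w ord0 c * D (rshift 1 c) j0| <= r / 2.
  apply: le_trans (ler_norm_sum _ _ _) _.
  apply: (@le_trans _ _ (\sum_(c < k) r / (2 * k.+1%:R))).
    apply: ler_sum => c _; rewrite normrM.
    apply: le_trans (ltW (small c)); rewrite ler_piMl //.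
  rewrite sumr_const card_ord -[leLHS]mulr_natl mulrA ler_pdivrMr //.
  have -> : r / 2 * (2 * k.+1%:R) = k.+1%:R * r by field.
  by rewrite ler_wpM2r ?(ltW r0) // ler_nat.
have : r / 2 <= C * 2^-1 ^+ l.
  move: wS; rewrite inE => /forallP /(_ j0); rewrite affine_evalE ei.
  move: rD sum_le; set s := \sum_(_ < _) _; move=> rD sl h.
  have := ler_normB (D i0 j0 + s) s; rewrite addrK => h'; lra.
move=> h; rewrite ler_pdivlMr // mul1r.
have : 1 <= k.+1%:R :> R by rewrite ler1n.
move=> k1; have : C * 2^-1 ^+ l <= C * k.+1%:R * 2^-1 ^+ l.
  by rewrite ler_wpM2r ?(ltW h0) // ler_peMr.
lra.
Qed.

End Transversality.

(* [nu <= a + nu^2 / a] for each covering set, where [nu] is the mass assigned to it *)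
Lemma sum_le_cover_energy (R : realFieldType) (Q K : eqType) (s : seq Q) (T : pred Q)
    (m : Q -> R) (U : seq K) (f : Q -> K) (a : K -> R) :
  (forall q, q \in s -> 0 <= m q) -> (forall u, 0 < a u) ->
  (forall q, q \in s -> T q -> f q \in U) ->
  \sum_(q <- s | T q) m q <= \sum_(u <- U) a u +
    \sum_(q <- s | T q) \sum_(q' <- s | T q' && (f q' == f q)) m q * m q' / a (f q).
Proof.
move=> m0 a0 fU.
pose V := undup U; pose nu u := \sum_(q <- s | T q && (f q == u)) m q.
have regroup (g : Q -> R) :
    \sum_(u <- V) \sum_(q <- s | T q && (f q == u)) g q = \sum_(q <- s | T q) g q.
  under eq_bigr do rewrite big_mkcondr.
  rewrite exchange_big /= big_seq_cond [RHS]big_seq_cond.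
  apply: eq_bigr => q /andP[qs Tq].
  rewrite -big_mkcond (eq_bigl (pred1 (f q))); last by move=> u; rewrite /= eq_sym.
  by rewrite -big_filter filter_pred1_uniq ?undup_uniq ?mem_undup ?fU // big_seq1.
have amgm u : nu u <= a u + nu u * nu u / a u.
  rewrite -(ler_pM2r (a0 u)) mulrDl divfK ?gt_eqF //.
  have := sqr_ge0 (nu u - a u); rewrite expr2; nra.
rewrite -regroup; apply: le_trans (ler_sum _ (fun u _ => amgm u)) _.
rewrite big_split /=; apply: lerD.
  rewrite /V; elim: (U) => [|u U' IH] /=; first by rewrite !big_nil.
  by case: ifP => _; rewrite !big_cons ?lerD2l // (le_trans IH) // lerDr ltW.
rewrite -[leRHS]regroup; apply: ler_sum => u _.
rewrite {1}/nu !mulr_suml; apply: ler_sum => q /andP[_ /eqP <-].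
by rewrite /nu mulr_sumr mulr_suml.
Qed.

Lemma mxDE (R : nmodType) a b (A B : 'M[R]_(a, b)) i j : (A + B) i j = A i j + B i j.
Proof. by rewrite !mxE. Qed.

Lemma mxBE (R : zmodType) a b (A B : 'M[R]_(a, b)) i j : (A - B) i j = A i j - B i j.
Proof. by rewrite !mxE. Qed.

(** * Average energy of the slices of a discrete Frostman measure *)

Section Core.
Variables (R : realType) (k n : nat) (rho : R).
Hypotheses (rho0 : 0 < rho) (rho1 : rho < 1) (rho2 : 2^-1 < rho).

Local Notation params := (nat -> digit (1 + k) n).
Local Notation prm := (@bin_val R (1 + k) n).
Implicit Types (mu : seq (params * R)) (q : params * R).

(** Closeness is tested at the corner of the cube only; the variation of the graphs over the cube
    will be absorbed in [C]. *)
Definition near_cond (C : R) l (w : seq (digit 1 k)) (x x' : params) :=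
  [forall c, `|affine_eval (prm x - prm x') (corner R w) ord0 c| <= C * 2^-1 ^+ l].

Definition admissible mu N := (forall q, q \in mu -> 0 <= q.2) /\
  forall u, (size u <= N)%N -> mass mu u <= rho ^+ size u.

Lemma mass_ball mu N (x : params) l : admissible mu N -> (l <= N)%N ->
  \sum_(q <- mu | [forall i, forall j, `|prm x i j - prm q.1 i j| < 2^-1 ^+ l]) q.2
  <= (3 ^ ((1 + k) * n))%:R * rho ^+ l.
Proof.
move=> [mu0 muw] lN.
pose ws := close_words (prm x) l.
apply: (@le_trans _ _ (\sum_(w <- ws) mass mu w)).
  rewrite /mass (exchange_big_dep xpredT) //=.
  rewrite big_mkcond big_seq [leRHS]big_seq; apply: ler_sum => q qmu.
  have s0 : 0 <= \sum_(w <- ws | mkseq q.1 (size w) == w) q.2.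
    by apply: sumr_ge0 => ? _; exact: mu0.
  case: ifP => // /forallP H.
  have h : mkseq q.1 l \in ws.
    by apply: mem_close_words => i j; have /forallP := H i; apply.
  by rewrite (big_rem _ h) /= size_mkseq eqxx lerDl sumr_ge0 // => *; exact: mu0.
apply: (@le_trans _ _ (\sum_(w <- ws) rho ^+ l)).
  rewrite big_seq [leRHS]big_seq; apply: ler_sum => w wws.
  have sw := close_words_size wws.
  by have := muw w; rewrite sw; apply.
rewrite big_const_seq count_predT iter_addr_0 -[leLHS]mulr_natl ler_wpM2r ?exprn_ge0 ?(ltW rho0) //.
by rewrite ler_nat size_close_words.
Qed.

Lemma mass_ball2 mu N (x : params) i : admissible mu N -> (i <= N)%N ->
  \sum_(q <- mu | [forall a, forall b, `|prm x a b - prm q.1 a b| < 2 * 2^-1 ^+ i]) q.2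
  <= (3 ^ ((1 + k) * n))%:R / rho * rho ^+ i.
Proof.
move=> adm; case: i => [|i] iN; last first.
  rewrite exprS mulrA mulfV // mul1r.
  apply: le_trans (mass_ball x adm (ltnW iN)) _.
  by rewrite exprS mulrA divfK ?gt_eqF.
(* For [i = 0] there is no earlier level; the mass at the root bounds everything by 1. *)
rewrite [rho ^+ 0]expr0 [leRHS]mulr1.
have [mu0 muw] := adm.
apply: (@le_trans _ _ 1).
  apply: le_trans (_ : mass mu [::] <= _); last exact: muw.
  rewrite /mass big_mkcond big_seq [leRHS]big_seq; apply: ler_sum => q /mu0 q0.
  by case: ifP.
by rewrite ler_pdivlMr // mul1r (le_trans (ltW rho1)) // ler1n expn_gt0.
Qed.

Lemma ler_sum_geo (x : R) l : 1 < x -> \sum_(i < l.+1) x ^+ i <= x / (x - 1) * x ^+ l.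
Proof.
move=> x1; have x10 : 0 < x - 1 by rewrite subr_gt0.
rewrite mulrAC ler_pdivlMr // mulrC -subrX1 -exprS.
by rewrite lerBlDr lerDl.
Qed.

(** The factors come from [count_small], from [mass_ball2], and from the geometric sum of ratio
    [2 * rho]. *)
Definition shell_const (C : R) : R :=
  (4 * C * k.+1%:R + 1) * ((3 ^ ((1 + k) * n))%:R / rho) * ((2 * rho) / (2 * rho - 1)).

(** Sort the atoms by the dyadic size [2^-i] of their distance to [x]. A shell has mass of order
    [rho^i], and each of its atoms is near [x] over a proportion [2^-l / 2^-i] of the cubes. As
    [2 * rho > 1] the terms [(2 * rho)^i] are dominated by the last one, which leaves [rho^l]. *)
Lemma shell_sum mu N (C : R) (x : params) l : admissible mu N -> (l <= N)%N -> 0 <= C ->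
  \sum_(q <- mu) q.2 * (#|[pred w : N.-tuple (digit 1 k) | near_cond C l w x q.1]|)%:R
  <= shell_const C * rho ^+ l * (2 ^ (k * N))%:R.
Proof.
move=> adm lN C0; have [mu0 muw] := adm.
pose K := 4 * C * k.+1%:R + 1; pose W : R := (2 ^ (k * N))%:R.
have K1 : 1 <= K by rewrite lerDr !mulr_ge0.
have W0 : 0 <= W by rewrite ler0n.
(* The radius is doubled so that shell 0 contains all parameters: two entries in [0, 1] may differ
   by exactly 1. *)
pose near i (y : params) := [forall a, forall b, `|prm x a b - prm y a b| < 2 * 2^-1 ^+ i].
have h0 i : 0 < 2^-1 ^+ i :> R by rewrite exprn_gt0.
have bound y : (#|[pred w : N.-tuple (digit 1 k) | near_cond C l w x y]|)%:R <=
    \sum_(i < l.+1) (if near i y then K * (2^-1 ^+ l / 2^-1 ^+ i) * W else 0).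
  have near0 : near 0%N y.
    apply/forallP => a; apply/forallP => b.
    have /andP[? ?] := bin_val01 R x a b; have /andP[? ?] := bin_val01 R y a b.
    rewrite expr0 ltr_norml; apply/andP; split; lra.
  have [i /andP[il ni] imax] := @ex_maxnP (fun i => (i <= l)%N && near i y) l
    (ex_intro _ 0%N near0) (fun i h => proj1 (andP h)).
  have t0 (j : 'I_l.+1) : 0 <= (if near j y then K * (2^-1 ^+ l / 2^-1 ^+ j) * W else 0).
    by case: ifP => // _; rewrite !mulr_ge0 ?invr_ge0 ?(ltW (h0 _)) ?(le_trans _ K1).
  rewrite (bigD1 (Ordinal (il : (i < l.+1)%N))) //= ni.
  apply: (@le_trans _ _ (K * (2^-1 ^+ l / 2^-1 ^+ i) * W)); last first.
    by rewrite lerDl; apply: sumr_ge0 => j _.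
  move: il; rewrite leq_eqVlt => /orP[/eqP e|il].
    rewrite e divff ?gt_eqF // mulr1; apply: le_trans (_ : W <= _); last by rewrite ler_peMl.
    by rewrite ler_nat; apply: leq_trans (max_card _) _; rewrite card_tuple card_digit mul1n -expnM.
  have : ~~ near i.+1 y.
    by apply/negP => nS; have := imax i.+1; rewrite il nS ltnn => /(_ isT).
  rewrite negb_forall => /existsP[a]; rewrite negb_forall => /existsP[b].
  rewrite -leNgt exprS mulrA mulfV // mul1r => rD.
  have r1 : 2^-1 ^+ i <= 1 :> R by rewrite exprn_ile1 // invf_le1 // ler1n.
  have := @count_small R k n N (prm x - prm y) C (2^-1 ^+ i) l a b (h0 i) r1 C0 lN.
  by rewrite mxBE mulrA; exact.
apply: (@le_trans _ _ (\sum_(q <- mu) q.2 * \sum_(i < l.+1)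
    (if near i q.1 then K * (2^-1 ^+ l / 2^-1 ^+ i) * W else 0))).
  by rewrite big_seq [leRHS]big_seq; apply: ler_sum => q /mu0 q0; rewrite ler_wpM2l.
under eq_bigr do rewrite mulr_sumr.
rewrite exchange_big /=.
apply: (@le_trans _ _ (\sum_(i < l.+1) K * (2^-1 ^+ l / 2^-1 ^+ i) * W *
    ((3 ^ ((1 + k) * n))%:R / rho * rho ^+ i))).
  apply: ler_sum => i _.
  have c0 : 0 <= K * (2^-1 ^+ l / 2^-1 ^+ i) * W.
    by rewrite !mulr_ge0 ?invr_ge0 ?(ltW (h0 _)) ?(le_trans _ K1).
  apply: le_trans (ler_wpM2l c0 (mass_ball2 x adm (leq_trans (leq_ord i) lN))).
  rewrite mulr_sumr [leRHS]big_mkcond; apply: ler_sum => q _.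
  by rewrite /near; case: ifP => _; rewrite ?mulr0 // mulrC.
have e (i : 'I_l.+1) : K * (2^-1 ^+ l / 2^-1 ^+ i) * W * ((3 ^ ((1 + k) * n))%:R / rho * rho ^+ i)
    = K * ((3 ^ ((1 + k) * n))%:R / rho) * 2^-1 ^+ l * W * (2 * rho) ^+ i.
  rewrite exprMn -exprVn invrK.
  by move: (2^-1 ^+ l) (2 ^+ i) (rho ^+ i) (_ / rho) => p r s t; ring.
under eq_bigr do rewrite e.
rewrite -mulr_sumr.
have r21 : 1 < 2 * rho by rewrite -ltr_pdivrMl // mulr1.
apply: (@le_trans _ _ (K * ((3 ^ ((1 + k) * n))%:R / rho) * 2^-1 ^+ l * W *
   (2 * rho / (2 * rho - 1) * (2 * rho) ^+ l))).
  rewrite ler_wpM2l ?ler_sum_geo // !mulr_ge0 ?invr_ge0 ?(ltW (h0 _)) ?(ltW rho0) //.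
  exact: le_trans K1.
rewrite /shell_const -/K exprMn le_eqVlt; apply/orP; left; apply/eqP.
have e2 : 2^-1 ^+ l * 2 ^+ l = 1 :> R by rewrite -exprMn mulVf ?expr1n.
have aux (z t p r s : R) : p * r = 1 -> z * p * W * (t * (r * s)) = z * t * s * W.
  by move=> pr; rewrite -[RHS]mulr1 -pr; ring.
exact: aux.
Qed.

(** [G] is the set of cubes with a cheap cover and [T x] the set of cubes over which the graph of
    [x] meets the closed set. Adding [sum_le_cover_energy] over [G] gives mass on the left, as each
    atom is seen over half of all cubes, and cost plus energy on the right; [shell_sum] bounds the
    average energy. *)
Lemma finite_core mu N (C eps sigma : R) l0 (G : pred (N.-tuple (digit 1 k)))
    (T : params -> pred (N.-tuple (digit 1 k))) :
  admissible mu N -> 0 <= C -> 0 < sigma -> 0 <= eps ->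
  (forall q, q \in mu ->
    (2 ^ (k * N))%:R / 2 <= (#|[pred w | G w && T q.1 w]|)%:R :> R) ->
  (forall w, G w -> exists (U : seq ('rV[R]_n * nat)) (f : params -> 'rV[R]_n * nat),
    [/\ forall u, u \in U -> (l0 <= u.2 <= N)%N, \sum_(u <- U) sigma ^+ u.2 <= eps,
        forall q, q \in mu -> T q.1 w -> f q.1 \in U &
        forall q q', q \in mu -> q' \in mu -> T q.1 w -> T q'.1 w -> f q'.1 = f q.1 ->
          near_cond C (f q.1).2 w q.1 q'.1]) ->
  total mu / 2 <=
    eps + shell_const C * (\sum_(l0 <= l < N.+1) (rho / sigma) ^+ l) * total mu.
Proof.
move=> adm C0 s0 eps0 GT HG; have [mu0 muw] := adm.
pose Wn : R := (2 ^ (k * N))%:R.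
have Wn0 : 0 < Wn by rewrite ltr0n expn_gt0.
(* A pair is charged at every level at which it is near over [w], whichever ball it shares. This
   charge does not depend on the chosen cover, so it can be averaged over all [w]. *)
pose cst w (q q' : params * R) l : R := if near_cond C l w q.1 q'.1 then (sigma ^+ l)^-1 else 0.
have cst0 w q q' l : 0 <= cst w q q' l.
  by rewrite /cst; case: ifP => // _; rewrite invr_ge0 exprn_ge0 // ltW.
pose en w := \sum_(q <- mu) \sum_(q' <- mu) q.2 * q'.2 * \sum_(l0 <= l < N.+1) cst w q q' l.
have en0 w : 0 <= en w.
  rewrite /en big_seq; apply: sumr_ge0 => q /mu0 q0.
  rewrite big_seq; apply: sumr_ge0 => q' /mu0 q'0.
  by rewrite !mulr_ge0 // sumr_ge0.
have step w : G w -> \sum_(q <- mu | T q.1 w) q.2 <= eps + en w.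
  move=> /HG[U [f [Ul Ueps fU fnear]]].
  apply: le_trans (@sum_le_cover_energy _ _ _ mu (fun q => T q.1 w) (fun q => q.2) U
    (fun q => f q.1) (fun u => sigma ^+ u.2) mu0 _ fU) _; first by move=> u; rewrite exprn_gt0.
  apply: lerD => //.
  rewrite big_mkcond /en big_seq [leRHS]big_seq; apply: ler_sum => q qmu.
  have q0 := mu0 _ qmu.
  have r0 (q' : params * R) : q' \in mu -> 0 <= q.2 * q'.2 * \sum_(l0 <= l < N.+1) cst w q q' l.
    by move=> /mu0 q'0; rewrite !mulr_ge0 // sumr_ge0.
  case: ifP => Tq; last by rewrite big_seq; apply: sumr_ge0 => q' /r0.
  rewrite big_mkcond big_seq [leRHS]big_seq; apply: ler_sum => q' q'mu.
  case: ifP => [/andP[Tq' /eqP ff]|_]; last exact: r0.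
  rewrite ler_wpM2l ?mulr_ge0 ?mu0 //.
  have lr : (f q.1).2 \in index_iota l0 N.+1.
    by rewrite mem_index_iota ltnS; exact: Ul (fU _ qmu Tq).
  rewrite (big_rem _ lr) /= {1}/cst fnear // lerDl; exact: sumr_ge0.
have lhs : total mu * (Wn / 2) <= \sum_(w | G w) \sum_(q <- mu | T q.1 w) q.2.
  under eq_bigr do rewrite big_mkcond.
  rewrite exchange_big /= /total mulr_suml big_seq [leRHS]big_seq; apply: ler_sum => q qmu.
  apply: le_trans (ler_wpM2l (mu0 _ qmu) (GT _ qmu)) _.
  rewrite -big_mkcondr sumr_const mulr_natr lexx //.
have rhs : \sum_(w : N.-tuple (digit 1 k)) en w <=
    Wn * (shell_const C * (\sum_(l0 <= l < N.+1) (rho / sigma) ^+ l) * total mu).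
  rewrite /en exchange_big /=.
  apply: (@le_trans _ _ (\sum_(q <- mu) q.2 * \sum_(l0 <= l < N.+1)
      (sigma ^+ l)^-1 * (shell_const C * rho ^+ l * Wn))).
    rewrite big_seq [leRHS]big_seq; apply: ler_sum => q qmu.
    rewrite exchange_big /=.
    have -> : \sum_(q' <- mu) \sum_(w : N.-tuple (digit 1 k)) q.2 * q'.2 * \sum_(l0 <= l < N.+1) cst w q q' l =
      q.2 * \sum_(l0 <= l < N.+1) (sigma ^+ l)^-1 * \sum_(q' <- mu) q'.2 *
        (#|[pred w : N.-tuple (digit 1 k) | near_cond C l w q.1 q'.1]|)%:R.
      rewrite (eq_bigr (fun q' : params * R => q.2 * \sum_(l0 <= l < N.+1) (sigma ^+ l)^-1 * (q'.2 *
          (#|[pred w : N.-tuple (digit 1 k) | near_cond C l w q.1 q'.1]|)%:R))).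
        rewrite -mulr_sumr exchange_big /=; congr (_ * _); apply: eq_bigr => l _.
        by rewrite mulr_sumr.
      move=> q' _; rewrite -mulr_sumr -mulrA; congr (_ * _).
      rewrite exchange_big /= mulr_sumr; apply: eq_bigr => l _.
      rewrite /cst -big_mkcond sumr_const /= [RHS]mulrCA; congr (_ * _).
      by rewrite mulr_natr.
    apply: ler_wpM2l; first exact: mu0.
    apply: ler_sum_nat => l /andP[_ lN].
    apply: ler_wpM2l; first by rewrite invr_ge0 exprn_ge0 // ltW.
    exact: shell_sum.
  rewrite -mulr_suml -/(total mu) le_eqVlt; apply/orP; left; apply/eqP.
  rewrite mulrC mulrA; congr (_ * _); rewrite mulr_sumr mulr_sumr.
  by apply: eq_bigr => l _; rewrite exprMn exprVn; ring.
rewrite -(ler_pM2l Wn0) mulrDr.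
apply: (@le_trans _ _ (\sum_(w | G w) (eps + en w))).
  rewrite mulrCA; apply: le_trans lhs _; exact: ler_sum.
rewrite big_split /=; apply: lerD.
  rewrite sumr_const -[leLHS]mulr_natl ler_wpM2r // ler_nat.
  by apply: leq_trans (max_card _) _; rewrite card_tuple card_digit mul1n -expnM.
apply: le_trans rhs; rewrite big_mkcond; apply: ler_sum => w _; by case: ifP.
Qed.

End Core.

(** * Slices of unions of graphs *)

Section DyadicNull.
Variables (R : realType) (a b : nat).

Definition dball (q : 'M[R]_(a, b) * nat) : set 'M[R]_(a, b) :=
  [set x | mx_close (2^-1 ^+ q.2) q.1 x].

Definition dcost (sigma : R) (q : 'M[R]_(a, b) * nat) : R := sigma ^+ q.2.

(* For [sigma = 2^-s] this is vanishing of the s-dimensional Hausdorff measure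
   for the maximum metric: balls of radius [2^-l] are charged [2^(-l s)]. *)
Definition dyadic_null (sigma : R) (A : set 'M[R]_(a, b)) :=
  content_le dball (dcost sigma) 0 A.

End DyadicNull.

Section Cubes.
Variables (R : realType) (k : nat).

Definition in_cube (w : seq (digit 1 k)) (t : 'rV[R]_k) := forall c,
  (num w (ord0, c))%:R * 2^-1 ^+ size w <= t ord0 c <=
  ((num w (ord0, c))%:R + 1) * 2^-1 ^+ size w.

Lemma in_cube_val (x : nat -> digit 1 k) j : in_cube (mkseq x j) (bin_val R x).
Proof. by move=> c; rewrite size_mkseq; exact: bin_val_bounds. Qed.

Lemma in_cube_corner (w : seq (digit 1 k)) : in_cube w (corner R w).
Proof. by move=> c; rewrite mxE lexx /= ler_wpM2r ?exprn_ge0 // lerDl. Qed.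

Lemma in_cube_close w t t' c : in_cube w t -> in_cube w t' ->
  `|t ord0 c - t' ord0 c| <= 2^-1 ^+ size w.
Proof.
move=> /(_ c) /andP[h1 h2] /(_ c) /andP[h3 h4].
rewrite mulrDl mul1r in h2 h4; rewrite ler_norml; apply/andP; split; lra.
Qed.

Lemma in_cube_rcons w d t : in_cube (rcons w d) t -> in_cube w t.
Proof.
move=> H c; have /andP[h1 h2] := H c.
have h0 : 0 < 2^-1 ^+ size w :> R by rewrite exprn_gt0.
move: h1 h2; rewrite num_rcons size_rcons exprS natrD -muln2 natrM.
move: (2^-1 ^+ _) h0 => p p0; case: (d _) => /= h1 h2; apply/andP; split; nra.
Qed.

End Cubes.

(** A cover of the limit slice at one time becomes a cover over a whole cube. Otherwise there are
    uncovered points of [C J] over ever smaller cubes; they accumulate at a point that lies in all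
    the closed sets, hence in some open [O m], which then contains late points of the sequence. *)
Lemma compact_slices (R : realType) (k n : nat) (C : nat -> set 'rV[R]_(k + n))
    (x : nat -> digit 1 k) (r : R) (O : nat -> set 'rV[R]_n) :
  (forall j, closed (C j)) -> (forall j, C j.+1 `<=` C j) ->
  (forall m, open (O m)) -> (forall m, O m `<=` O m.+1) ->
  (forall y, (forall j, C j (row_mx (bin_val R x) y)) -> exists m, O m y) ->
  exists J, forall t y, in_cube (mkseq x J) t -> C J (row_mx t y) ->
    (forall c, `|y ord0 c| <= r) -> O J y.
Proof.
move=> cC Cdec oO Oinc HO; apply: contrapT => /forallNP H.
have /choice[f Hf] : forall J, exists p : 'rV[R]_k * 'rV[R]_n,
    [/\ in_cube (mkseq x J) p.1, C J (row_mx p.1 p.2),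
      forall c, `|p.2 ord0 c| <= r & ~ O J p.2].
  move=> J; have /existsNP[t /existsNP[y]] := H J.
  by move=> /not_implyP[h1 /not_implyP[h2 /not_implyP[h3 h4]]]; exists (t, y).
pose box := [set y : 'rV[R]_n | forall i, `[- r, r]%classic (y ord0 i)].
have cbox : compact box by apply: (@rV_compact R n (fun=> `[- r, r]%classic)) => i; exact: segment_compact.
pose ys J := (f J).2.
have Fbox : (ys @ \oo) box.
  exists 0%N => // J _ c; rewrite /= in_itv /= -ler_norml.
  by case: (Hf J).
have [y [_ clu]] := cbox _ _ Fbox.
have {}clu e J0 : 0 < e -> exists2 J, (J0 <= J)%N & ball y e (ys J).
  move=> e0; have FA : (ys @ \oo) [set ys J | J in [set J | (J0 <= J)%N]].
    by exists J0 => // J /= J0J; exists J.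
  have [_ [[J /= J0J <-] yJ]] := clu _ _ FA (nbhsx_ballx y e e0).
  by exists J.
have Cdec' i j : (i <= j)%N -> C j `<=` C i.
  elim: j => [|j IH]; first by rewrite leqn0 => /eqP ->.
  rewrite leq_eqVlt ltnS => /orP[/eqP -> //|/IH h z /Cdec]; exact: h.
have Oinc' i j : (i <= j)%N -> O i `<=` O j.
  elim: j => [|j IH]; first by rewrite leqn0 => /eqP ->.
  rewrite leq_eqVlt ltnS => /orP[/eqP -> //|/IH h z /h]; exact: Oinc.
have [m Om] : exists m, O m y.
  apply: HO => j; apply: cC => B /nbhs_ballP[e /= e0 eB].
  have h0 : 0 < 2^-1 :> R by rewrite invr_gt0.
  have h1 : 2^-1 < 1 :> R by rewrite invf_lt1 // ltr1n.
  have e2 : 0 < e / 2 by rewrite divr_gt0.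
  have [J1 J1e] := exists_expr_le h0 h1 e2.
  have [J] := clu e (maxn j J1) e0; rewrite geq_max => /andP[jJ J1J] [_ yJ].
  have [fc fC _ _] := Hf J.
  exists (row_mx (f J).1 (f J).2); split; first exact: Cdec' fC.
  apply: eB; split=> // i c.
  case: (split_ordP c) => [u ->|u ->]; rewrite ?row_mxEl ?row_mxEr.
    rewrite (ord1 i) -ball_normE /=.
    apply: le_lt_trans (in_cube_close u (in_cube_val _ x J) fc) _.
    rewrite size_mkseq; apply: (@le_lt_trans _ _ (2^-1 ^+ J1)).
      by rewrite ler_wiXn2l ?(ltW h0) ?(ltW h1).
    by apply: le_lt_trans J1e _; rewrite ltr_pdivrMr // ltr_pMr // ltr1n.
  exact: yJ.
have /nbhs_ballP[e /= e0 eO] : nbhs y (O m) by apply: open_nbhs_nbhs.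
have [J mJ yJ] := clu e m e0.
by case: (Hf J) => _ _ _; apply; apply: (Oinc' _ _ mJ); exact: eO.
Qed.

Lemma open_dball (R : realType) (a b : nat) (q : 'M[R]_(a, b) * nat) : open (dball q).
Proof.
rewrite openE => x qx.
have h0 : 0 < 2^-1 ^+ q.2 :> R by rewrite exprn_gt0.
have [[p _]|ne] := pselect (exists p : 'I_a * 'I_b, True); last first.
  apply/nbhs_ballP; exists 1 => //= y _ i j; by case: ne; exists (i, j).
pose g (p : 'I_a * 'I_b) := 2^-1 ^+ q.2 - `|q.1 p.1 p.2 - x p.1 p.2|.
have [p' _ Hp'] := @arg_minP _ _ _ p xpredT g isT.
have g0 : 0 < g p' by rewrite subr_gt0; exact: qx.
apply/nbhs_ballP; exists (g p') => //= y [_ xy] i j.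
have := xy i j; rewrite -ball_normE /= => h1.
have := Hp' (i, j) isT; rewrite /g /= in h1 * => h2.
have := ler_distD (x i j) (q.1 i j) (y i j); lra.
Qed.

Section MainLemma.
Variables (R : realType) (k n : nat) (rho sigma : R).
Hypotheses (k0 : (0 < k)%N) (rho2 : 2^-1 < rho) (rhosigma : rho < sigma) (sigma1 : sigma < 1).

Local Notation params := (nat -> digit (1 + k) n).
Local Notation times := (nat -> digit 1 k).
Local Notation h := (tree_content (F := digit (1 + k) n) rho).
Local Notation L := (tree_content (F := digit 1 k) ((2^-1 : R) ^+ k)).

Let rho0 : 0 < rho. Proof. by apply: lt_trans rho2; rewrite invr_gt0. Qed.
Let rho1 : rho < 1. Proof. exact: lt_trans sigma1. Qed.
Let sigma0 : 0 < sigma. Proof. exact: lt_trans rhosigma. Qed.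

Definition zero_digit a b : digit a b := [ffun=> false].

Lemma half_exp_gt0 : 0 < (2^-1 : R) ^+ k.
Proof. by rewrite exprn_gt0. Qed.

Lemma half_exp_lt1 : (2^-1 : R) ^+ k < 1.
Proof. by rewrite exprn_ilt1 // ?invf_lt1 ?ltr1n // -lt0n. Qed.

Lemma half_exp_card : (2^-1 : R) ^+ k * #|{: digit 1 k}|%:R = 1.
Proof. by rewrite card_digit mul1n natrX -exprMn mulVf ?expr1n. Qed.

Variables (Z : 'M[R]_(1 + k, n)) (A : set params) (B : set 'rV[R]_(k + n)).
Hypothesis sB : souslin B.

Let ev (x : params) (t : 'rV[R]_k) := affine_eval (Z + bin_val R x) t.

Hypothesis AB : forall x, A x -> forall t, B (row_mx t (ev x t)).
Hypothesis hA : 0 < h A.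

Let Mb : R := \sum_i \sum_j `|Z i j| + 1.

Let Mb0 : 0 <= Mb.
Proof. by rewrite addr_ge0 // sumr_ge0 // => i _; rewrite sumr_ge0. Qed.

Let prm_le (x : params) i j : `|(Z + bin_val R x) i j| <= Mb.
Proof.
rewrite mxE; apply: le_trans (ler_normD _ _) _; apply: lerD.
  rewrite (bigD1 i) //= (bigD1 j) //= -addrA lerDl addr_ge0 // sumr_ge0 // => i' _.
  by rewrite sumr_ge0.
by have /andP[h1 h2] := bin_val01 R x i j; rewrite ger0_norm.
Qed.

Let ev_lip (x : params) (t t' : 'rV[R]_k) c (d : R) : (forall i, `|t ord0 i - t' ord0 i| <= d) ->
  `|ev x t ord0 c - ev x t' ord0 c| <= k%:R * (d * Mb).
Proof.
by move=> td; apply: affine_eval_lip td => i j; exact: prm_le.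
Qed.

Let rad : R := (k.+1)%:R * Mb.

Let ev_le (x : params) (t : times) c : `|ev x (bin_val R t) ord0 c| <= rad.
Proof.
apply: le_trans (affine_eval_le (e := 1) c (prm_le x) Mb0 _) _.
  by move=> i; have /andP[h1 h2] := bin_val01 R t ord0 i; rewrite ger0_norm.
by rewrite mulr1 addrC natr1.
Qed.

Let hit (X : set 'rV[R]_(k + n)) (x : params) : set times :=
  [set t | X (row_mx (bin_val R t) (ev x (bin_val R t)))].

(* [3 / 4] is used so that two subsets of the cube of measure more than [3 / 4]
   meet in a set of measure at least [1 / 2]. *)
Let fam (X : set 'rV[R]_(k + n)) : set params := [set x | A x /\ 3 / 4 < L (hit X x)].

(** A strict lower bound on a content passes from an increasing union to one of its members. *)
Let big X := h A / 2 < h (fam X).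

Let Linc (Aj : nat -> set times) (b : R) : (forall j, Aj j `<=` Aj j.+1) ->
  b < L (\bigcup_j Aj j) -> exists j, b < L (Aj j).
Proof.
move=> inc lt; apply: contrapT => /forallNP H; move: lt; rewrite ltNge => /negP; apply.
apply: (increasing_content (zero_digit 1 k) half_exp_gt0 half_exp_lt1 inc) => j.
by rewrite leNgt; apply/negP.
Qed.

Let big_mono X Y : X `<=` Y -> big X -> big Y.
Proof.
move=> XY; rewrite /big => /lt_le_trans; apply.
apply: (tree_content_mono (zero_digit _ _) rho0 rho1) => x [Ax lt]; split=> //; apply: lt_le_trans lt _.
by apply: (tree_content_mono (zero_digit _ _) half_exp_gt0 half_exp_lt1) => t; exact: XY.
Qed.

(** Upward continuity is used twice: for [L], to find for each parameter a stage at which 3/4 is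
    exceeded, then for [h] along the resulting families. *)
Let big_cup (X : nat -> set 'rV[R]_(k + n)) : (forall m, X m `<=` X m.+1) ->
  big (\bigcup_m X m) -> exists m, big (X m).
Proof.
move=> inc bigX; apply: contrapT => /forallNP H; move: bigX.
rewrite /big ltNge => /negP; apply.
apply: (@le_trans _ _ (h (\bigcup_m fam (X m)))).
  apply: (tree_content_mono (zero_digit _ _) rho0 rho1) => x [Ax lt].
  have [||m lt'] := @Linc (fun m => hit (X m) x) (3 / 4); [by move=> m t; exact: inc| |by exists m].
  apply: lt_le_trans lt _.
  apply: (tree_content_mono (zero_digit _ _) half_exp_gt0 half_exp_lt1) => t [m _ Xm].
  by exists m.
apply: (increasing_content (zero_digit _ _) rho0 rho1) => m; last first.
  by rewrite leNgt; apply/negP; exact: H.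
move=> x [Ax lt]; split=> //; apply: lt_le_trans lt _.
by apply: (tree_content_mono (zero_digit _ _) half_exp_gt0 half_exp_lt1) => t; exact: inc.
Qed.

Let bigB : big B.
Proof.
have e : fam B = A.
  apply/seteqP; split=> x; first by case.
  move=> Ax; split=> //.
  have -> : hit B x = setT by apply/seteqP; split=> // t _; exact: AB.
  rewrite (tree_content_setT (zero_digit _ _) half_exp_lt1 half_exp_card); lra.
by rewrite /big e ltr_pdivrMr // ltr_pMr // ltr1n.
Qed.

Section Contradiction.
Hypothesis null : L [set t | ~ dyadic_null sigma (slice B (bin_val R t))] = 0.

Variables (l0 : nat) (eps : R) (C : nat -> set 'rV[R]_(k + n)).
Hypotheses (eps0 : 0 < eps) (cC : forall j, closed (C j)) (Cdec : forall j, C j.+1 `<=` C j)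
  (CB : \bigcap_j C j `<=` B) (bigC : forall j, big (C j)).

(** Levels at most [j] make each ball at least as large as the side of the cube, so moving to the
    corner costs a multiple of the radius; levels at least [l0] leave only the tail of the energy
    series. *)
Let good j (w : seq (digit 1 k)) := exists U : seq ('rV[R]_n * nat),
  [/\ forall u, u \in U -> (l0 <= u.2 <= j)%N, \sum_(u <- U) sigma ^+ u.2 <= eps &
   forall t y, in_cube w t -> C j (row_mx t y) -> (forall c, `|y ord0 c| <= rad) ->
     exists2 u, u \in U & dball u y].

Let good_inc j (t : times) : good j (mkseq t j) -> good j.+1 (mkseq t j.+1).
Proof.
move=> [U [Ul Ue HU]]; exists U; split=> //.
  by move=> u /Ul /andP[-> h2] /=; exact: leqW.
move=> s y; rewrite mkseqS => /in_cube_rcons sc /Cdec; exact: HU.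
Qed.

Let null_good (t : times) : dyadic_null sigma (slice B (bin_val R t)) ->
  exists j, good j (mkseq t j).
Proof.
(* The bound [sigma ^+ l0] on the whole cost forces every ball of the cover to have level at least
   [l0]. *)
move=> nt; pose e := Num.min eps (sigma ^+ l0).
have e0 : 0 < e by rewrite lt_min eps0 exprn_gt0.
have [u [uB ue]] := nt _ e0; rewrite add0r in ue.
have term i : sigma ^+ (u i).2 <= e.
  apply: le_trans (ue i.+1); rewrite big_ord_recr /= lerDr sumr_ge0 // => j _.
  by rewrite /dcost exprn_ge0 // ltW.
have ul i : (l0 <= (u i).2)%N.
  rewrite leqNgt; apply/negP => lt.
  have : sigma ^+ l0 < sigma ^+ (u i).2 by rewrite ltr_iXn2l.
  by rewrite ltNge (le_trans (term i)) // ge_min lexx orbT.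
(* Finitely many balls at a time, of level at most [m]: the single index given by compactness then
   serves for the closed set, the cube and the cover. *)
pose O m := \bigcup_(i in [set i | (i < m)%N /\ ((u i).2 <= m)%N]) dball (u i).
have [|m y [i [im um] iy]|y Hy|J HJ] := @compact_slices R k n C t rad O cC Cdec.
- by move=> m; apply: bigcup_open => i _; exact: open_dball.
- by exists i => //; split; exact: leqW.
- have [i _ iy] := uB y (CB (fun j _ => Hy j)).
  exists (maxn i.+1 (u i).2), i => //; split; first by rewrite leq_max ltnSn.
  by rewrite leq_max leqnn orbT.
exists J, [seq u i | i <- iota 0 J & ((u i).2 <= J)%N]; split.
- by move=> q /mapP[i]; rewrite mem_filter => /andP[h1 _] ->; rewrite ul.
- apply: (@le_trans _ _ e); last by rewrite ge_min lexx.
  apply: le_trans (ue J); rewrite big_map big_filter -(big_mkord xpredT (fun i => dcost sigma (u i))).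
  rewrite /index_iota subn0 big_mkcond; apply: ler_sum => i _.
  by case: ifP => // _; rewrite /dcost exprn_ge0 // ltW.
- move=> s y sJ Cy yr; have [i [iJ uJ] iy] := HJ s y sJ Cy yr.
  by exists (u i) => //; apply: map_f; rewrite mem_filter uJ mem_iota.
Qed.

Let exists_good : exists j, 3 / 4 < L [set t | good j (mkseq t j)].
Proof.
apply: (@Linc (fun j => [set t | good j (mkseq t j)]) (3 / 4)); first by move=> j t; exact: good_inc.
apply: (@lt_le_trans _ _ (L setT)).
  rewrite (tree_content_setT (zero_digit 1 k) half_exp_lt1 half_exp_card); lra.
apply: (@le_trans _ _ (L (\bigcup_j [set t | good j (mkseq t j)] `|`
    [set t | ~ dyadic_null sigma (slice B (bin_val R t))]))).
  apply: (tree_content_mono (zero_digit _ _) half_exp_gt0 half_exp_lt1) => t _.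
  have [/null_good[j gj]|nt] := pselect (dyadic_null sigma (slice B (bin_val R t))); last by right.
  by left; exists j.
apply: le_trans (tree_content_setU (zero_digit _ _) half_exp_gt0 half_exp_lt1 _ _) _.
by rewrite null addr0.
Qed.

(** The 2 comes from two graphs meeting one ball, and [2 * (k%:R * Mb)] from moving each of them
    from its own time to the corner. *)
Let Cst : R := 2 + 2 * (k%:R * Mb).

Lemma core_inequality : exists N, h A / 4 <
  eps + shell_const k n rho Cst * (\sum_(l0 <= l < N.+1) (rho / sigma) ^+ l).
Proof.
have [N gN] := exists_good; exists N.
have [mu [mumem mum muh]] := finite_frostman (zero_digit (1 + k) n) rho0 rho1 (fam (C N)) N [::].
have adm : admissible rho mu N.
  split; first by move=> q /mumem[].
  by move=> u uN; apply: mum => //; rewrite prefix0s.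
have tot1 : total mu <= 1.
  have := mum [::] isT isT; rewrite expr0 /mass /total; apply: le_trans.
  by rewrite le_eqVlt; apply/orP; left; apply/eqP; apply: eq_bigl.
have toth : h A / 2 < total mu.
  apply: lt_le_trans (bigC N) (le_trans _ muh).
  by apply: (tree_content_mono (zero_digit _ _) rho0 rho1).
pose G : pred (N.-tuple (digit 1 k)) := [pred w | `[< good N (tval w) >]].
pose T (x : params) : pred (N.-tuple (digit 1 k)) :=
  [pred w | `[< exists2 t, hit (C N) x t & mkseq t N = tval w >]].
pose Wn : R := (2 ^ (k * N))%:R.
have Wh : 2^-1 ^+ k ^+ N * Wn = 1 by rewrite /Wn natrX exprM -exprMn -exprMn mulVf ?expr1n.
have Wn0 : 0 < Wn by rewrite ltr0n expn_gt0.
have cnt (X : set times) (P : pred (N.-tuple (digit 1 k))) : 3 / 4 < L X ->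
    (forall t, X t -> P [tuple of mkseq t N]) -> 3 / 4 * Wn <= #|P|%:R.
  move=> LX XP.
  have := content_le_count (zero_digit 1 k) half_exp_lt1 half_exp_card X N.
  move=> /(lt_le_trans LX) /ltW.
  rewrite -(ler_pM2r Wn0) -[leRHS]mulrA Wh mulr1 => /le_trans; apply.
  rewrite ler_nat; apply: subset_leq_card; apply/fintype.subsetP => w; rewrite unfold_in /= => /asboolP[t Xt tw].
  by have := XP t Xt; congr (is_true (P _)); apply: val_inj.
have GT q : q \in mu -> Wn / 2 <= #|[pred w | G w && T q.1 w]|%:R.
  move=> /mumem[[_ Lq] _ _].
  have cG : 3 / 4 * Wn <= #|G|%:R.
    by apply: cnt gN _ => t gt; apply/asboolP.
  have cT : 3 / 4 * Wn <= #|T q.1|%:R.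
    by apply: cnt Lq _ => t gt; apply/asboolP; exists t.
  have := cardUI G (T q.1) => /(congr1 (fun m => m%:R : R)); rewrite !natrD => e.
  have : #|predU G (T q.1)|%:R <= Wn.
    by rewrite ler_nat; apply: leq_trans (max_card _) _; rewrite card_tuple card_digit mul1n -expnM.
  have -> : #|[pred w | G w && T q.1 w]| = #|predI G (T q.1)| by apply: eq_card.
  lra.
have HG w : G w -> exists (U : seq ('rV[R]_n * nat)) (f : params -> 'rV[R]_n * nat),
    [/\ forall u, u \in U -> (l0 <= u.2 <= N)%N, \sum_(u <- U) sigma ^+ u.2 <= eps,
        forall q, q \in mu -> T q.1 w -> f q.1 \in U &
        forall q q', q \in mu -> q' \in mu -> T q.1 w -> T q'.1 w -> f q'.1 = f q.1 ->
          near_cond Cst (f q.1).2 w q.1 q'.1].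
  move=> /asboolP[U [Ul Ue HU]].
  have /choice[f Hf] : forall x : params, exists u, T x w ->
      u \in U /\ exists2 t, in_cube w t & dball u (ev x t).
    move=> x; have [Tx|nT] := boolP (T x w); last by exists (0, 0%N).
    have /asboolP[t ht tw] := Tx.
    have tc : in_cube w (bin_val R t) by rewrite -tw; exact: in_cube_val.
    have [u uU ud] := HU _ _ tc ht (ev_le x t).
    by exists u => _; split=> //; exists (bin_val R t).
  exists U, f; split=> //; first by move=> q _ /Hf[].
  move=> q q' qmu q'mu /Hf[fU [t tc td]] /Hf[_ [t' tc' td']] ff.
  apply/forallP => c.
  have e0 : bin_val R q.1 - bin_val R q'.1 = (Z + bin_val R q.1) - (Z + bin_val R q'.1).
    by rewrite opprD addrACA subrr add0r.
  have lN : ((f q.1).2 <= N)%N by case/andP: (Ul _ fU).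
  have swN : size w = N by rewrite size_tuple.
  have h1 := ev_lip q.1 c (fun i => in_cube_close i (in_cube_corner R w) tc).
  have h2 := ev_lip q'.1 c (fun i => in_cube_close i (in_cube_corner R w) tc').
  have := td ord0 c; have := td' ord0 c; rewrite ff => h3 h4.
  rewrite e0 affine_evalB mxBE -/(ev _ _) -/(ev _ _).
  have lN' : 2^-1 ^+ size w <= 2^-1 ^+ (f q.1).2 :> R.
    by rewrite swN ler_wiXn2l // invf_le1 // ler1n.
  have h5 : k%:R * (2^-1 ^+ size w * Mb) <= 2^-1 ^+ (f q.1).2 * (k%:R * Mb).
    by rewrite mulrCA ler_wpM2r // mulr_ge0.
  rewrite /Cst; move: h1 h2 h3 h4 h5; move: (2^-1 ^+ (f q.1).2) (_ * (_ * Mb)) => p z.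
  move: (ev q.1 _ _ _) (ev q.1 _ _ _) (ev q'.1 _ _ _) (ev q'.1 _ _ _) ((f q.1).1 _ _) => a1 a2 a3 a4 a5.
  rewrite !ler_norml !ltr_norml.
  move=> /andP[? ?] /andP[? ?] /andP[? ?] /andP[? ?] h5.
  apply/andP; split; lra.
have Cst0 : 0 <= Cst by rewrite addr_ge0 // !mulr_ge0.
have := finite_core rho0 rho1 rho2 adm Cst0 sigma0 (ltW eps0) GT HG.
set S := shell_const _ _ _ _ * _ => hS.
have S0 : 0 <= S.
  have r21 : 1 < 2 * rho by rewrite -ltr_pdivrMl // mulr1.
  rewrite /S /shell_const !mulr_ge0 ?invr_ge0 ?(ltW rho0) ?subr_ge0 ?(ltW r21) //.
    by rewrite addr_ge0 // !mulr_ge0.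
  by apply: sumr_ge0 => l _; rewrite exprn_ge0 // divr_ge0 // ltW.
have : S * total mu <= S by rewrite ler_piMr.
lra.
Qed.

End Contradiction.

(** The constant [K] depends on none of [l0], [eps] and [N], and the ratio [rho / sigma] is below 1.
    So [l0] can make the energy term at most [h A / 8]; with [eps = h A / 8] this contradicts
    [core_inequality]. *)
Lemma slices_not_null : L [set t | ~ dyadic_null sigma (slice B (bin_val R t))] <> 0.
Proof.
move=> null.
have [C [cC Cdec CB bigC]] := choquet big_mono big_cup sB bigB.
pose K := shell_const k n rho (2 + 2 * (k%:R * Mb)).
pose y := rho / sigma.
have y0 : 0 < y by rewrite divr_gt0.
have y1 : y < 1 by rewrite ltr_pdivrMr // mul1r.
have r21 : 1 < 2 * rho by rewrite -ltr_pdivrMl // mulr1.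
have K0 : 0 <= K.
  rewrite /K /shell_const !mulr_ge0 ?invr_ge0 ?(ltW rho0) ?subr_ge0 ?(ltW r21) //.
  by rewrite addr_ge0 // !mulr_ge0 // addr_ge0 // !mulr_ge0.
have e0 : 0 < h A / 8 / (K + 1) * (1 - y) by rewrite mulr_gt0 ?subr_gt0 // !divr_gt0 // ltr_wpDl.
have [l0 l0e] := exists_expr_le y0 y1 e0.
have eps0 : 0 < h A / 8 by rewrite divr_gt0.
have [N] := core_inequality null l0 eps0 cC Cdec CB bigC.
rewrite -/K -/y; set S := \sum_(_ <= _ < _) _.
have : S * (1 - y) <= y ^+ l0.
  rewrite /S; case: (leqP l0 N.+1) => lN; last by rewrite big_geq ?(ltnW lN) // mul0r exprn_ge0 // ltW.
  rewrite mulrBr mulr1 mulr_suml.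
  have -> : \sum_(l0 <= i < N.+1) y ^+ i * y = \sum_(l0 <= i < N.+1) y ^+ i.+1.
    by apply: eq_bigr => i _; rewrite exprSr.
  rewrite -opprB -sumrB telescope_sumr // opprB lerBlDr lerDl exprn_ge0 // ltW //.
move=> h1.
have : S <= h A / 8 / (K + 1).
  by rewrite -(ler_pM2r (_ : 0 < 1 - y)) ?subr_gt0 // (le_trans h1).
have K1 : 0 < K + 1 by rewrite ltr_wpDl.
rewrite ler_pdivlMr // => h2 h3.
have S0 : 0 <= S by apply: sumr_ge0 => l _; rewrite exprn_ge0 // ltW.
have : K * S <= S * (K + 1) by rewrite mulrDr mulr1 [K * S]mulrC lerDl.
lra.
Qed.

End MainLemma.

(** * Hausdorff null sets and dyadic covers *)

Section HalfPower.
Variable R : realType.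
Implicit Types s r : R.

Lemma half_gt0 : 0 < 2^-1 :> R. Proof. by rewrite invr_gt0. Qed.

Lemma half_lt1 : 2^-1 < 1 :> R. Proof. by rewrite invf_lt1 // ltr1n. Qed.

Definition half_pow s : R := 2^-1 `^ s.

Lemma half_pow_gt0 s : 0 < half_pow s.
Proof. by rewrite powR_gt0 // half_gt0. Qed.

Lemma half_powD s s' : half_pow (s + s') = half_pow s * half_pow s'.
Proof. by rewrite /half_pow powRD // invr_eq0 pnatr_eq0 implybT. Qed.

Lemma half_pow_nat k : half_pow k%:R = 2^-1 ^+ k.
Proof. by rewrite /half_pow powR_mulrn // ltW // half_gt0. Qed.

Lemma half_pow_lt1 s : 0 < s -> half_pow s < 1.
Proof.
move=> s0; have : 2^-1 `^ s < 1 `^ s :> R; last by rewrite powR1.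
by apply: gt0_ltr_powR; rewrite ?nnegrE ?half_lt1 // ltW // half_gt0.
Qed.

Lemma half_pow_lt s s' : s < s' -> half_pow s' < half_pow s.
Proof.
move=> ss; rewrite -(subrK s s') half_powD -[ltRHS]mul1r ltr_pM2r ?half_pow_gt0 //.
by rewrite half_pow_lt1 // subr_gt0.
Qed.

Lemma half_pow_exp s l : (2^-1 ^+ l) `^ s = half_pow s ^+ l.
Proof.
elim: l => [|l IH]; first by rewrite !expr0 powR1.
by rewrite !exprS powRM ?IH ?exprn_ge0 ?ltW ?half_gt0.
Qed.

(** Rounding a radius up to a power of 1/2 loses a factor [2^s] in the cost; [e] pays for [r = 0],
    where every level is allowed. *)
Lemma exists_level s r (e : R) : 0 < s -> 0 <= r -> r < 1 -> 0 < e ->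
  exists l, r < 2^-1 ^+ l /\ half_pow s ^+ l <= (half_pow s)^-1 * r `^ s + e.
Proof.
move=> s0 r0 r1 e0; have hs := half_pow_gt0 s.
have p0 : 0 <= (half_pow s)^-1 * r `^ s by rewrite mulr_ge0 ?powR_ge0 // invr_ge0 ltW.
move: r0; rewrite le_eqVlt => /orP[/eqP <-|r0].
  have [l le] := exists_expr_le hs (half_pow_lt1 s0) e0.
  exists l; rewrite exprn_gt0 ?half_gt0 //; split=> //; apply: le_trans le _.
  by rewrite lerDr mulr_ge0 ?powR_ge0 // invr_ge0 ltW.
have ex : exists n, 2^-1 ^+ n <= r by exact: (exists_expr_le half_gt0 half_lt1 r0).
case: (ex_minnP ex) => -[|l]; first by rewrite expr0 leNgt r1.
move=> lr lmin; exists l; split.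
  by rewrite ltNge; apply/negP => /lmin; rewrite ltnn.
have h : half_pow s ^+ l.+1 <= r `^ s.
  rewrite -half_pow_exp; apply: ge0_ler_powR; rewrite ?nnegrE //; exact: ltW.
apply: (@le_trans _ _ ((half_pow s)^-1 * r `^ s)); last by rewrite lerDl ltW.
by rewrite -(ler_pM2l hs) -exprS mulrA mulfV ?gt_eqF // mul1r.
Qed.

Lemma powR_le_exponent s s' r : 0 <= r -> r <= 1 -> s <= s' -> 0 < s' -> r `^ s' <= r `^ s.
Proof.
rewrite le_eqVlt => /orP[/eqP <- _ _ s0|r0 r1 ss _].
  by rewrite powR0 ?gt_eqF // powR_ge0.
by apply: ger_powR => //; rewrite r0.
Qed.

Lemma dcost_ge0 a b s (q : 'M[R]_(a, b) * nat) : 0 <= dcost (half_pow s) q.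
Proof. by rewrite /dcost exprn_ge0 // ltW // half_pow_gt0. Qed.

Lemma dcost_small a b s (e : R) : 0 < s -> 0 < e ->
  exists q : 'M[R]_(a, b) * nat, dcost (half_pow s) q <= e.
Proof.
move=> s0 e0; have [l le] := exists_expr_le (half_pow_gt0 s) (half_pow_lt1 s0) e0.
by exists (0, l).
Qed.

End HalfPower.

Section Transfer.
Variables (R : realType) (T : Type) (d : T -> T -> R) (a b : nat) (f : T -> 'M[R]_(a, b)).
Variables (c : R).
Hypothesis c0 : 0 < c.

Lemma hausdorff_null_dyadic (A : set T) (s s' : R) :
  0 <= s -> s <= s' -> 0 < s' -> (forall x y, 0 <= d x y) ->
  (forall x y, A x -> A y -> forall i j, `|f x i j - f y i j| <= c * d x y) ->
  hausdorff_measure d s A = 0%E -> dyadic_null (half_pow s') (f @` A).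
Proof.
move=> s0 ss s'0 d0 fd H0 e e0; rewrite add0r.
(* Diameters at most 1 allow the exponent to grow from [s] to [s'], and images of size at most 1/2
   allow [exists_level]. *)
pose delta : R := Num.min 1 (2^-1 / c).
have delta0 : 0 < delta by rewrite lt_min ltr01 divr_gt0 // half_gt0.
pose M : R := (half_pow s')^-1 * c `^ s'.
have M0 : 0 < M by rewrite mulr_gt0 ?invr_gt0 ?half_pow_gt0 // powR_gt0.
pose e' := e / 2 / M.
have e'0 : 0 < e' by rewrite !divr_gt0.
have : (hausdorff_premeasure d s delta A < e'%:E)%E.
  apply: (@le_lt_trans _ _ 0%E); last by rewrite lte_fin.
  by rewrite -H0; apply: ereal_sup_ubound; exists delta.
move=> /ereal_inf_lt[_ [U [AU dU ->]] Ue].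
have dp0 i : (0 <= diam_pow d s (U i))%E.
  by rewrite /diam_pow; case: ifP => // _; exact: poweR_ge0.
(* A member of the cover meeting [A] supplies the centre of its ball; the others receive an
   arbitrary ball of tiny cost. *)
pose ne i := `[< exists x, U i x /\ A x >].
pose r i : R := fine (diameter d (U i)).
have rP i : ne i -> [/\ 0 <= r i, r i <= delta, diam_pow d s (U i) = ((r i) `^ s)%:E &
    forall x y, U i x -> U i y -> d x y <= r i].
  move=> /asboolP[x [Ux Ax]].
  have h1 : ((d x x)%:E <= diameter d (U i))%E by apply: ereal_sup_ubound; exists x, x.
  have fin : diameter d (U i) \is a fin_num.
    rewrite fin_numE; apply/andP; split; apply/eqP => h.
      by move: h1; rewrite h leeNy_eq.
    by have := dU i; rewrite h leye_eq.
  have rE : diameter d (U i) = (r i)%:E by rewrite fineK.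
  split.
  - by rewrite -lee_fin -rE (le_trans _ h1) // lee_fin.
  - by rewrite -lee_fin -rE.
  - rewrite /diam_pow; case: ifP => [/eqP U0|_]; last by rewrite rE.
    by move: Ux; rewrite U0.
  - by move=> y z Uy Uz; rewrite -lee_fin -rE; apply: ereal_sup_ubound; exists y, z.
pose p i : R := if ne i then (r i) `^ s else 0.
have psum n : \sum_(i < n) p i <= e'.
  rewrite -lee_fin -sumEFin; apply: le_trans (ltW Ue).
  apply: le_trans (nneseries_lim_ge (P := xpredT) n (fun i _ _ => dp0 i)).
  rewrite big_mkord; apply: lee_sum => i _; rewrite /p; case: ifPn => // nei.
  by have [_ _ -> _] := rP i nei.
have /choice[q Hq] : forall i, exists q : 'M[R]_(a, b) * nat,
    (ne i -> f @` (A `&` U i) `<=` dball q) /\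
    dcost (half_pow s') q <= M * p i + e / 2 * 2^-1 ^+ i.+1.
  move=> i; have eta0 : 0 < e / 2 * 2^-1 ^+ i.+1 by rewrite mulr_gt0 ?divr_gt0 ?exprn_gt0 ?half_gt0.
  rewrite /p; case: (boolP (ne i)) => nei; last first.
    have [q qe] := dcost_small a b s'0 eta0; exists q; split=> //.
    by rewrite mulr0 add0r.
  have [r0 rd _ rU] := rP i nei; have /asboolP[x [Ux Ax]] := nei.
  have cr0 : 0 <= c * r i by rewrite mulr_ge0 // ltW.
  have cr1 : c * r i < 1.
    apply: (@le_lt_trans _ _ 2^-1); last exact: half_lt1.
    by rewrite mulrC -ler_pdivlMr // (le_trans rd) // ge_min lexx orbT.
  have [l [lr ls]] := exists_level s'0 cr0 cr1 eta0.
  exists (f x, l); split.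
    move=> _ _ [y [Ay Uy] <-] i' j' /=; apply: le_lt_trans lr.
    apply: le_trans (fd _ _ Ax Ay i' j') _; rewrite ler_pM2l //; exact: rU.
  apply: le_trans ls _; rewrite lerD2r powRM ?(ltW c0) // mulrA ler_pM2l //.
  by apply: powR_le_exponent => //; apply: le_trans rd _; rewrite ge_min lexx.
exists q; split.
  move=> _ [x Ax <-]; have [i _ Ux] := AU x Ax; exists i => //.
  by apply: (Hq i).1; [apply/asboolP; exists x | exists x].
move=> n; apply: (@le_trans _ _ (\sum_(i < n) (M * p i + e / 2 * 2^-1 ^+ i.+1))).
  by apply: ler_sum => i _; case: (Hq i).
rewrite big_split /= -mulr_sumr [leRHS](splitr e); apply: lerD.
  by rewrite mulrC -ler_pdivlMr //; exact: psum.
by apply: sum_geo_half; rewrite divr_ge0 // ltW.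
Qed.

Lemma dyadic_null_hausdorff (A : set T) (s : R) : 0 < s -> (forall x y, 0 <= d x y) ->
  (forall x y (e : R), (forall i j, `|f x i j - f y i j| < e) -> d x y <= c * e) ->
  dyadic_null (half_pow s) (f @` A) -> hausdorff_measure d s A = 0%E.
Proof.
move=> s0 d0 fd HA; apply/eqP; rewrite eq_le; apply/andP; split; last first.
  apply: le_trans (_ : hausdorff_premeasure d s 1 A <= _)%E; last first.
    by apply: ereal_sup_ubound; exists 1 => //=; exact: ltr01.
  apply: le_ereal_inf_tmp => _ [U [_ _ ->]].
  apply: nneseries_ge0 => i _ _; rewrite /diam_pow; case: ifP => // _; exact: poweR_ge0.
apply: ge_ereal_sup => _ [delta /= delta0 <-].
apply/lee_addgt0Pr => eps eps0; rewrite add0e.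
have c20 : 0 < c * 2 by rewrite mulr_gt0.
have [l1 Hl1] : exists l1, 2^-1 ^+ l1 <= delta / (c * 2).
  by apply: exists_expr_le; rewrite ?half_gt0 ?half_lt1 // divr_gt0.
have M0 : 0 < (c * 2) `^ s by rewrite powR_gt0.
(* The second bound forces all levels to be at least [l1], so that the preimages have diameter at
   most [delta]. *)
pose e := Num.min (eps / (c * 2) `^ s) (half_pow s ^+ l1).
have e0 : 0 < e by rewrite lt_min divr_gt0 // exprn_gt0 // half_pow_gt0.
have [u [uA ue]] := HA e e0; rewrite add0r in ue.
pose U i := [set x | A x /\ dball (u i) (f x)].
have Ud i x y : U i x -> U i y -> d x y <= c * 2 * 2^-1 ^+ (u i).2.
  move=> [_ Ux] [_ Uy]; rewrite -mulrA; apply: fd => i' j'.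
  have := Ux i' j'; have := Uy i' j'; rewrite !ltr_norml => /andP[? ?] /andP[? ?].
  apply/andP; split; lra.
have diamU i : (diameter d (U i) <= (c * 2 * 2^-1 ^+ (u i).2)%:E)%E.
  by apply: ge_ereal_sup => _ [x [y [Ux Uy ->]]]; rewrite lee_fin; exact: Ud.
have term i : half_pow s ^+ (u i).2 <= e.
  apply: le_trans (ue i.+1); rewrite big_ord_recr /= lerDr sumr_ge0 // => j _.
  exact: dcost_ge0.
have ul i : (l1 <= (u i).2)%N.
  rewrite leqNgt; apply/negP => lt.
  have : half_pow s ^+ l1 < half_pow s ^+ (u i).2 by rewrite ltr_iXn2l ?half_pow_gt0 ?half_pow_lt1.
  by rewrite ltNge (le_trans (term i)) // ge_min lexx orbT.
apply: (@le_trans _ _ (\sum_(0 <= i <oo) diam_pow d s (U i))%E).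
  apply: ereal_inf_lbound; exists U; split=> // [x Ax|i].
    by have [i _ ix] := uA (f x) (ex_intro2 _ _ x Ax erefl); exists i.
  apply: le_trans (diamU i) _; rewrite lee_fin mulrC -ler_pdivlMr //.
  by apply: le_trans Hl1; rewrite ler_wiXn2l // ltW // ?half_gt0 ?half_lt1.
have dp0 i : (0 <= diam_pow d s (U i))%E.
  by rewrite /diam_pow; case: ifP => // _; exact: poweR_ge0.
have dple i : (diam_pow d s (U i) <= ((c * 2) `^ s * half_pow s ^+ (u i).2)%:E)%E.
  rewrite /diam_pow; case: ifPn => [_|/set0P[x Ux]].
    by rewrite lee_fin mulr_ge0 ?powR_ge0 // exprn_ge0 // ltW // half_pow_gt0.
  have h1 : ((d x x)%:E <= diameter d (U i))%E by apply: ereal_sup_ubound; exists x, x.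
  have dg0 : (0 <= diameter d (U i))%E by apply: le_trans h1; rewrite lee_fin.
  apply: (@le_trans _ _ ((c * 2 * 2^-1 ^+ (u i).2)%:E `^ s)%E); last first.
    rewrite poweR_EFin lee_fin powRM; [|exact: ltW|by rewrite exprn_ge0 // ltW // half_gt0].
    by rewrite half_pow_exp.
  have r0 : 0 <= c * 2 * 2^-1 ^+ (u i).2 by rewrite mulr_ge0 ?ltW // exprn_gt0 // half_gt0.
  apply: gt0_ler_poweR; rewrite ?(ltW s0) //; rewrite in_itv /= ?leey ?andbT //.
apply: lime_le; first by apply: is_cvg_nneseries => i _ _.
apply: nearW => n; rewrite big_mkord.
apply: le_trans (lee_sum _ (fun (i : 'I_n) _ => dple i)) _.
rewrite sumEFin lee_fin -mulr_sumr mulrC -ler_pdivlMr //.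
by apply: le_trans (ue n) _; rewrite ge_min lexx.
Qed.

End Transfer.

Section NullSets.
Variables (R : realType) (a b : nat).
Implicit Types (A : set 'M[R]_(a, b)) (s : R).

Lemma dyadic_null_sub s A A' : A' `<=` A -> dyadic_null s A -> dyadic_null s A'.
Proof. by move=> AA H; apply: content_le_le AA H. Qed.

Lemma dyadic_null_bigcup s (I : countType) (A : I -> set 'M[R]_(a, b)) : 0 < s ->
  (forall i, dyadic_null (half_pow s) (A i)) -> dyadic_null (half_pow s) (\bigcup_i A i).
Proof.
move=> s0 HA.
apply: (@content_le_le _ _ _ _ _ 0 0 (\bigcup_n (if unpickle n is Some i then A i else set0)));
  [exact: lexx | | ].
  by move=> x [i _ Ax]; exists (pickle i) => //; rewrite pickleK.
apply: (content_le_bigcup (@dcost_ge0 R a b s) (e := fun=> 0)); last by move=> n; rewrite big1.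
move=> n; case: (unpickle n) => [i|]; first exact: HA.
exact: (content_le_set0 _ (@dcost_ge0 R a b s) (fun e => @dcost_small R a b s e s0) (lexx 0)).
Qed.

Lemma dyadic_null_scale (c s : R) A : 0 < s ->
  content_le (fun q => [set x | mx_close (c * 2^-1 ^+ q.2) q.1 x]) (dcost (half_pow s)) 0 A ->
  dyadic_null (half_pow s) A.
Proof.
move=> s0 HA e e0; rewrite add0r; have hs := half_pow_gt0 s.
have [m cm] : exists m, c <= 2 ^+ m.
  have c1 : 0 < (`|c| + 1)^-1 by rewrite invr_gt0 ltr_wpDl.
  have [m Hm] := exists_expr_le (half_gt0 R) (half_lt1 R) c1.
  exists m; move: Hm; rewrite exprVn lef_pV2 ?posrE ?exprn_gt0 ?ltr_wpDl //.
  by apply: le_trans; apply: le_trans (ler_norm _) _; rewrite lerDl.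
have sm : 0 < half_pow s ^+ m by rewrite exprn_gt0.
(* The factor [c] is absorbed by lowering all levels by [m]; the second bound makes every level at
   least [m], so that the subtraction is exact. *)
pose e' := Num.min (e * half_pow s ^+ m) (half_pow s ^+ m).
have e'0 : 0 < e' by rewrite lt_min sm mulr_gt0.
have [u [uA ue]] := HA e' e'0; rewrite add0r in ue.
have term i : half_pow s ^+ (u i).2 <= e'.
  apply: le_trans (ue i.+1); rewrite big_ord_recr /= lerDr sumr_ge0 // => j _.
  exact: dcost_ge0.
have um i : (m <= (u i).2)%N.
  rewrite leqNgt; apply/negP => lt.
  have : half_pow s ^+ m < half_pow s ^+ (u i).2 by rewrite ltr_iXn2l ?half_pow_lt1.
  by rewrite ltNge (le_trans (term i)) // ge_min lexx orbT.
exists (fun i => ((u i).1, ((u i).2 - m)%N)); split.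
  move=> x /uA[i _ ix]; exists i => // j k /=; apply: lt_le_trans (ix j k) _.
  rewrite -{1}(subnKC (um i)) exprD mulrA ler_piMl ?exprn_ge0 //.
  by rewrite exprVn ler_pdivrMr ?exprn_gt0 // mul1r.
move=> n; rewrite /dcost /= -(ler_pM2r sm) mulr_suml.
apply: (@le_trans _ _ e'); last by rewrite ge_min lexx.
apply: le_trans (ue n); apply: ler_sum => i _.
by rewrite -exprD subnK // /dcost lexx.
Qed.

Lemma dyadic_null_tree (s : R) A (Z : 'M[R]_(a, b)) : 0 < s -> dyadic_null (half_pow s) A ->
  tree_content (half_pow s) [set x | A (Z + bin_val R x)] = 0.
Proof.
move=> s0 HA; have hs := half_pow_gt0 s; have hs1 := half_pow_lt1 s0.
apply/eqP; rewrite eq_le (tree_content_ge0 (zero_digit a b) hs hs1) andbT.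
apply: tree_content_le => //; apply: content_le_inf => e e0; rewrite add0r.
pose K : R := (3 ^ (a * b))%:R.
have K0 : 0 < K by rewrite ltr0n expn_gt0.
have [u [uA ue]] := HA (e / K) (divr_gt0 e0 K0); rewrite add0r in ue.
apply: (@content_le_le _ _ _ _ _ _ _
    (\bigcup_i [set x | mx_close (2^-1 ^+ (u i).2) ((u i).1 - Z) (bin_val R x)])); [exact: lexx| |].
  move=> x /uA[i _ ix]; exists i => // j k; have := ix j k.
  by rewrite mxDE mxBE opprD addrA.
apply: (content_le_bigcup (cylw_ge0 hs) (e := fun i => K * half_pow s ^+ (u i).2)).
  move=> i; set l := (u i).2; set y := _ - Z.
  apply: (@content_le_le _ _ _ _ _ (\sum_(w <- close_words y l) half_pow s ^+ l) _
     [set x | mx_close (2^-1 ^+ l) y (bin_val R x)]) => //.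
    rewrite big_const_seq count_predT iter_addr_0 -[leLHS]mulr_natl.
    by rewrite ler_wpM2r ?exprn_ge0 ?(ltW hs) // ler_nat size_close_words.
  apply: (content_le_bigsum (cylw_ge0 hs) (cylw_small (zero_digit a b) hs hs1) (A := fun w => cyl w)).
    move=> w /close_words_size wl.
    have := content_le_single (@cyl (digit a b)) (cylw_ge0 hs) (cylw_small (zero_digit a b) hs hs1) w.
    by rewrite /cylw wl.
  move=> x /mem_close_words h; exists (mkseq x l) => //.
  exact: cyl_mkseq.
move=> n; rewrite -mulr_sumr mulrC -ler_pdivlMr //; exact: ue.
Qed.

End NullSets.

(** * Null sets of times and almost every slice *)

Section Times.
Variables (R : realType) (k : nat).
Hypothesis k0 : (0 < k)%N.
Local Notation L := (tree_content (F := digit 1 k) ((2^-1 : R) ^+ k)).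

Lemma exists_unit_cube (a b : nat) (t : 'M[R]_(a, b)) :
  exists (z : 'M[int]_(a, b)) (x : nat -> digit a b), t = map_mx intr z + bin_val R x.
Proof.
pose z : 'M[int]_(a, b) := \matrix_(i, j) Num.floor (t i j).
have [x Hx] : exists x : nat -> digit a b, bin_val R x = t - map_mx intr z.
  apply: bin_val_surj => i j; rewrite mxBE !mxE.
  by have := floor_itv (t i j); rewrite subr_ge0 ltrBlDl rmorphD /= => ->.
by exists z, x; rewrite Hx addrC subrK.
Qed.

Lemma tree_null_dyadic (N : set 'rV[R]_k) :
  (forall z : 'rV[int]_k, L [set x | N (map_mx intr z + bin_val R x)] = 0) ->
  dyadic_null (half_pow k%:R) N.
Proof.
move=> HN.
apply: (@dyadic_null_sub _ _ _ _
  (\bigcup_(z : 'rV[int]_k) [set t | N t /\ exists x, t = map_mx intr z + bin_val R x])).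
  by move=> t Nt; have [z [x tx]] := exists_unit_cube t; exists z => //; split=> //; exists x.
apply: dyadic_null_bigcup => [|z]; first by rewrite ltr0n.
(* A closed cube of side [2^-l] need not fit in the open ball of radius [2^-l] about its corner. *)
apply: (@dyadic_null_scale _ _ _ 2); first by rewrite ltr0n.
have := tree_contentP (zero_digit 1 k) (half_exp_gt0 R k) (half_exp_lt1 R k0)
  [set x | N (map_mx intr z + bin_val R x)].
rewrite HN => H e e0; have [u [uN ue]] := H e e0.
exists (fun i => (map_mx intr z + corner R (u i), size (u i))); split.
  move=> t [Nt [x tx]]; rewrite {t}tx in Nt *; have [i _ ix] := uN x Nt; exists i => // c j /=.
  rewrite (ord1 c) !mxDE opprD addrACA subrr add0r.
  apply: le_lt_trans (in_cube_close j (in_cube_corner R (u i)) (_ : in_cube _ (bin_val R x))) _.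
    by rewrite -{1}ix; exact: in_cube_val.
  by rewrite ltr_pMl ?exprn_gt0 // ltr1n.
move=> n; apply: le_trans (ue n); apply: ler_sum => i _.
by rewrite /dcost /cylw /= half_pow_nat.
Qed.

Variables (n : nat) (s : R).
Hypothesis s0 : 0 < s.

(* The function [f m] below is the sum of the costs of the balls over [x]; Markov's
   inequality bounds the content of the set [N m] where it exceeds [2^-m]. *)
Lemma dyadic_null_slices (B : set 'rV[R]_(k + n)) (z : 'rV[R]_k) :
  dyadic_null (half_pow (s + k%:R)) B ->
  L [set x | ~ dyadic_null (half_pow s) (slice B (z + bin_val R x))] = 0.
Proof.
move=> HB; have hs := half_pow_gt0 s.
have r0 := half_exp_gt0 R k; have r1 := half_exp_lt1 R k0.
apply/eqP; rewrite eq_le (tree_content_ge0 (zero_digit 1 k) r0 r1) andbT.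
apply: tree_content_le => //; apply: content_le_inf => eta eta0; rewrite add0r.
pose K : R := (3 ^ (1 * k))%:R.
have K0 : 0 < K by rewrite ltr0n expn_gt0.
have p0 m : 0 < 2^-1 ^+ m :> R by rewrite exprn_gt0 // half_gt0.
(* The allowance combines the threshold [2^-m], the target measure of [N m], and a division by the
   number [K] of cylinders per ball. *)
have /choice[u Hu] : forall m, exists u : nat -> 'rV[R]_(k + n) * nat, B `<=` \bigcup_i dball (u i) /\
    forall j, \sum_(i < j) half_pow s ^+ (u i).2 * 2^-1 ^+ k ^+ (u i).2 <=
      2^-1 ^+ m * (eta * 2^-1 ^+ m.+1) / K.
  move=> m; have e0 : 0 < 2^-1 ^+ m * (eta * 2^-1 ^+ m.+1) / K by rewrite divr_gt0 // !mulr_gt0.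
  have [u [uB ue]] := HB _ e0; rewrite add0r in ue; exists u; split=> // j.
  apply: le_trans (ue j); apply: ler_sum => i _.
  by rewrite -exprMn -half_pow_nat -half_powD.
pose near m i x := `[< mx_close (2^-1 ^+ (u m i).2) (lsubmx (u m i).1 - z) (bin_val R x) >].
pose f m j x : R := \sum_(i < j) if near m i x then half_pow s ^+ (u m i).2 else 0.
(* [tree_markov] treats finite sums; upward continuity of the content passes to the union over
   [j]. *)
pose N m := \bigcup_j [set x | 2^-1 ^+ m <= f m j x].
have finc m i j x : (i <= j)%N -> f m i x <= f m j x.
  move=> ij; rewrite /f -(big_mkord xpredT (fun i => if near m i x then half_pow s ^+ (u m i).2 else 0)).
  rewrite -(big_mkord xpredT (fun i => if near m i x then half_pow s ^+ (u m i).2 else 0)).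
  rewrite [leRHS](big_cat_nat (n := i)) //= lerDl sumr_ge0 // => l _.
  by case: ifP => // _; rewrite exprn_ge0 // ltW.
apply: (@content_le_le _ _ _ _ _ _ _ (\bigcup_m N m)); [exact: lexx| |].
  move=> x Hx; apply: contrapT => nN; apply: Hx.
  apply: content_le_inf => e e0; rewrite add0r.
  have [m me] := exists_expr_le (half_gt0 R) (half_lt1 R) e0.
  have [uB _] := Hu m.
  apply: (@content_le_le _ _ _ _ _ (2^-1 ^+ m) _
    (\bigcup_i (if near m i x then dball (rsubmx (u m i).1, (u m i).2) else set0))) => //.
    move=> y By; have [i _ iy] := uB _ By; exists i => //.
    have -> : near m i x.
      apply/asboolP => c j; have := iy c (lshift n j); rewrite row_mxEl mxDE mxBE.
      by rewrite /= opprD addrA [lsubmx _ _ _]mxE.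
    by move=> c j; have := iy c (rshift k j); rewrite row_mxEr /= [rsubmx _ _ _]mxE.
  apply: (content_le_bigcup (@dcost_ge0 R 1 n s)
      (e := fun i => if near m i x then half_pow s ^+ (u m i).2 else 0)).
    move=> i; case: ifP => _.
      exact (content_le_single (@dball R 1 n) (@dcost_ge0 R 1 n s)
        (fun e => @dcost_small R 1 n s e s0) (rsubmx (u m i).1, (u m i).2)).
    exact (content_le_set0 (@dball R 1 n) (@dcost_ge0 R 1 n s)
        (fun e => @dcost_small R 1 n s e s0) (lexx 0)).
  move=> j; rewrite leNgt; apply/negP => lt; apply: nN; exists m => //; exists j => //.
  exact: ltW.
apply: (content_le_bigcup (cylw_ge0 r0) (e := fun m => eta * 2^-1 ^+ m.+1)); last first.
  by move=> j; apply: sum_geo_half; exact: ltW.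
move=> m; apply/(tree_content_leP (zero_digit 1 k) r0 r1).
apply: (increasing_content (zero_digit 1 k) r0 r1) => [j x /= h|j].
  by apply: le_trans h _; exact: finc.
rewrite -(ler_pM2l (p0 m)).
pose sq := flatten [seq [seq (w, half_pow s ^+ (u m i).2) | w <- close_words (lsubmx (u m i).1 - z) (u m i).2]
   | i <- iota 0 j].
apply: (@le_trans _ _ (\sum_(q <- sq) q.2 * 2^-1 ^+ k ^+ size q.1)).
  apply: (tree_markov (zero_digit 1 k) r1 (half_exp_card R k)) => //; last first.
  - move=> x /= h; apply: le_trans h _.
    rewrite /f /sq big_flatten big_map -(big_mkord xpredT (fun i => if near m i x then half_pow s ^+ (u m i).2 else 0)).
    rewrite /index_iota subn0; apply: ler_sum => i _; rewrite big_map /=.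
    have rest0 : forall r : seq (seq (digit 1 k)), 0 <= \sum_(w <- r | mkseq x (size w) == w) half_pow s ^+ (u m i).2.
      by move=> r; apply: sumr_ge0 => w _; rewrite exprn_ge0 // ltW.
    case: ifPn => // /asboolP /mem_close_words h'.
    by rewrite (big_rem _ h') /= size_mkseq eqxx lerDl.
  - by move=> q /flatten_mapP[i _ /mapP[w _ ->]] /=; rewrite exprn_ge0 // ltW.
rewrite /sq big_flatten big_map.
have [_ ue] := Hu m; have := ue j; rewrite ler_pdivlMr // => h; apply: le_trans h.
rewrite -(big_mkord xpredT (fun i => half_pow s ^+ (u m i).2 * 2^-1 ^+ k ^+ (u m i).2)) /index_iota subn0.
rewrite mulr_suml; apply: ler_sum => i _; rewrite big_map /=.
rewrite (@eq_big_seq _ _ _ _ _ _ (fun=> half_pow s ^+ (u m i).2 * 2^-1 ^+ k ^+ (u m i).2)); last first.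
  by move=> w /close_words_size ->.
rewrite big_const_seq count_predT iter_addr_0 -[leLHS]mulr_natr ler_wpM2l //.
  by rewrite mulr_ge0 // exprn_ge0 // ltW.
by rewrite ler_nat size_close_words.
Qed.

End Times.

(** * Families of affine subspaces as families of matrices *)

Lemma mx_bounded (R : realType) a b (M : 'M[R]_(a, b)) :
  exists2 c, 0 <= c & forall i j, `|M i j| <= c.
Proof.
exists (\sum_i \sum_j `|M i j|); first by apply: sumr_ge0 => i _; exact: sumr_ge0.
move=> i j; rewrite (bigD1 i) //= (bigD1 j) //= -addrA lerDl addr_ge0 ?sumr_ge0 //.
by move=> i' _; exact: sumr_ge0.
Qed.

(** Over each of the [2^(k l)] cubes of times of level [l], the graphs from one cylinder of length
    [l] lie in one ball of radius of order [2^-l]. At the exponent [s + k] these balls cost together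
    [2^(-l s)], the cost of the cylinder. *)
Lemma graphs_null (R : realType) (k n : nat) (k0 : (0 < k)%N) (s : R) (s0 : 0 < s)
    (A : set (nat -> digit (1 + k) n)) (Z : 'M[R]_(1 + k, n)) (z : 'rV[R]_k) :
  tree_content (half_pow s) A = 0 ->
  dyadic_null (half_pow (s + k%:R)) [set p | exists x t, A x /\
    p = row_mx (z + bin_val R t) (affine_eval (Z + bin_val R x) (z + bin_val R t))].
Proof.
move=> A0; have hs := half_pow_gt0 s; have hs1 := half_pow_lt1 s0.
have sk0 : 0 < s + k%:R by rewrite addr_gt0 // ltr0n.
have [cZ cZ0 HZ] := mx_bounded Z; have [cz cz0 Hz] := mx_bounded z.
(* The terms account for a change of time, a change of matrix, and strictness. *)
pose c : R := k%:R * (cZ + 1) + (1 + k%:R * (cz + 1)) + 1.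
apply: (@dyadic_null_scale R 1 (k + n) c) => //.
apply: content_le_inf => e e0; rewrite add0r.
have := tree_contentP (zero_digit (1 + k) n) hs hs1 A; rewrite A0 => /(_ _ e0)[u [Au ue]].
rewrite add0r in ue.
apply: (@content_le_le _ _ _ _ _ _ _ (\bigcup_i [set p | exists x t, [/\ A x, cyl (u i) x &
    p = row_mx (z + bin_val R t) (affine_eval (Z + bin_val R x) (z + bin_val R t))]])); [exact: lexx| |].
  by move=> p [x [t [Ax ->]]]; have [i _ ix] := Au x Ax; exists i => //; exists x, t.
apply: (content_le_bigcup (@dcost_ge0 R 1 (k + n) (s + k%:R)) (e := fun i => cylw (half_pow s) (u i))) => // i.
pose l := size (u i).
have [[x0 xi]|ne] := pselect (exists x, cyl (u i) x); last first.
  apply: (@content_le_le _ _ _ _ _ 0 _ set0); first exact: cylw_ge0.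
    by move=> p [x [t [_ ix _]]]; apply: ne; exists x.
  exact (content_le_set0 _ (@dcost_ge0 R 1 (k + n) (s + k%:R))
    (fun e => @dcost_small R 1 (k + n) _ e sk0) (lexx 0)).
pose q (w : l.-tuple (digit 1 k)) : 'rV[R]_(k + n) * nat :=
  (row_mx (z + corner R w) (affine_eval (Z + bin_val R x0) (z + corner R w)), l).
apply: (@content_le_le _ _ _ _ _ (\sum_(w <- enum {: l.-tuple (digit 1 k)}) dcost (half_pow (s + k%:R)) (q w)) _
  [set p | exists x t, [/\ A x, cyl (u i) x &
    p = row_mx (z + bin_val R t) (affine_eval (Z + bin_val R x) (z + bin_val R t))]]) => //.
  rewrite /dcost /q /= big_const_seq count_predT iter_addr_0 -cardE card_tuple card_digit mul1n.
  rewrite -[leLHS]mulr_natl half_powD half_pow_nat exprMn mulrCA !natrX.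
  have -> : (2 : R) ^+ k ^+ l * 2^-1 ^+ k ^+ l = 1 by rewrite -exprMn -exprMn mulfV // !expr1n.
  by rewrite mulr1.
apply: (content_le_bigsum (@dcost_ge0 R 1 (k + n) (s + k%:R)) (fun e => @dcost_small R 1 (k + n) _ e sk0)
  (A := fun w => [set p | mx_close (c * 2^-1 ^+ (q w).2) (q w).1 p])).
  move=> w _.
  exact (content_le_single (fun q => [set p | mx_close (c * 2^-1 ^+ q.2) q.1 p])
    (@dcost_ge0 R 1 (k + n) (s + k%:R)) (fun e => @dcost_small R 1 (k + n) _ e sk0) (q w)).
move=> p [x [t [Ax ix ->]]].
exists [tuple of mkseq t l]; first by rewrite mem_enum.
have sl : size (mkseq t l) = l by rewrite size_mkseq.
have tclose j : `|(z + corner R (mkseq t l)) ord0 j - (z + bin_val R t) ord0 j| <= 2^-1 ^+ l.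
  rewrite !mxDE opprD addrACA subrr add0r -{2}sl.
  exact: (in_cube_close j (in_cube_corner R _) (in_cube_val R t l)).
have h0 : 0 < 2^-1 ^+ l :> R by rewrite exprn_gt0 // half_gt0.
have c1 : 1 < c.
  have g1 : 0 <= k%:R * (cZ + 1) by rewrite mulr_ge0 // addr_ge0.
  have g2 : 0 <= k%:R * (cz + 1) by rewrite mulr_ge0 // addr_ge0.
  rewrite /c; lra.
move=> i' j; rewrite (ord1 i') /q /=.
case: (split_ordP j) => [v ->|v ->]; rewrite ?row_mxEl ?row_mxEr.
  by apply: le_lt_trans (tclose v) _; rewrite ltr_pMl.
have b1 : `|affine_eval (Z + bin_val R x0) (z + corner R (mkseq t l)) ord0 v -
    affine_eval (Z + bin_val R x0) (z + bin_val R t) ord0 v| <= k%:R * (2^-1 ^+ l * (cZ + 1)).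
  apply: affine_eval_lip tclose => a b; rewrite mxDE.
  apply: le_trans (ler_normD _ _) _; apply: lerD => //.
  by have /andP[? ?] := bin_val01 R x0 a b; rewrite ger0_norm.
have b2 : `|affine_eval (Z + bin_val R x0) (z + bin_val R t) ord0 v -
    affine_eval (Z + bin_val R x) (z + bin_val R t) ord0 v| <= (1 + k%:R * (cz + 1)) * 2^-1 ^+ l.
  rewrite -mxBE -affine_evalB; apply: affine_eval_le; last 2 first.
  - exact: ltW.
  - move=> a; rewrite mxDE; apply: le_trans (ler_normD _ _) _; apply: lerD => //.
    by have /andP[? ?] := bin_val01 R t ord0 a; rewrite ger0_norm.
  - move=> a b; rewrite mxBE !mxDE opprD addrACA subrr add0r.
    by apply: bin_val_close; rewrite xi ix.
apply: le_lt_trans (ler_distD (affine_eval (Z + bin_val R x0) (z + bin_val R t) ord0 v) _ _) _.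
apply: le_lt_trans (lerD b1 b2) _.
have -> : k%:R * (2^-1 ^+ l * (cZ + 1)) = k%:R * (cZ + 1) * 2^-1 ^+ l by rewrite mulrCA mulrC.
by rewrite -mulrDl ltr_pM2r // /c ltrDl.
Qed.

(** * Euclidean norm and orthogonal projections *)

Section Euclid.
Variables (R : realType) (m : nat).
Implicit Types x y : 'rV[R]_m.

Lemma dot_productC x y : dot_product x y = dot_product y x.
Proof. by apply: eq_bigr => i _; rewrite mulrC. Qed.

Lemma dot_productDl x x' y : dot_product (x + x') y = dot_product x y + dot_product x' y.
Proof. by rewrite -big_split; apply: eq_bigr => i _; rewrite mxDE mulrDl. Qed.

Lemma dot_product_ge0 x : 0 <= dot_product x x.
Proof. by apply: sumr_ge0 => i _; rewrite -expr2 sqr_ge0. Qed.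

Lemma entry_le_eucl_norm x i : `|x ord0 i| <= eucl_norm x.
Proof.
rewrite -sqrtr_sqr ler_wsqrtr // /dot_product (bigD1 i) //= -expr2 lerDl.
by apply: sumr_ge0 => j _; rewrite -expr2 sqr_ge0.
Qed.

Lemma eucl_norm_le x (e : R) : (forall i, `|x ord0 i| <= e) -> 0 <= e ->
  eucl_norm x <= m%:R * e.
Proof.
move=> xe e0; rewrite -[leRHS]ger0_norm ?mulr_ge0 // -sqrtr_sqr ler_wsqrtr //.
apply: (@le_trans _ _ (\sum_(i < m) e ^+ 2)).
  apply: ler_sum => i _; rewrite -expr2 -[leLHS]ger0_norm ?sqr_ge0 // normrX.
  by rewrite ler_pXn2r // nnegrE.
rewrite sumr_const card_ord -[leLHS]mulr_natl exprMn ler_wpM2r ?sqr_ge0 //.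
by rewrite -natrX ler_nat; case: (m) => // j; rewrite -[leqLHS]expn1 leq_pexp2l.
Qed.

Lemma eucl_normZ (c : R) x : eucl_norm (c *: x) = `|c| * eucl_norm x.
Proof.
rewrite /eucl_norm -[`|c|]sqrtr_sqr -sqrtrM ?sqr_ge0 //; congr Num.sqrt.
by rewrite /dot_product mulr_sumr; apply: eq_bigr => i _; rewrite !mxE; ring.
Qed.

Lemma eucl_norm_ge0 x : 0 <= eucl_norm x. Proof. exact: sqrtr_ge0. Qed.

Lemma eucl_norm_eq0 x : eucl_norm x = 0 -> x = 0.
Proof.
move=> h; apply/matrixP => i j; rewrite (ord1 i) [RHS]mxE; apply/eqP.
by rewrite -normr_le0 -h entry_le_eucl_norm.
Qed.

Lemma eucl_norm_orthogonal x y : dot_product y x = 0 -> eucl_norm x <= eucl_norm (x + y).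
Proof.
move=> xy; rewrite ler_wsqrtr // dot_productDl (dot_productC x) (dot_productC y) !dot_productDl.
by rewrite (dot_productC x y) xy addr0 add0r lerDl dot_product_ge0.
Qed.

Variable V : {vspace 'rV[R]_m}.

(** The default value 0 of [xget] lies in [V] and has norm 0, so this fact and [eucl_norm_oproj]
    hold in both cases of the definition. *)
Lemma oproj_mem x : oproj V x \in V.
Proof. by rewrite /oproj; case: xgetP => [y -> []|_] //; exact: mem0v. Qed.

Lemma oproj_id x : x \in V -> oproj V x = x.
Proof.
move=> xV; rewrite /oproj; case: xgetP => [y _ [yV Hy]|/(_ x)]; last first.
  case; split=> // v _; rewrite subrr /dot_product big1 // => i _.
  by rewrite mxE mul0r.
apply/esym/eqP; rewrite -subr_eq0; apply/eqP/eucl_norm_eq0.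
by rewrite /eucl_norm Hy ?sqrtr0 // memvB.
Qed.

Lemma eucl_norm_oproj x : eucl_norm (oproj V x) <= eucl_norm x.
Proof.
rewrite /oproj; case: xgetP => [y _ [yV Hy]|_].
  by rewrite -[x in leRHS](subrK y) addrC eucl_norm_orthogonal ?Hy.
rewrite /eucl_norm /dot_product big1 ?sqrtr0 ?sqrtr_ge0 // => i _.
by rewrite mxE mul0r.
Qed.

End Euclid.

Lemma oproj_diff_ubound (R : realType) m (V V' : {vspace 'rV[R]_m}) :
  has_ubound [set eucl_norm (oproj V x - oproj V' x) | x in [set x | eucl_norm x <= 1]].
Proof.
exists (m%:R * 2) => _ [x /= x1 <-]; apply: eucl_norm_le => // j.
rewrite mxBE; apply: le_trans (ler_normB _ _) _.
have h W : `|oproj W x ord0 j| <= 1.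
  by apply: le_trans (entry_le_eucl_norm _ _) _; apply: le_trans (eucl_norm_oproj _ _) x1.
have := h V; have := h V'; lra.
Qed.

Lemma oproj_diff_le (R : realType) m (V V' : {vspace 'rV[R]_m}) v : v \in V ->
  exists2 w, w \in V' & forall i, `|(v - w) ord0 i| <=
    eucl_norm v * operator_norm (fun x => oproj V x - oproj V' x).
Proof.
move=> vV; have [v0|v0] := eqVneq (eucl_norm v) 0.
  exists 0; first exact: mem0v.
  by move=> i; rewrite v0 mul0r (eucl_norm_eq0 v0) subr0 mxE normr0.
(* [operator_norm] tests vectors of the unit ball, so [v] is normalized and the projection scaled
   back. *)
pose f x := oproj V x - oproj V' x; pose u := (eucl_norm v)^-1 *: v.
have nv : 0 < eucl_norm v by rewrite lt_neqAle eq_sym v0 eucl_norm_ge0.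
have u1 : eucl_norm u = 1 by rewrite eucl_normZ gtr0_norm ?invr_gt0 // mulVf.
exists (eucl_norm v *: oproj V' u); first by rewrite memvZ // oproj_mem.
move=> i; have -> : v - eucl_norm v *: oproj V' u = eucl_norm v *: f u.
  by rewrite /f [oproj V u]oproj_id ?memvZ // scalerBr scalerA mulfV // scale1r.
rewrite mxE normrM gtr0_norm // ler_pM2l //.
apply: le_trans (entry_le_eucl_norm _ _) _.
by apply: ub_le_sup; [exact: oproj_diff_ubound | exists u => //=; rewrite u1].
Qed.

Section Affine.
Variables (R : realType) (k n : nat).
Implicit Types P : affine_subspace R (k + n) k.

Definition is_graph P (M : 'M[R]_(1 + k, n)) :=
  points P = [set row_mx t (affine_eval M t) | t in [set: 'rV[R]_k]].

(** Non-verticality makes the projection of the direction onto R^k surjective; both have dimension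
    [k], so it is injective too. The rows of the linear part [W] are read off from preimages of the
    unit vectors. *)
Lemma non_vertical_graph P : non_vertical P -> exists M, is_graph P M.
Proof.
move=> nvP; pose V := direction P; pose a := offset P.
have surj t : exists2 v, v \in V & lsubmx v = t - lsubmx a.
  have : [set row_mx t' (0 : 'rV[R]_n) | t' in [set: 'rV[R]_k]] (row_mx t 0) by exists t.
  rewrite -nvP => -[_ [v /= vV <-] /eq_row_mx[e _]].
  by exists v => //; rewrite -e linearD addrK.
have /choice[b Hb] : forall i : 'I_k, exists v, v \in V /\ lsubmx v = delta_mx ord0 i.
  move=> i; have [v vV e] := surj (delta_mx ord0 i + lsubmx a); exists v; split=> //.
  by rewrite e addrK.
pose W : 'M[R]_(k, n) := \matrix_(i < k) rsubmx (b i).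
pose f : 'Hom('rV[R]_(k + n), 'rV[R]_k) := linfun (@lsubmx R 1 k n).
have ker0 v : v \in V -> lsubmx v = 0 -> v = 0.
  move=> vV v0.
  have img : (f @: V)%VS = fullv.
    apply/eqP; rewrite eqEsubv subvf /=; apply/subvP => t _.
    have [w wV e] := surj (t + lsubmx a).
    have -> : t = f w by rewrite lfunE /= e addrK.
    exact: memv_img.
  have := limg_ker_dim f V; rewrite img dimvf dim_matrix dim_direction.
  change ((1%N * k)%R) with (1 * k)%N; rewrite mul1n => /eqP; rewrite -[X in _ == X]add0n eqn_add2r dimv_eq0 => /eqP h0.
  apply/eqP; rewrite -memv0 -h0 memv_cap vV /=.
  by rewrite memv_ker lfunE /= v0.
have decomp v : v \in V -> rsubmx v = lsubmx v *m W.
  move=> vV; pose v' := \sum_i (lsubmx v) ord0 i *: b i.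
  have v'V : v' \in V by apply: memv_suml => i _; apply: memvZ; case: (Hb i).
  have lv' : lsubmx v' = lsubmx v.
    rewrite /v' linear_sum [RHS]row_sum_delta; apply: eq_bigr => i _.
    by rewrite linearZ /=; have [_ ->] := Hb i.
  have hz : lsubmx (v - v') = 0 by rewrite linearB /= lv' subrr.
  have /eqP := ker0 _ (memvB vV v'V) hz; rewrite subr_eq0 => /eqP ->.
  rewrite lv' {1}/v' linear_sum /= mulmx_sum_row; apply: eq_bigr => i _.
  by rewrite linearZ /= rowK.
exists (col_mx (rsubmx a - lsubmx a *m W) W).
have evE t : affine_eval (col_mx (rsubmx a - lsubmx a *m W) W) t = rsubmx a - lsubmx a *m W + t *m W.
  by rewrite /affine_eval mul_row_col mul1mx.
have pt v : v \in V -> v + a = row_mx (lsubmx v + lsubmx a)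
    (affine_eval (col_mx (rsubmx a - lsubmx a *m W) W) (lsubmx v + lsubmx a)).
  move=> vV; rewrite evE mulmxDl.
  rewrite -[LHS](@hsubmxK _ 1 k n) !linearD /= decomp //; congr row_mx.
  by rewrite addrACA addNr addr0 addrC.
apply/seteqP; split=> [_ [v /= vV <-]|_ [t _ <-]].
  by exists (lsubmx v + lsubmx a) => //; rewrite pt.
have [v vV e] := surj t; exists v => //; rewrite pt //.
by rewrite e subrK.
Qed.

Lemma is_graph_lsub P M p : is_graph P M -> points P p ->
  p = row_mx (lsubmx p) (affine_eval M (lsubmx p)).
Proof. by move=> -> [t _ <-]; rewrite row_mxKl. Qed.

(** Orthogonality of the offset bounds the norm of the direction part of [p] by that of [p], which
    makes the estimate depend on [p] alone. *)
Lemma points_close P P' p : points P p -> exists2 q, points P' q &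
  forall i, `|(p - q) ord0 i| <= (eucl_norm p + 1) * affine_dist P P'.
Proof.
move=> [v vV <-]; have [w wV Hw] := oproj_diff_le (direction P') vV.
exists (w + offset P'); first by exists w.
move=> i; have -> : v + offset P - (w + offset P') = (v - w) + (offset P - offset P').
  by rewrite opprD addrACA.
have nv : eucl_norm v <= eucl_norm (v + offset P).
  by apply: eucl_norm_orthogonal; exact: offset_orthogonal.
rewrite mxDE; apply: le_trans (ler_normD _ _) _.
have h1 := Hw i; have h2 := entry_le_eucl_norm (offset P - offset P') i.
rewrite /affine_dist; move: h1 h2; set o := operator_norm _; set f := eucl_norm (offset P - offset P').
have o0 : 0 <= o.
  apply: le_trans (eucl_norm_ge0 (oproj (direction P) 0 - oproj (direction P') 0)) _.
  apply: ub_le_sup; first exact: oproj_diff_ubound.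
  exists 0 => //=; rewrite /eucl_norm /dot_product big1 ?sqrtr0 // => j _.
  by rewrite mxE mul0r.
have f0 : 0 <= f by exact: eucl_norm_ge0.
have v0 := eucl_norm_ge0 v; move=> h1 h2.
apply: le_trans (lerD h1 h2) _.
have : eucl_norm v * o <= eucl_norm (v + offset P) * o by rewrite ler_wpM2r.
have : 0 <= eucl_norm (v + offset P) * f by rewrite mulr_ge0 // eucl_norm_ge0.
move: (eucl_norm (v + offset P)) => g; lra.
Qed.

(** The point of [P] over [t] is close to a point of [P'] over some [t'], and the slope bound on
    [M'] leads back from [t'] to [t]. Taking 0 and the unit vectors for [t] recovers the rows, a
    linear row being a difference of two values, whence the factor 2. The constant grows with [c],
    that is, towards vertical subspaces. *)
Lemma graph_lipschitz P P' M M' (c : R) : is_graph P M -> is_graph P' M' -> 0 <= c ->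
  (forall i j, `|M i j| <= c) -> (forall i j, `|M' i j| <= c) ->
  forall i j, `|M i j - M' i j| <=
    2 * ((1 + k%:R * c) * ((k + n)%:R * (1 + (1 + k%:R) * c) + 1)) * affine_dist P P'.
Proof.
move=> gP gP' c0 Mc M'c.
pose N : R := (k + n)%:R * (1 + (1 + k%:R) * c).
pose D := affine_dist P P'.
have N0 : 0 <= 1 + (1 + k%:R) * c by rewrite addr_ge0 // mulr_ge0 // addr_ge0.
have key (t : 'rV[R]_k) (j : 'I_n) : (forall i, `|t ord0 i| <= 1) ->
    `|affine_eval M t ord0 j - affine_eval M' t ord0 j| <= (1 + k%:R * c) * ((N + 1) * D).
  move=> t1; pose p := row_mx t (affine_eval M t) : 'rV[R]_(k + n).
  have pP : points P p by rewrite gP; exists t.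
  have pN : eucl_norm p <= N.
    apply: eucl_norm_le => // i; case: (split_ordP i) => [u ->|u ->]; rewrite ?row_mxEl ?row_mxEr.
      by apply: le_trans (t1 u) _; rewrite lerDl mulr_ge0 // addr_ge0.
    apply: le_trans (affine_eval_le u Mc c0 t1) _; by rewrite mulr1 lerDr.
  have [q qP' Hq] := points_close P' pP.
  have qE := is_graph_lsub gP' qP'; set t' := lsubmx q in qE.
  have D0 : 0 <= D.
    have := le_trans (normr_ge0 _) (Hq (rshift k j)).
    by rewrite pmulr_rge0 // ltr_wpDl // eucl_norm_ge0.
  have Hq' i : `|(p - q) ord0 i| <= (N + 1) * D.
    by apply: le_trans (Hq i) _; rewrite ler_wpM2r // lerD2r.
  have ht i : `|t ord0 i - t' ord0 i| <= (N + 1) * D.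
    by have := Hq' (lshift n i); rewrite mxBE qE !row_mxEl.
  have hy : `|affine_eval M t ord0 j - affine_eval M' t' ord0 j| <= (N + 1) * D.
    by have := Hq' (rshift k j); rewrite mxBE qE !row_mxEr.
  have hl := affine_eval_lip j M'c ht; rewrite distrC in hl.
  apply: le_trans (ler_distD (affine_eval M' t' ord0 j) _ _) _.
  apply: le_trans (lerD hy hl) _; rewrite le_eqVlt; apply/orP; left; apply/eqP; ring.
have k0 (j : 'I_n) : `|M (lshift k ord0) j - M' (lshift k ord0) j| <= (1 + k%:R * c) * ((N + 1) * D).
  have := key 0 j; rewrite !affine_evalE !big1 ?addr0; [|by move=> *; rewrite mxE mul0r..].
  by apply=> i; rewrite mxE normr0.
have key' (u : 'I_k) (j : 'I_n) : `|(M (lshift k ord0) j + M (rshift 1 u) j) - (M' (lshift k ord0) j + M' (rshift 1 u) j)|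
    <= (1 + k%:R * c) * ((N + 1) * D).
  have evd (A : 'M[R]_(1 + k, n)) : affine_eval A (delta_mx ord0 u) ord0 j =
      A (lshift k ord0) j + A (rshift 1 u) j.
    rewrite affine_evalE (bigD1 u) //= mxE !eqxx mul1r big1 ?addr0 // => v vu.
    by rewrite mxE (negbTE vu) andbF mul0r.
  have := key (delta_mx ord0 u) j; rewrite !evd; apply=> i.
  by rewrite mxE; case: (_ && _); rewrite ?normr1 ?normr0.
move=> i j; have -> : 2 * ((1 + k%:R * c) * ((k + n)%:R * (1 + (1 + k%:R) * c) + 1)) * affine_dist P P' =
  2 * ((1 + k%:R * c) * ((N + 1) * D)) by rewrite /N /D; ring.
have := k0 j; move: (key'); set B := (1 + k%:R * c) * _ => {}key'.
case: (split_ordP i) => [u ->|u ->]; first by rewrite (ord1 u); have := normr_ge0 (M (lshift k ord0) j - M' (lshift k ord0) j); lra.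
have := key' u j; rewrite !ler_norml => /andP[? ?] /andP[? ?]; apply/andP; split; lra.
Qed.

End Affine.

(** * The Fubini property *)

Section HausdorffDimension.
Variables (R : realType) (T : Type) (d : T -> T -> R).

Lemma hausdorff_measure_mono (s : R) (A A' : set T) : A `<=` A' ->
  (hausdorff_measure d s A <= hausdorff_measure d s A')%E.
Proof.
move=> AA; apply: ge_ereal_sup => _ [delta delta0 <-].
apply: le_trans (_ : hausdorff_premeasure d s delta A' <= _)%E; last first.
  by apply: ereal_sup_ubound; exists delta.
apply: ereal_inf_le_tmp => z [U [A'U dU ->]]; exists U; split=> //.
exact: subset_trans A'U.
Qed.

Lemma hausdorff_measure_ge0 (s : R) (A : set T) : (0 <= hausdorff_measure d s A)%E.
Proof.
apply: le_trans (_ : hausdorff_premeasure d s 1 A <= _)%E; last first.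
  by apply: ereal_sup_ubound; exists 1 => //=; exact: ltr01.
apply: le_ereal_inf_tmp => _ [U [_ _ ->]].
by apply: nneseries_ge0 => i _ _; rewrite /diam_pow; case: ifP => // _; exact: poweR_ge0.
Qed.

Lemma hausdorff_dim_lt (A : set T) (q : R) : (hausdorff_dim d A < q%:E)%E ->
  exists s, [/\ 0 <= s, s < q & hausdorff_measure d s A = 0%E].
Proof. by move=> /ereal_inf_lt[_ [s [s0 H0] <-]]; rewrite lte_fin => sq; exists s. Qed.

End HausdorffDimension.

Section EuclideanDimension.
Variables (R : realType) (m : nat).
Hypothesis m0 : (0 < m)%N.
Implicit Types (A : set 'rV[R]_m) (s q : R).

Lemma null_dyadic_eucl A s s' : 0 <= s -> s <= s' -> 0 < s' ->
  hausdorff_measure (@eucl_dist R m) s A = 0%E -> dyadic_null (half_pow s') A.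
Proof.
move=> s0 ss s'0 H0; rewrite -(image_id A).
apply: (hausdorff_null_dyadic ltr01 s0 ss s'0 _ _ H0); first by move=> *; exact: eucl_norm_ge0.
by move=> x y _ _ i j; rewrite mul1r (ord1 i) -mxBE; exact: entry_le_eucl_norm.
Qed.

Lemma dyadic_null_eucl A s : 0 < s -> dyadic_null (half_pow s) A ->
  hausdorff_measure (@eucl_dist R m) s A = 0%E.
Proof.
move=> s0 HA; have c0 : 0 < m%:R :> R by rewrite ltr0n.
apply: (@dyadic_null_hausdorff R _ _ _ _ id _ c0) => //.
- by move=> *; exact: eucl_norm_ge0.
- move=> x y e xy; apply: eucl_norm_le => [i|].
    by rewrite mxBE ltW.
  by apply: le_trans (ltW (xy ord0 (Ordinal m0))).
- by rewrite image_id.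
Qed.

Lemma dyadic_null_dim_le A s : 0 < s -> dyadic_null (half_pow s) A ->
  (hausdorff_dim (@eucl_dist R m) A <= s%:E)%E.
Proof.
move=> s0 HA; apply: ereal_inf_lbound; exists s => //; split; first exact: ltW.
exact: dyadic_null_eucl.
Qed.

Lemma dim_lt_dyadic_null A q : 0 < q -> (hausdorff_dim (@eucl_dist R m) A < q%:E)%E ->
  dyadic_null (half_pow q) A.
Proof. by move=> q0 /hausdorff_dim_lt[s [s0 sq]]; apply: null_dyadic_eucl => //; exact: ltW. Qed.

End EuclideanDimension.

Section Lower.
Variables (R : realType) (k n : nat).
Hypotheses (k0 : (0 < k)%N) (n0 : (0 < n)%N).
Local Notation L := (tree_content (F := digit 1 k) ((2^-1 : R) ^+ k)).

Let kR0 : 0 < k%:R :> R. Proof. by rewrite ltr0n. Qed.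

Lemma dyadic_null_proj sigma (B : set 'rV[R]_(k + n)) :
  dyadic_null sigma B -> dyadic_null sigma [set lsubmx p | p in B].
Proof.
move=> HB e e0; have [u [uB ue]] := HB e e0.
exists (fun i => (lsubmx (u i).1, (u i).2)); split=> //.
move=> _ [p Bp <-]; have [i _ ip] := uB p Bp; exists i => // a b /=.
by rewrite -mxBE -linearB /= mxE mxBE; exact: ip.
Qed.

Lemma null_tree_null (N : set 'rV[R]_k) (z : 'rV[R]_k) :
  hausdorff_measure (@eucl_dist R k) k%:R N = 0%E -> L [set x | N (z + bin_val R x)] = 0.
Proof.
move=> H0; have := null_dyadic_eucl (ltW kR0) (lexx _) kR0 H0.
by move=> /(dyadic_null_tree z kR0); rewrite half_pow_nat.
Qed.

Lemma fubini_lower (B : set 'rV[R]_(k + n)) : (forall t, exists y, B (row_mx t y)) ->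
  (ess_sup_slice_dim B + k%:R%:E <= hausdorff_dim (@eucl_dist R (k + n)) B)%E.
Proof.
move=> projB.
(* The projection of [B] is all of R^k, which settles the element 0 of the set defining the
   essential supremum. *)
have base s : 0 <= s -> hausdorff_measure (@eucl_dist R (k + n)) s B = 0%E -> k%:R <= s.
  move=> s0 H0; rewrite leNgt; apply/negP => sk.
  have := null_dyadic_eucl s0 (ltW sk) kR0 H0 => /dyadic_null_proj /(dyadic_null_tree 0 kR0).
  rewrite half_pow_nat; have -> : [set x | [set lsubmx p | p in B] (0 + bin_val R x)] = setT.
    apply/seteqP; split=> // x _; have [y' By'] := projB (0 + bin_val R x).
    by exists (row_mx (0 + bin_val R x) y') => //; rewrite row_mxKl.
  rewrite (tree_content_setT (zero_digit 1 k) (half_exp_lt1 R k0) (half_exp_card R k)) => /eqP.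
  by rewrite oner_eq0.
rewrite -leeBrDr //; apply: ge_ereal_sup => y [->|[q [q0 Hq] <-]]; rewrite leeBrDr //.
  rewrite add0e; apply: le_ereal_inf_tmp => _ [s [s0 H0] <-]; rewrite lee_fin; exact: base H0.
apply: le_ereal_inf_tmp => _ [s [s0 H0] <-]; rewrite -EFinD lee_fin leNgt; apply/negP => sq.
have ks := base s s0 H0.
have qpos : 0 < q by rewrite -(ltrD2r k%:R) add0r (le_lt_trans ks).
(* An exponent for null slices has to be positive, while [s - k%:R] may be 0; the maximum with
   [q / 2] stays below [q]. *)
pose r := Num.max (s - k%:R) (q / 2).
have r0 : 0 < r by rewrite lt_max divr_gt0 ?orbT.
have rq : r < q by rewrite gt_max ltrBlDr sq ltr_pdivrMr // ltr_pMr // ltr1n.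
have sr : s <= r + k%:R by rewrite -lerBlDr le_max lexx.
have rk0 : 0 < r + k%:R by rewrite addr_gt0.
have HB := null_dyadic_eucl s0 sr rk0 H0.
move: Hq; rewrite ltNge => /negP; apply.
rewrite (dyadic_null_eucl k0 kR0) //; apply: (tree_null_dyadic k0) => z.
apply/eqP; rewrite eq_le (tree_content_ge0 (zero_digit 1 k) (half_exp_gt0 R k) (half_exp_lt1 R k0)) andbT.
rewrite -(dyadic_null_slices k0 r0 (map_mx intr z) HB).
apply: (tree_content_mono (zero_digit 1 k) (half_exp_gt0 R k) (half_exp_lt1 R k0)) => x /= qlt nx.
have := lt_le_trans qlt (dyadic_null_dim_le n0 r0 nx).
by rewrite lte_fin ltNge (ltW rq).
Qed.

End Lower.

Section Union.
Variables (R : realType) (k n : nat).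
Hypotheses (k0 : (0 < k)%N) (n0 : (0 < n)%N).
Local Notation L := (tree_content (F := digit 1 k) ((2^-1 : R) ^+ k)).

Let kR0 : 0 < k%:R :> R. Proof. by rewrite ltr0n. Qed.

Variables (E : set (affine_subspace R (k + n) k)).
Variable gr : affine_subspace R (k + n) k -> 'M[R]_(1 + k, n).
Hypothesis grP : forall P, E P -> is_graph P (gr P).

Local Notation B := (\bigcup_(P in E) points P).

(** The part of the family in one integer translate of the unit cube of matrices, moved to the tree.
    Countably many translates exhaust the family. *)
Definition param_set (z : 'M[int]_(1 + k, n)) : set (nat -> digit (1 + k) n) :=
  [set x | exists2 P, E P & gr P = map_mx intr z + bin_val R x].

Lemma union_null s : 0 < s ->
  (forall z, tree_content (half_pow s) (param_set z) = 0) -> dyadic_null (half_pow (s + k%:R)) B.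
Proof.
move=> s0 H0; have sk0 : 0 < s + k%:R by rewrite addr_gt0.
apply: (dyadic_null_sub _ (dyadic_null_bigcup (I := ('M[int]_(1 + k, n) * 'rV[int]_k)%type) sk0
   (fun i => graphs_null k0 s0 (map_mx intr i.1) (map_mx intr i.2) (H0 i.1)))).
move=> p [P EP Pp]; have [z [x zx]] := exists_unit_cube (gr P).
have [z' [t zt]] := exists_unit_cube (lsubmx p).
exists (z, z') => //=; exists x, t; split; first by exists P.
by rewrite -zx -zt; exact: is_graph_lsub (grP EP) Pp.
Qed.

(** If the essential supremum were some [b < s], almost every slice would have dimension at most a
    [q] between [b] and [s], hence be null at the exponent [s]. This contradicts [slices_not_null]
    with [rho = 2^-s'] and [sigma = 2^-s], where [s' < 1] gives [rho > 1/2]. *)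
Lemma le_ess_sup z s s' : 0 < s -> s < s' -> s' < 1 -> borel B ->
  tree_content (half_pow s') (param_set z) != 0 -> (s%:E <= ess_sup_slice_dim B)%E.
Proof.
move=> s0 ss s1 bB nz; rewrite leNgt; apply/negP => lt.
have s'0 : 0 < s' by exact: lt_trans ss.
have b0 : (0 <= ess_sup_slice_dim B)%E by apply: ereal_sup_ubound; left.
have [b bE] : exists b, ess_sup_slice_dim B = b%:E.
  move: b0 lt; case: (ess_sup_slice_dim B) => [b|//|//] _ _; by exists b.
rewrite bE !lee_fin lte_fin in b0 lt.
pose q := (b + s) / 2.
have bq : b < q by rewrite /q; lra.
have qs : q < s by rewrite /q; lra.
have Hq : hausdorff_measure (@eucl_dist R k) k%:R
    [set t | (q%:E < hausdorff_dim (@eucl_dist R n) (slice B t))%E] = 0%E.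
  apply/eqP; rewrite eq_le hausdorff_measure_ge0 andbT leNgt; apply/negP => h.
  have : (q%:E <= ess_sup_slice_dim B)%E.
    apply: ereal_sup_ubound; right; exists q => //; split=> //.
    exact: le_trans b0 (ltW bq).
  by rewrite bE lee_fin leNgt bq.
have hz : 0 < tree_content (half_pow s') (param_set z).
  by rewrite lt_neqAle eq_sym nz (tree_content_ge0 (zero_digit _ _) (half_pow_gt0 s') (half_pow_lt1 s'0)).
have half1 : 2^-1 < half_pow s'.
  by have := half_pow_lt s1; rewrite -[1]/(1%:R) half_pow_nat expr1.
have AB x : param_set z x -> forall t, B (row_mx t (affine_eval (map_mx intr z + bin_val R x) t)).
  by move=> [P EP <-] t; exists P => //; rewrite (grP EP); exists t.
apply: (slices_not_null k0 half1 (half_pow_lt ss) (half_pow_lt1 s0) (borel_souslin bB) AB hz).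
apply/eqP; rewrite eq_le (tree_content_ge0 (zero_digit 1 k) (half_exp_gt0 R k) (half_exp_lt1 R k0)) andbT.
rewrite -(null_tree_null k0 0 Hq).
apply: (tree_content_mono (zero_digit 1 k) (half_exp_gt0 R k) (half_exp_lt1 R k0)) => x /= nx.
rewrite add0r ltNge; apply/negP => le; apply: nx.
by apply: (dim_lt_dyadic_null s0); apply: le_lt_trans le _; rewrite lte_fin.
Qed.

(* If the lower bound [1] for the slices failed, [le_ess_sup] would apply to an
   exponent below [1]. *)
Lemma fubini_dichotomy : borel B ->
  (ess_sup_slice_dim B + k%:R%:E < hausdorff_dim (@eucl_dist R (k + n)) B)%E ->
  exists2 s : R, 1 < s & (exists z, tree_content (half_pow s) (param_set z) != 0) /\
    (1 <= ess_sup_slice_dim B)%E.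
Proof.
move=> bB lt; set D := hausdorff_dim _ _ in lt.
have b0 : (0 <= ess_sup_slice_dim B)%E by apply: ereal_sup_ubound; left.
have [b bE] : exists b, ess_sup_slice_dim B = b%:E.
  move: b0 lt; case: (ess_sup_slice_dim B) => [b|_|//]; first by exists b.
  by rewrite addye // ltNge leey.
rewrite bE in b0 lt *; rewrite !lee_fin in b0 *; rewrite -EFinD in lt.
have nonnull s : b < s -> ((s + k%:R)%:E < D)%E -> exists z, tree_content (half_pow s) (param_set z) != 0.
  move=> bs sD; apply: contrapT => /forallNP H; move: sD; rewrite ltNge => /negP; apply.
  have s0 : 0 < s by exact: le_lt_trans bs.
  apply: dyadic_null_dim_le; [by rewrite addn_gt0 k0 | by rewrite addr_gt0 |].
  by apply: union_null => // z; apply/eqP; rewrite -[_ == _]negbK; apply/negP; exact: H.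
have [s bs sD] : exists2 s, b < s & ((s + k%:R)%:E < D)%E.
  move: lt; case: (D) => [e||//]; last by move=> _; exists (b + 1); rewrite ?ltrDl ?ltry.
  rewrite lte_fin => be; exists ((b + (e - k%:R)) / 2); rewrite ?lte_fin; lra.
have b1 : 1 <= b.
  rewrite leNgt; apply/negP => b1.
  (* An exponent between [b] and 1 at which the family is still not null; [le_ess_sup] at the
     midpoint of [b] and [s'] then gives a value above [b]. *)
  pose s' := Num.min s ((b + 1) / 2).
  have bs' : b < s' by rewrite lt_min bs; lra.
  have s'1 : s' < 1 by rewrite gt_min; apply/orP; right; lra.
  have s'D : ((s' + k%:R)%:E < D)%E.
    by apply: le_lt_trans sD; rewrite lee_fin lerD2r ge_min lexx.
  have [z nz] := nonnull _ bs' s'D.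
  have bm : 0 < (b + s') / 2 by rewrite divr_gt0 // ltr_wpDl // (le_lt_trans b0).
  have ms : (b + s') / 2 < s' by lra.
  have := le_ess_sup bm ms s'1 bB nz; rewrite bE lee_fin; lra.
by exists s; [exact: le_lt_trans bs | split=> //; exact: nonnull].
Qed.

Lemma graph_projection t : E !=set0 -> exists y, B (row_mx t y).
Proof.
by move=> [P EP]; exists (affine_eval (gr P) t), P => //; rewrite (grP EP); exists t.
Qed.

(** In one unit cube the entries of the matrices are bounded, so the passage from subspaces to
    matrices is Lipschitz there; the 1 added to [K / c] keeps the constant positive. *)
Lemma param_set_null (d : affine_subspace R (k + n) k -> affine_subspace R (k + n) k -> R) s z :
  is_metric d -> lipschitz_equivalent d (@affine_dist R (k + n) k) -> 0 < s ->
  (hausdorff_dim d E < s%:E)%E -> tree_content (half_pow s) (param_set z) = 0.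
Proof.
move=> [d0 _ _ _] [c [C [c0 _ dc]]] s0 /hausdorff_dim_lt[s' [s'0 ss H0]].
pose Ez := [set P | E P /\ exists x, gr P = map_mx intr z + bin_val R x].
have [cz cz0 Hz] := mx_bounded (map_mx intr z : 'M[R]_(1 + k, n)).
have gb P : Ez P -> forall i j, `|gr P i j| <= cz + 1.
  move=> [_ [x ->]] i j; rewrite mxDE; apply: le_trans (ler_normD _ _) _; apply: lerD => //.
  by have /andP[? ?] := bin_val01 R x i j; rewrite ger0_norm.
have cz1 : 0 <= cz + 1 by rewrite addr_ge0.
pose K : R := 2 * ((1 + k%:R * (cz + 1)) * ((k + n)%:R * (1 + (1 + k%:R) * (cz + 1)) + 1)).
have K0 : 0 <= K by rewrite /K !(mulr_ge0, addr_ge0).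
have Kc : 0 < K / c + 1 by rewrite ltr_wpDl // divr_ge0 // ltW.
have HE : hausdorff_measure d s' Ez = 0%E.
  apply/eqP; rewrite eq_le hausdorff_measure_ge0 andbT -H0.
  by apply: hausdorff_measure_mono => P [].
have lip P P' : Ez P -> Ez P' -> forall i j, `|gr P i j - gr P' i j| <= (K / c + 1) * d P P'.
  move=> eP eP' i j.
  have := graph_lipschitz (grP eP.1) (grP eP'.1) cz1 (gb _ eP) (gb _ eP') i j.
  move=> /le_trans; apply; rewrite -/K.
  have [h _] := dc P P'.
  apply: (@le_trans _ _ (K / c * d P P')); last by rewrite ler_wpM2r // lerDl.
  by rewrite -mulrA ler_wpM2l // ler_pdivlMl.
have := hausdorff_null_dyadic Kc s'0 (ltW ss) s0 d0 lip HE.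
move=> /(dyadic_null_tree (map_mx intr z) s0) h.
apply/eqP; rewrite eq_le (tree_content_ge0 (zero_digit _ _) (half_pow_gt0 s) (half_pow_lt1 s0)) andbT -h.
apply: (tree_content_mono (zero_digit _ _) (half_pow_gt0 s) (half_pow_lt1 s0)) => x [P EP e].
by exists P => //; split=> //; exists x.
Qed.

End Union.

Theorem corollary3p10 (R : realType) (k m : nat) (hk : (1 <= k)%N) (hkm : (k < m)%N) :
  (forall (d : affine_subspace R (k + (m - k)) k ->
               affine_subspace R (k + (m - k)) k -> R)
          (E : set (affine_subspace R (k + (m - k)) k)),
     is_metric d ->
     lipschitz_equivalent d (@affine_dist R (k + (m - k)) k) ->
     E !=set0 ->
     (forall P, E P -> non_vertical P) ->
     (hausdorff_dim d E <= 1%:E)%E ->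
     borel (\bigcup_(P in E) points P) ->
     fubini_property (\bigcup_(P in E) points P))
  /\
  (forall (B : set 'rV[R]_(k + (m - k))),
     borel B ->
     (exists E : set (affine_subspace R (k + (m - k)) k),
        [/\ E !=set0, forall P, E P -> non_vertical P &
            B = \bigcup_(P in E) points P]) ->
     (hausdorff_dim (@eucl_dist R (k + (m - k))) B < (k%:R + 1)%R%:E)%E ->
     fubini_property B).
Proof.
have n0 : (0 < m - k)%N by rewrite subn_gt0.
have graphs (E : set (affine_subspace R (k + (m - k)) k)) :
    (forall P, E P -> non_vertical P) -> exists gr, forall P, E P -> is_graph P (gr P).
  move=> nv.
  have /choice[gr Hgr] : forall P, exists M, E P -> is_graph P M.
    move=> P; have [/nv /non_vertical_graph[M PM]|nE] := pselect (E P); first by exists M.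
    by exists 0.
  by exists gr.
have lower (E : set (affine_subspace R (k + (m - k)) k)) gr :
    (forall P, E P -> is_graph P (gr P)) -> E !=set0 ->
    (ess_sup_slice_dim (\bigcup_(P in E) points P) + k%:R%:E <=
     hausdorff_dim (@eucl_dist R (k + (m - k))) (\bigcup_(P in E) points P))%E.
  move=> grP E0; apply: fubini_lower => // t; exact: graph_projection grP t E0.
split=> [d E dm dl E0 nv dE bB|B bB [E [E0 nv BE]] dB].
  have [gr grP] := graphs E nv.
  apply/eqP; rewrite eq_le (lower E gr) // andbT leNgt; apply/negP => lt.
  (* A family that is not null at an exponent above 1 contradicts [dE]. *)
  have [s s1 [[z nz] _]] := fubini_dichotomy hk grP bB lt.
  move/eqP: nz; apply; apply: (param_set_null grP _ dm dl); first exact: lt_trans s1.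
  by apply: le_lt_trans dE _; rewrite lte_fin.
rewrite {}BE in bB dB *; have [gr grP] := graphs E nv.
apply/eqP; rewrite eq_le (lower E gr) // andbT leNgt; apply/negP => lt.
(* Here the other half of the dichotomy is used: slices of dimension at least 1 already give [B]
   dimension above [k + 1]. *)
have [s s1 [_ b1]] := fubini_dichotomy hk grP bB lt.
have := lt_trans lt dB; rewrite EFinD [X in (_ < X)%E]addeC ltNge => /negP; apply.
exact: leeD2r.
Qed.
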